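(* For each integer $n\geq 0$, let $K_n := P(\Gamma,\{-2,\,2,\,-(3n+1),\,3\})$, where $\Gamma$ is the crossing-free planar projection of the complete graph $K_4$ on four vertices. Then $K_n$ is a knot and its Alexander polynomial satisfies $\Delta_{K_n}(t)=1$. Furthermore, the Jones polynomials satisfy $J_{K_n}(q)\neq J_{K_m}(q)$ whenever $n\neq m$; in particular $K_n$ is not isotopic to $K_m$ for $n\neq m$.
   Context: Graph-pretzel links. Let $\Gamma$ be a projection (diagram) of a spatial graph with vertices $v_1,\dots,v_i$, where $v_j$ has valence $r_j$, and let $\overline{\Gamma}$ be its mirror image with corresponding vertices $\overline{v_j}$. Embed $\Gamma$ in $\mathbb{R}^3$ in the slab $\{9/10\le z\le 11/10\}$ so that its projection to $\mathbb{R}^2\times\{1\}$ is the diagram $\Gamma$, and embed $\overline{\Gamma}$ in the slab $\{-11/10\le z\le -9/10\}$ as the reflection of the embedded $\Gamma$ in the plane $z=0$ (so $v_j\mapsto \overline{v_j}$). Truncate both graphs at every vertex. Given integers $n_1,\dots,n_i$, for each $j$ connect the $r_j$ endpoints of the truncated $\Gamma$ at $v_j$ to the $r_j$ endpoints of the truncated $\overline{\Gamma}$ at $\overline{v_j}$ by $r_j$ vertical strands carrying an $n_j/r_j$ twist. Here, for $r\ge1$, the $1/r$ twist of $r$ strands arranged on a circle is the braid rotating them by angle $2\pi/r$ (with a fixed handedness), an $n/r$ twist for $n\ge 0$ is $n$ stacked copies of the $1/r$ twist, and for $n<0$ it is $-n$ stacked copies of the mirror image of the $1/r$ twist; an $r/r$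 twist is a full twist. The resulting unoriented link is denoted $P(\Gamma,\{n_1,\dots,n_i\})$. For $\Gamma=K_4$ the link does not depend on how the four parameters are assigned to the four vertices. *)

(* Defs.v *)
From HB Require Import structures.
From mathcomp Require Import all_boot all_order all_algebra fraction.
Set Implicit Arguments. Unset Strict Implicit. Unset Printing Implicit Defensive.
Import Order.TTheory GRing.Theory Num.Theory.
Local Open Scope ring_scope.

(* A crossing is a 4-tuple (a,b,c,d) of edge labels, listed counterclockwise *)
(* around the crossing, where a,c are the two ends of the under-strand and   *)
(* b,d the two ends of the over-strand (slots 0,2 = under, 1,3 = over).      *)
(* A (well formed) PD code uses every label exactly twice; the two slots     *)
(* carrying the same label are joined by an edge of the diagram.             *)

Definition crossing := (nat * nat * nat * nat)%type.
Definition PD := seq crossing.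

Definition xlabel (x : crossing) (k : nat) : nat :=
  let: (a, b, c, d) := x in
  match k with 0 => a | 1 => b | 2 => c | _ => d end.

Section Diagram.
Variable p : PD.

Definition slot := ('I_(size p) * 'I_4)%type.

Definition slabel (s : slot) : nat := xlabel (nth (0, 0, 0, 0)%N p s.1) s.2.

Definition nbr (s : slot) : slot :=
  odflt s [pick t : slot | (t != s) && (slabel t == slabel s)].

Definition thr (s : slot) : slot := (s.1, inord ((s.2 + 2) %% 4)).

Definition step (s : slot) : slot := nbr (thr s).

Definition is_knot : bool :=
  (0 < size p)%N &&
  [forall s : slot, forall t : slot, fconnect step s t || fconnect step s (thr t)].

Definition Lring := {fraction {poly int}}.
Definition varA : Lring := FracField.tofrac ('X : {poly int}).

(* A-smoothing joins slots 0-1 and 2-3, B-smoothing joins 1-2 and 3-0 *)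
Definition smooth (b : bool) (s : slot) : slot :=
  (s.1, inord (nth 0%N (if b then [:: 1; 0; 3; 2] else [:: 3; 2; 1; 0])%N s.2)).

Definition state := {ffun 'I_(size p) -> bool}.

(* number of circles of the state st (each circle gives two orbits) *)
Definition nloops (st : state) : nat :=
  (fcard (fun s : slot => nbr (smooth (st s.1) s)) predT %/ 2)%N.

Definition kbracket : Lring :=
  \sum_(st : state)
     varA ^ (#|[set c | st c]|%:Z - #|[set c | ~~ st c]|%:Z)%R
     * (- varA ^+ 2 - varA ^- 2) ^+ (nloops st).-1.

(* Orientation of a knot diagram: fix some slot s0 and declare that the knot *)
(* enters the crossing of s0 through s0; a slot t is "entering" iff it lies  *)
(* on the forward traversal from s0.                                          *)
Definition entering (t : slot) : bool :=
  if [pick s : slot] is Some s0 then fconnect step s0 t else false.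

Definition in_under (c : 'I_(size p)) : 'I_4 :=
  if entering (c, inord 0) then inord 0 else inord 2.
Definition in_over (c : 'I_(size p)) : 'I_4 :=
  if entering (c, inord 1) then inord 1 else inord 3.

(* a crossing is positive iff the incoming over-slot is the one immediately *)
(* clockwise of the incoming under-slot                                     *)
Definition positive (c : 'I_(size p)) : bool :=
  (in_over c == ((in_under c + 3) %% 4)%N :> nat).

Definition writhe : int :=
  \sum_(c < size p) (if positive c then 1 else -1).

(* Jones polynomial, written in the variable A with t = A^(-4):             *)
(*   J(D) = (-A^3)^(-w(D)) <D>,   <unknot> = 1                              *)
Definition jones : Lring := (- varA ^+ 3) ^ (- writhe) * kbracket.

Definition under_slot (s : slot) : bool := ~~ odd s.2.

(* arcs (maximal over-passing segments) are indexed by the crossing where  *)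
(* they end, i.e. where they enter as under-strand                          *)
Fixpoint arc_end_aux (fuel : nat) (s : slot) : 'I_(size p) :=
  if fuel is fuel'.+1 then
    (if under_slot s then s.1 else arc_end_aux fuel' (step s))
  else s.1.
Definition arc_end (s : slot) : 'I_(size p) := arc_end_aux (4 * size p) s.

Definition over_arc (c : 'I_(size p)) := arc_end (c, in_over c).
Definition inc_arc (c : 'I_(size p)) := c.
Definition out_arc (c : 'I_(size p)) := arc_end (step (c, in_under c)).
(* the under-slot on the left of the (oriented) over-strand is in_over - 1 *)
Definition left_arc (c : 'I_(size p)) :=
  if ((in_over c + 3) %% 4)%N == in_under c :> nat then inc_arc c else out_arc c.
Definition right_arc (c : 'I_(size p)) :=
  if ((in_over c + 3) %% 4)%N == in_under c :> nat then out_arc c else inc_arc c.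

Definition alexander_matrix : 'M[{poly int}]_(size p) :=
  \matrix_(i, j) ((1 - 'X) *+ (over_arc i == j) + 'X *+ (right_arc i == j)
                  - (left_arc i == j)%:R).

(* Delta(t) = 1 (Alexander polynomials being defined up to units +-t^k of  *)
(* Z[t,t^-1]): every first principal minor of the Alexander matrix is a    *)
(* unit +- t^k.                                                            *)
Definition alexander_trivial : Prop :=
  forall i0 : 'I_(size p), exists (b : bool) (k : nat),
    \det (row' i0 (col' i0 alexander_matrix)) = (-1) ^+ b * 'X ^+ k.

End Diagram.

(* Gamma = crossing-free planar K_4: vertex 0 at the centre, vertices 1,2,3 *)
(* at angles 90, 210, 330 degrees.  The ends of edges at vertex v are the   *)
(* slots i = 0,1,2 in counterclockwise order; nbK4 v i is the neighbour.    *)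

Definition nbK4 (v i : nat) : nat :=
  if v == 0%N then i.+1 else nth 0%N [:: (v %% 3).+1; 0; ((v + 1) %% 3).+1]%N i.

Definition slotK4 (v w : nat) : nat := find (fun i => nbK4 v i == w) (iota 0 3).

Definition subm3 (i : nat) (m : int) : nat := `|((i%:Z - m) %% 3)%Z|%N.
Definition addm3 (i k : nat) : nat := ((i + k) %% 3)%N.

(* number of crossings on each ray / spiral of the twist region at a vertex *)
Definition cv (m : int) : nat := if 0 < m then (`|m|.-1)%N else `|m|%N.

Section Pretzel.
Variable tw : nat -> int.

Definition Bnd : nat := (2 * foldr maxn 0 [seq cv (tw v) | v <- iota 0 4]).+1.
(* label of the j-th segment of the strand that starts at the top end of   *)
(* slot i of vertex v                                                      *)
Definition lab (v i j : nat) : nat := ((3 * v + i) * Bnd + j)%N.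

(* the crossing in the middle of the edge {v,w}: the top (over) strand      *)
(* and the bottom (under) strand of the edge swap sides                     *)
Definition edge_crossing (v i : nat) : crossing :=
  let w := nbK4 v i in let i' := slotK4 w v in
  (lab v (subm3 i (tw v)) (2 * cv (tw v)), lab w i' 0,
   lab w (subm3 i' (tw w)) (2 * cv (tw w)), lab v i 0)%N.

(* crossing of the k-th step (1 <= k <= cv) of the (bottom) spiral starting *)
(* at slot i of vertex v with a (top) ray                                   *)
Definition vertex_crossing (v i k : nat) : crossing :=
  let m := tw v in let c := cv m in
  if 0 < m then
    let j := addm3 i k in
    (lab v i (c + k - 1), lab v j (c - k), lab v i (c + k), lab v j (c - k + 1))%N
  else
    let j := subm3 i k%:Z in
    (lab v i (c + k - 1), lab v j (c - k + 1), lab v i (c + k), lab v j (c - k))%N.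

Definition pretzelK4_pd : PD :=
  [seq edge_crossing vi.1 vi.2 |
     vi <- [seq (v, i) | v <- iota 0 4, i <- iota 0 3] & (vi.1 < nbK4 vi.1 vi.2)%N]
  ++ flatten [seq flatten [seq [seq vertex_crossing v i k | k <- iota 1 (cv (tw v))]
                          | i <- iota 0 3] | v <- iota 0 4].
End Pretzel.

Definition Kn (n : nat) : PD :=
  pretzelK4_pd (fun v => nth 0 [:: -2; 2; - (3 * n + 1)%:Z; 3] v).

(* Submission.v *)
(* A strand of the diagram first runs inward along a ray of a vertex, over     *)

(* The diagram grows with [n] only in the twist region of vertex 2, which consists of [3n + 1] rings
   and has period 3. So each claim splits into a fixed finite computation and the powers of one
   operator.

   Knot: the way the ends of the strands are connected depends on the twists modulo 3 only, so one
   itinerary through the twelve strands ([reached_all]) serves every [n]. It gives [is_knot_Kn] and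
   the orientation, and [writhe_Kn] computes the writhe as [n].

   Alexander polynomial: over Z[t,1/t] the Wirtinger relations identify all arcs.
   [spiral_closed_form] solves the twist region and [top_arcs_equal] inverts the remaining system,
   giving [arcs_equal]. By [planar_relation] the relations satisfy a linear dependency with
   coefficients + or - t^k, so any one of them is redundant. [principal_minor_unit] concludes from
   these two facts.

   Jones polynomial: it suffices to separate the values at one algebraic number A, with u = A^2 a
   root of u^2 + 3u + 1. There the bracket counts weighted 3-colourings ([laurent_eval_bracket]),
   the twist region contracts to an iterate of a 3x3 matrix ([csum_twist]), and the whole sum is a
   scalar product ([csum_all]). By [dot3_rec] and [jones_value] the normalised values V satisfy
   V(n+1) - V(n) = const * u^(6n). The constant is nonzero ([dot3_eigen_neq0]) and |u| is not 1
   ([norm_u_neq1]), whence [jones_injective]. *)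
(* everything, and then outward along a spiral, under the rays of that vertex; *)
(* so every arc is one of six over-arcs (the top edges of K_4) or a segment of *)
(* a spiral.                                                                   *)
(*                                                                             *)
(* Alexander polynomial: each relation at a spiral crossing expresses a spiral *)
(* arc through the previous one and an over-arc.  Along the long twist region  *)
(* this recursion has period 3 and is solved in closed form, which leaves a    *)
(* linear system in the six over-arcs with coefficients in Z[t,1/t,t^n]; it is *)
(* unimodular, so all arcs are equal in the Alexander module.  The planarity   *)
(* relation between the rows then makes every principal minor a unit.          *)
(*                                                                             *)
(* Jones polynomial: at A with - A^2 - A^-2 = 3 a state circle is worth three  *)
(* colours, so the bracket is a sum over 3-colourings of the edges with local  *)
(* weights.  A twist region is then a combination of the tensors of the        *)
(* noncrossing matchings of six points, on which one ring of crossings acts by *)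
(* a 3x3 matrix whose cube has eigenvalues - u^6 and - u^12, where u = A^2.    *)
(* After normalisation the value of the Jones polynomial of K_n is a + b u^6n  *)
(* with b nonzero and |u| different from 1.                                    *)
From Stdlib Require Import ZArith.
Require Import Defs.
From mathcomp Require Import all_boot all_order all_algebra fraction algC.
From mathcomp Require Import zify ssrZ ring.
Set Implicit Arguments. Unset Strict Implicit. Unset Printing Implicit Defensive.
Import Order.TTheory GRing.Theory Num.Theory.
Local Open Scope ring_scope.

(** * Circles and colourings *)

Section TwoInvolutions.
Variables (T : finType) (a b : T -> T).
Hypotheses (aK : involutive a) (bK : involutive b).
Hypotheses (a_free : forall x, a x != x) (b_free : forall x, b x != x).

Let g x := b (a x).
Let e := [rel x y | (a x == y) || (b x == y)].

Lemma dihedral_inj : injective g.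
Proof. by move=> x y; rewrite /g => /(can_inj bK)/(can_inj aK). Qed.
Let g_sym := fconnect_sym dihedral_inj.

Lemma dihedral_e_sym : connect_sym e.
Proof.
apply: sym_connect_sym => x y /=.
by apply/orP/orP => -[] /eqP <-; rewrite ?aK ?bK eqxx; auto.
Qed.
Let e_sym := dihedral_e_sym.

(** Conjugation by [a] inverts [g], so the equation with exponent k + 2 at [x] becomes the one with
    exponent k at [g x]. The descent ends in a fixed point of [a] or of [b]. *)
Lemma reflection_notin_orbit k x : a x <> iter k g x.
Proof.
have [m] := ubnP k; elim: m k x => // m IH [|[|k]] x ltkm /= eq_ax.
- by have /eqP[] := a_free x.
- by have /eqP[] := b_free (a x); exact: esym eq_ax.
apply: (IH k (g x)); first exact: ltnW.
apply: dihedral_inj; have -> : g (a (g x)) = a x by rewrite /g aK bK.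
by rewrite eq_ax -iterSr.
Qed.

Lemma connect_dihedral x y : connect e x y = fconnect g x y || fconnect g (a x) y.
Proof.
apply/idP/orP.
  case/connectP => p; elim: p x => [|z p IH] x /=; first by move=> _ ->; left.
  case/andP => exz pz ly; have := IH _ pz ly.
  case/orP: exz => /eqP exz; rewrite -exz ?aK; first by case; auto.
  case=> [xy|xy]; [right|left].
    apply: connect_trans xy; apply: connect1; rewrite /= /g aK //.
  by apply: connect_trans xy; rewrite g_sym; apply: connect1; rewrite /= /g aK bK.
have ge u v : fconnect g u v -> connect e u v.
  move=> /iter_findex <-; elim: (findex _ _ _) => //= k IH.
  apply: connect_trans IH _; apply: (@connect_trans _ _ (a (iter k g u))).
    by apply: connect1; rewrite /= eqxx.
  by apply: connect1; rewrite /= eqxx orbT.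
case=> /ge // axy; apply: connect_trans axy; apply: connect1.
by rewrite /= eqxx.
Qed.

(** A circle is a component of [e], and [g] runs along it in both directions: the orbits of [x] and
    [a x] are disjoint and exhaust the component. *)
Lemma fcard_dihedral : fcard g T = (2 * n_comp e T)%N.
Proof.
rewrite /n_comp_mem -!sum1_card.
rewrite (partition_big (fingraph.root e) (mem (roots e))) => [|x _]; last exact: roots_root.
rewrite big_distrr [RHS](eq_bigl (mem (roots e))) => [|x]; last first.
  by rewrite !inE andbT.
apply: eq_bigr => x rx; rewrite sum1_card /= muln1.
rewrite (@eq_card _ _ [set froot g x; froot g (a x)]) => [|y].
  rewrite cards2 (root_connect g_sym).
  case: (boolP (fconnect g x (a x))) => // /iter_findex eq_ax.
  by case: (reflection_notin_orbit (esym eq_ax)).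
rewrite !inE; apply/andP/orP => [[/andP[/= ry _] /eqP rxy]|].
  have : connect e x y by rewrite e_sym -rxy connect_root.
  by rewrite connect_dihedral -!(root_connect g_sym) (eqP ry) !(eq_sym y); case/orP; auto.
have cx u : fconnect g x u || fconnect g (a x) u -> fingraph.root e u == x.
  rewrite -connect_dihedral -(root_connect e_sym) => /eqP <-.
  exact: rx.
by case=> /eqP ->; rewrite !inE /= roots_root // cx // connect_root ?orbT.
Qed.

Variable C : finType.

(** An invariant colouring is a free choice of one colour per circle; [ext] spreads the colour of a
    root over its component. *)
Lemma card_invariant_colourings :
  #|[set f : {ffun T -> C} | [forall x, (f (a x) == f x) && (f (b x) == f x)]]|
  = (#|C| ^ (fcard g T %/ 2))%N.
Proof.
rewrite fcard_dihedral mulKn //.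
have -> : n_comp e T = #|{: {x | roots e x}}|.
  by rewrite card_sig /n_comp_mem; apply: eq_card => x; rewrite !inE andbT.
rewrite -card_ffun.
pose rt x : {x | roots e x} := exist _ (fingraph.root e x) (roots_root e_sym x).
pose ext (f : {ffun {x | roots e x} -> C}) : {ffun T -> C} := [ffun x => f (rt x)].
have ext_inj : injective ext.
  move=> f1 f2 /ffunP eqf; apply/ffunP => -[x rx].
  have := eqf x; rewrite !ffunE; suff -> : rt x = exist _ x rx by [].
  by apply: val_inj; apply/eqP.
rewrite -(card_imset _ ext_inj); apply: eq_card => f; rewrite inE.
have rt_eq x y : e x y -> rt x = rt y.
  by move=> exy; apply: val_inj; apply/eqP; rewrite /= root_connect // connect1.
apply/forallP/imsetP => [f_inv|[f' _ ->] x]; last first.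
  by rewrite !ffunE -(rt_eq x (a x)) ?(rt_eq x (b x)) /= ?eqxx ?orbT.
exists [ffun z => f (val z)] => //; apply/ffunP => x; rewrite !ffunE /=.
have : connect e x (fingraph.root e x) by exact: connect_root.
case/connectP => p; elim: p x (fingraph.root e x) => [|z p IH] x y /=; first by move=> _ ->.
case/andP => exz pz ly; rewrite -(IH z y pz ly).
have /andP[/eqP ax /eqP bx] := f_inv x.
by case/orP: exz => /eqP <-.
Qed.

(** Ensures that the exponent [(nloops st).-1] of the bracket is not truncated. *)
Lemma fcard_dihedral_gt1 (x : T) : (0 < fcard g T %/ 2)%N.
Proof.
rewrite fcard_dihedral mulKn //; apply/card_gt0P; exists (fingraph.root e x).
by rewrite !inE roots_root.
Qed.

End TwoInvolutions.

(** * Evaluation of Laurent polynomials inside the fraction field *)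

Section LaurentEvaluation.
Variables (F : fieldType) (A : F).
Hypothesis A_neq0 : A != 0.

Definition peval (P : {poly int}) : F := (map_poly intr P).[A].

(* [laurent_eval x y]: [x] is a Laurent polynomial in [varA] taking the value *)
(* [y] at [A].                                                                *)
Definition laurent_eval (x : Lring) (y : F) : Prop :=
  exists (P : {poly int}) (k : nat),
    x * varA ^+ k = FracField.tofrac P /\ y * A ^+ k = peval P.

Lemma varA_neq0 : varA != 0.
Proof. by rewrite tofrac_eq0 polyX_eq0. Qed.

(** Clearing denominators gives an identity between integer polynomials, and this can be evaluated
    at [A]. *)
Lemma laurent_eval_inj x y1 y2 :
  laurent_eval x y1 -> laurent_eval x y2 -> y1 = y2.
Proof.
move=> [P1 [k1 [x1 e1]]] [P2 [k2 [x2 e2]]].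
have : P1 * 'X^k2 = P2 * 'X^k1.
  apply/eqP; rewrite -tofrac_eq; apply/eqP; rewrite !tofracM !tofracXn -x1 -x2.
  by rewrite -!mulrA -!exprD addnC.
move/(congr1 peval); rewrite /peval !rmorphM !rmorphXn /= !map_polyX !hornerM !hornerXn.
rewrite -/(peval P1) -/(peval P2) -e1 -e2 -!mulrA -!exprD addnC.
by apply: mulIf; rewrite expf_neq0.
Qed.

Lemma laurent_evalM x1 y1 x2 y2 :
  laurent_eval x1 y1 -> laurent_eval x2 y2 -> laurent_eval (x1 * x2) (y1 * y2).
Proof.
move=> [P1 [k1 [e1 f1]]] [P2 [k2 [e2 f2]]]; exists (P1 * P2), (k1 + k2)%N.
by rewrite !exprD mulrACA e1 e2 tofracM mulrACA f1 f2 /peval rmorphM hornerM.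
Qed.

Lemma laurent_evalD x1 y1 x2 y2 :
  laurent_eval x1 y1 -> laurent_eval x2 y2 -> laurent_eval (x1 + x2) (y1 + y2).
Proof.
move=> [P1 [k1 [e1 f1]]] [P2 [k2 [e2 f2]]].
exists (P1 * 'X^k2 + P2 * 'X^k1), (k1 + k2)%N.
rewrite tofracD !tofracM !tofracXn -e1 -e2 /peval rmorphD !rmorphM !rmorphXn /=.
rewrite !map_polyX hornerD !hornerM !hornerXn -/(peval P1) -/(peval P2) -f1 -f2.
by rewrite -!mulrA -!exprD [(k2 + k1)%N]addnC -!mulrDl.
Qed.

Lemma laurent_eval0 : laurent_eval 0 0.
Proof. by exists 0, 0%N; rewrite !mul0r tofrac0 /peval rmorph0 horner0. Qed.

Lemma laurent_eval1 : laurent_eval 1 1.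
Proof. by exists 1, 0%N; rewrite !mulr1 tofrac1 /peval rmorph1 hornerC. Qed.

Lemma laurent_evalN x y : laurent_eval x y -> laurent_eval (- x) (- y).
Proof.
move=> [P [k [e f]]]; exists (- P), k.
by rewrite !mulNr e f tofracN /peval rmorphN hornerN.
Qed.

Lemma laurent_evalX x y k : laurent_eval x y -> laurent_eval (x ^+ k) (y ^+ k).
Proof.
move=> xy; elim: k => [|k IH]; first exact: laurent_eval1.
by rewrite !exprS; apply: laurent_evalM.
Qed.

Lemma laurent_eval_var : laurent_eval varA A.
Proof.
by exists 'X, 0%N; rewrite !mulr1 /peval map_polyX hornerX.
Qed.

Lemma laurent_eval_varV : laurent_eval varA^-1 A^-1.
Proof.
by exists 1, 1%N; rewrite !mulVf ?varA_neq0 // tofrac1 /peval rmorph1 hornerC.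
Qed.

Lemma laurent_eval_exprz x y (z : int) :
  laurent_eval x y -> laurent_eval x^-1 y^-1 -> laurent_eval (x ^ z) (y ^ z).
Proof.
move=> xy xyV; case: z => k; first by rewrite -!exprnP; apply: laurent_evalX.
by rewrite NegzE -!exprnN -!exprVn; apply: laurent_evalX.
Qed.

Lemma laurent_eval_sum (I : finType) (P : pred I) (f : I -> Lring) (g : I -> F) :
  (forall i, laurent_eval (f i) (g i)) ->
  laurent_eval (\sum_(i | P i) f i) (\sum_(i | P i) g i).
Proof.
by move=> fg; apply: big_ind2 => [|x1 x2 y1 y2|i _];
  [apply: laurent_eval0|apply: laurent_evalD|apply: fg].
Qed.

End LaurentEvaluation.

(** * The Kauffman bracket as a sum over colourings *)

Section ColourStateSum.
Variable p : PD.
Hypotheses (nbrK : involutive (@nbr p)) (nbr_free : forall s : slot p, nbr s != s).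

Lemma ord4_ind (Q : 'I_4 -> Prop) :
  Q (inord 0) -> Q (inord 1) -> Q (inord 2) -> Q (inord 3) -> forall q, Q q.
Proof.
by move=> Q0 Q1 Q2 Q3 [[|[|[|[|m]]]] // ltm];
  [move: Q0|move: Q1|move: Q2|move: Q3]; congr Q; apply: val_inj; rewrite /= inordK.
Qed.

Lemma smoothK b : involutive (@smooth p b).
Proof.
case=> c q; rewrite /smooth /=; congr pair.
by elim/ord4_ind: q; case: b; rewrite !inordK.
Qed.

Lemma smooth_free b (s : slot p) : smooth b s != s.
Proof.
case: s => c q; rewrite /smooth /= xpair_eqE eqxx -val_eqE /=.
by elim/ord4_ind: q; case: b; rewrite !inordK.
Qed.

Variables (F : fieldType) (A : F) (C : finType).
Hypotheses (A_neq0 : A != 0) (loop_value : #|C|%:R = - A ^+ 2 - A ^- 2).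
Hypothesis p_gt0 : (0 < size p)%N.

Definition nbr_invariant (f : {ffun slot p -> C}) := [forall s, f (nbr s) == f s].

Definition colour_weight (x0 x1 x2 x3 : C) : F :=
  A *+ ((x0 == x1) && (x2 == x3)) + A^-1 *+ ((x1 == x2) && (x3 == x0)).

Let smooth_inv (f : {ffun slot p -> C}) c b :=
  [forall q : 'I_4, f (smooth b (c, q)) == f (c, q)].

(** Expanding the product of the crossing weights chooses a smoothing at each crossing, that is, a
    state. A colouring survives in a state when it is constant on its circles, so the state is
    counted #|C|^[nloops] times. The bracket has one power less, hence the factor #|C| on the
    left. *)
Lemma laurent_eval_bracket : exists2 K : F, laurent_eval A (kbracket p) K &
  #|C|%:R * K = \sum_(f | nbr_invariant f) \prod_(c < size p)
    colour_weight (f (c, inord 0)) (f (c, inord 1)) (f (c, inord 2)) (f (c, inord 3)).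
Proof.
exists (\sum_(st : state p) A ^ (#|[set c | st c]|%:Z - #|[set c | ~~ st c]|%:Z)
     * (- A ^+ 2 - A ^- 2) ^+ (nloops st).-1).
  apply: laurent_eval_sum => st; apply: laurent_evalM.
    apply: laurent_eval_exprz; [exact: laurent_eval_var|exact: laurent_eval_varV].
  apply: laurent_evalX; apply: laurent_evalD.
    by apply/laurent_evalN/laurent_evalX/laurent_eval_var.
  by apply: laurent_evalN; rewrite -!exprVn; apply/laurent_evalX/laurent_eval_varV.
have sm_invol (st : state p) : involutive (fun s : slot p => smooth (st s.1) s).
  by move=> s; rewrite /= smoothK.
have sm_free (st : state p) s : smooth (st s.1) s != s by apply: smooth_free.
have -> : \sum_(f | nbr_invariant f) \prod_(c < size p)
    colour_weight (f (c, inord 0)) (f (c, inord 1)) (f (c, inord 2)) (f (c, inord 3))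
  = \sum_(f | nbr_invariant f) \prod_c \sum_(b : bool)
      (if b then A else A^-1) *+ smooth_inv f c b.
  apply: eq_bigr => f _; apply: eq_bigr => c _; rewrite big_bool /colour_weight.
  congr (_ *+ _ + _ *+ _); congr nat_of_bool.
    apply/andP/forallP => [[/eqP e1 /eqP e2]|sf].
      by elim/ord4_ind; rewrite /smooth /= !inordK // ?e1 ?e2.
    have := sf (inord 0); have := sf (inord 2).
    by rewrite /smooth /= !inordK // => /eqP -> /eqP ->.
  apply/andP/forallP => [[/eqP e1 /eqP e2]|sf].
    by elim/ord4_ind; rewrite /smooth /= !inordK // ?e1 ?e2.
  have := sf (inord 1); have := sf (inord 3).
  by rewrite /smooth /= !inordK // => /eqP -> /eqP ->.
under [RHS]eq_bigr do rewrite bigA_distr_bigA /=.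
rewrite exchange_big big_distrr; apply: eq_bigr => st _ /=.
rewrite mulrCA -{1}loop_value loop_value -exprS prednK; last first.
  rewrite /nloops; apply: (fcard_dihedral_gt1 (sm_invol st) nbrK (sm_free st) nbr_free).
  exact: (Ordinal p_gt0, inord 0).
rewrite -loop_value -natrX -card_invariant_colourings //.
rewrite -sum1_card natr_sum big_distrr /= (eq_bigl _ _ (in_set _)).
have wt : A ^ (#|[set c | st c]|%:Z - #|[set c | ~~ st c]|%:Z)
    = \prod_c (if st c then A else A^-1).
  rewrite (bigID st) /= expfzDr // -exprnN -!exprnP -exprVn; congr (_ * _).
    rewrite (eq_bigr (fun=> A)) => [|c ->//]; rewrite prodr_const.
    by congr (_ ^+ _); apply: eq_card => c; rewrite inE.
  rewrite (eq_bigr (fun=> A^-1)) => [|c /negbTE -> //]; rewrite prodr_const.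
  by congr (_ ^+ _); apply: eq_card => c; rewrite inE.
rewrite big_mkcond [RHS]big_mkcond; apply: eq_bigr => f _ /=.
case: (boolP (nbr_invariant f)) => [/forallP fn|nfn]; last first.
  case: ifP => // /forallP fa; case/negP: nfn; apply/forallP => s.
  by case/andP: (fa s).
case: ifP => [/forallP fa|nfa].
  rewrite mulr1 wt; apply: eq_bigr => c _; suff -> : smooth_inv f c (st c) by [].
  by apply/forallP => q; case/andP: (fa (c, q)).
have [c nc] : exists c, ~~ smooth_inv f c (st c).
  apply/existsP; rewrite -negb_forall; apply/negP => /forallP sa.
  move/negP: nfa; apply; apply/forallP => -[c q]; rewrite fn andbT.
  by have /forallP := sa c; apply.
by rewrite (bigD1 c) //= (negbTE nc) mulr0n mul0r.
Qed.

End ColourStateSum.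

(** * Structure of the diagram *)

Section Ends.
Variables (X : eqType) (names : seq X).

Definition ends_in (e : X * nat) := (e.1 \in names) && (e.2 < 4)%N.
Definition ethr (e : X * nat) : X * nat := (e.1, ((e.2 + 2) %% 4)%N).

Lemma ethr_in e : ends_in e -> ends_in (ethr e).
Proof. by case/andP => xin _; rewrite /ends_in xin ltn_mod. Qed.

Lemma ethrK e : ends_in e -> ethr (ethr e) = e.
Proof. by case: e => x q /andP[/= _ ltq]; rewrite /ethr /=; congr pair; lia. Qed.

End Ends.

Section NamedDiagram.
Variables (X L : eqType) (x0 : X) (names : seq X) (cr : X -> crossing).
Hypotheses (names_uniq : uniq names) (x0_in : x0 \in names).
Let p : PD := [seq cr x | x <- names].

Lemma named_size : size p = size names. Proof. exact: size_map. Qed.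

Lemma named_gt0 : (0 < size p)%N.
Proof. by rewrite named_size; case: names x0_in. Qed.

Definition named (x : X) : 'I_(size p) := insubd (Ordinal named_gt0) (index x names).
Definition nslot (e : X * nat) : slot p := (named e.1, inord e.2).

Lemma val_named x : x \in names -> named x = index x names :> nat.
Proof.
move=> xin; rewrite [LHS]val_insubd; suff -> : (index x names < size p)%N by [].
by rewrite named_size index_mem.
Qed.

Lemma named_inj : {in names &, injective named}.
Proof.
move=> x y xin yin /(congr1 val) /=; rewrite !val_named // => /(congr1 (nth x0 names)).
by rewrite !nth_index.
Qed.

Lemma named_surj (c : 'I_(size p)) : exists2 x, x \in names & c = named x.
Proof.
have ltc : (c < size names)%N by rewrite -named_size.
exists (nth x0 names c); first exact: mem_nth.
by apply: val_inj; rewrite /= val_named ?mem_nth // index_uniq.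
Qed.

Lemma nslot_inj : {in ends_in names &, injective nslot}.
Proof.
move=> [x q] [y r] /andP[/= xin ltq] /andP[/= yin ltr] [/(named_inj xin yin) -> eqr].
by move/(congr1 val): eqr; rewrite /= !inordK // => ->.
Qed.

Lemma nslot_surj (s : slot p) : exists2 e, ends_in names e & s = nslot e.
Proof.
case: s => c q; have [x xin ->] := named_surj c.
exists (x, val q); first by rewrite /ends_in xin ltn_ord.
by rewrite /nslot /= inord_val.
Qed.

Lemma slabel_nslot e : ends_in names e -> slabel (nslot e) = xlabel (cr e.1) e.2.
Proof.
case: e => x q /andP[/= xin ltq]; rewrite /slabel /= inordK //.
by rewrite val_named // (nth_map x0) ?index_mem // nth_index.
Qed.

Lemma thr_nslot e : ends_in names e -> thr (nslot e) = nslot (ethr e).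
Proof. by case: e => x q /andP[_ /= ltq]; rewrite /thr /nslot /= inordK. Qed.

Lemma big_named (R : Type) (idx : R) (op : Monoid.com_law idx) (f : 'I_(size p) -> R) :
  \big[op/idx]_(c < size p) f c = \big[op/idx]_(x <- names) f (named x).
Proof.
rewrite -(big_map named xpredT f); apply: perm_big; apply: uniq_perm.
- exact: index_enum_uniq.
- by rewrite map_inj_in_uniq //; exact: named_inj.
move=> c; rewrite mem_index_enum; have [x xin ->] := named_surj c.
by rewrite map_f.
Qed.

(* [F l] and [G l] are the two ends of the edge [l]. *)
Variables (lbl : X * nat -> L) (code : L -> nat) (valid : pred L) (F G : L -> X * nat).
Hypothesis code_inj : {in valid &, injective code}.
Hypothesis lblP : forall e, ends_in names e ->
  [/\ valid (lbl e), xlabel (cr e.1) e.2 = code (lbl e) & e = F (lbl e) \/ e = G (lbl e)].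
Hypothesis endsP : forall l, valid l ->
  [/\ ends_in names (F l), ends_in names (G l), lbl (F l) = l, lbl (G l) = l & F l != G l].

Lemma slabel_lbl e : ends_in names e -> slabel (nslot e) = code (lbl e).
Proof. by move=> ein; rewrite slabel_nslot //; case: (lblP ein). Qed.

(** [nbr] picks any other slot with the same label; the choice is forced because [F] and [G] are the
    only two ends of a label. *)
Lemma nbr_partner e e' : ends_in names e -> ends_in names e' -> e != e' -> lbl e = lbl e' ->
  nbr (nslot e) = nslot e'.
Proof.
move=> ein e'in neq eql; rewrite /nbr; case: pickP => [t /andP[neqt /eqP]|none].
  have [f fin def_t] := nslot_surj t; rewrite {t}def_t in neqt *.
  have [vf _ Ff] := lblP fin; have [ve _ Fe] := lblP ein; have [ve' _ Fe'] := lblP e'in.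
  rewrite !slabel_lbl // => /(code_inj vf ve) eqf /=; congr nslot.
  have neqf : f != e by apply: contraNneq neqt => ->.
  rewrite eqf in Ff; rewrite -eql in Fe'.
  move: (lbl e) Ff Fe Fe' neqf neq => l.
  by case=> -> [] -> [] ->; rewrite ?eqxx.
have := none (nslot e'); rewrite !slabel_lbl // eql eqxx andbT.
by rewrite (inj_in_eq nslot_inj) // eq_sym neq.
Qed.

Lemma nbr_F l : valid l -> nbr (nslot (F l)) = nslot (G l).
Proof.
by case/endsP => Fin Gin lF lG neq; rewrite (nbr_partner (e' := G l)) // lF lG.
Qed.

Lemma nbr_G l : valid l -> nbr (nslot (G l)) = nslot (F l).
Proof.
by case/endsP => Fin Gin lF lG neq; rewrite (nbr_partner (e' := F l)) // ?lF ?lG // eq_sym.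
Qed.

Lemma slot_FG (s : slot p) :
  exists2 l, valid l & s = nslot (F l) \/ s = nslot (G l).
Proof.
have [e ein ->] := nslot_surj s; have [vl _ FG] := lblP ein.
by exists (lbl e) => //; case: FG => <-; auto.
Qed.

Lemma named_nbrK : involutive (@nbr p).
Proof. by move=> s; have [l vl [] ->] := slot_FG s; rewrite ?nbr_F ?nbr_G ?nbr_F. Qed.

Lemma named_nbr_free (s : slot p) : nbr s != s.
Proof.
have [l vl FG] := slot_FG s; have [Fin Gin _ _ neq] := endsP vl.
by case: FG => ->; rewrite ?nbr_F ?nbr_G // (inj_in_eq nslot_inj) // eq_sym.
Qed.

Lemma slabel_nbr (s t : slot p) : slabel s = slabel t -> s = t \/ nbr s = t.
Proof.
have [e ein ->] := nslot_surj s; have [f fin ->] := nslot_surj t.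
rewrite !slabel_lbl //; have [ve _ _] := lblP ein; have [vf _ _] := lblP fin.
move/(code_inj ve vf) => eql; have [->|neq] := eqVneq e f; first by left.
by right; apply: nbr_partner.
Qed.

Lemma thrK : involutive (@thr p).
Proof.
move=> s; have [e ein ->] := nslot_surj s.
by rewrite !thr_nslot ?(ethrK ein) ?ethr_in.
Qed.

Lemma step_inj : injective (@step p).
Proof. by move=> s t /(can_inj named_nbrK)/(can_inj thrK). Qed.

(** Reversal of travel: [thr] conjugates [step] to its inverse. *)
Lemma step_thr_step (s : slot p) : step (thr (step s)) = thr s.
Proof. by rewrite /step thrK named_nbrK. Qed.

Lemma fconnect_thr (s t : slot p) :
  fconnect (@step p) s t -> fconnect (@step p) (thr t) (thr s).
Proof.
move=> /iter_findex <-; elim: (findex _ _ _) => //= k IH.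
by apply: connect_trans IH; apply: connect1; rewrite /= step_thr_step.
Qed.

(* A set of slots containing exactly one end of each strand at each crossing  *)
(* and contained in one [step]-orbit exhibits the diagram as a knot.          *)
Variables (E : pred (slot p)) (s0 : slot p).
Hypothesis Ethr : forall s, E (thr s) = ~~ E s.
Hypothesis Econn : forall s, E s -> fconnect (@step p) s0 s.
Hypothesis Estep : forall s, E s -> E (step s).
Hypothesis Es0 : E s0.

Lemma named_is_knot : is_knot p.
Proof.
have sym := fconnect_sym step_inj.
have Econn2 s t : E s -> E t -> fconnect (@step p) s t.
  by move=> Es Et; apply: connect_trans (Econn Et); rewrite sym Econn.
apply/andP; split; first exact: named_gt0.
apply/forallP => s; apply/forallP => t.
have [Es|nEs] := boolP (E s); have [Et|nEt] := boolP (E t).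
- by rewrite Econn2.
- by rewrite orbC Econn2 // Ethr.
- by rewrite orbC -[s]thrK; apply/orP; left; apply/fconnect_thr/Econn2; rewrite ?Ethr.
by rewrite -[s]thrK -[t]thrK; apply/orP; left; apply/fconnect_thr/Econn2; rewrite ?Ethr.
Qed.

Lemma fconnect_E s : fconnect (@step p) s0 s = E s.
Proof.
apply/idP/idP; last exact: Econn.
by move=> /iter_findex <-; elim: (findex _ _ _) => //= k /Estep.
Qed.

End NamedDiagram.

(** [pick] returns the head of the enumeration, so the orientation in [entering] is based at slot 0
    of the first crossing. *)
Lemma pick_slot (p : PD) (p_gt0 : (0 < size p)%N) :
  [pick s : slot p] = Some (Ordinal p_gt0, ord0).
Proof.
have enum_cons m (gt0 : (0 < m)%N) : exists r, enum 'I_m = Ordinal gt0 :: r.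
  case: m gt0 => // m gt0; rewrite enum_ordSl.
  by exists [seq lift ord0 i | i <- enum 'I_m]; congr cons; apply: val_inj.
have [r1 E1] := enum_cons _ p_gt0; have [r2 E2] := enum_cons 4 isT.
suff [r Er] : exists r, enum {: slot p} = (Ordinal p_gt0, ord0) :: r.
  by rewrite /pick; set e := enum _; have -> : e = enum {: slot p} by []; rewrite Er.
rewrite enumT unlock /= /prod_enum E1 /= E2 /=.
eexists; congr cons; congr pair; exact: val_inj.
Qed.

Local Open Scope nat_scope.

Lemma uniq_flatten_key (K T : eqType) (s : seq K) (f : K -> seq T) (key : T -> K) :
  uniq s -> (forall a, uniq (f a)) -> (forall a x, x \in f a -> key x = a) ->
  uniq (flatten [seq f a | a <- s]).
Proof.
move=> us uf kf; elim: s us => //= a s IH /andP[nas us].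
rewrite cat_uniq uf IH // andbT; apply/hasPn => x /flatten_mapP[b bs xb].
by apply: contraNN nas => xa; rewrite -(kf _ _ xa) (kf _ _ xb).
Qed.

Ltac edge_cases H := move: H; rewrite !inE; do 5?[case/orP]; move=> /eqP[-> ->].

(** * Crossing names and edge labels of [Kn] *)

Section Structure.
Variable n : nat.

Definition ktw (v : nat) : int := nth 0%R [:: -2; 2; - (3 * n + 1)%:Z; 3]%R v.
Definition rings v := nth 0 [:: 2; 1; (3 * n).+1; 2] v.
(** The positive twists sit at the odd vertices 1 and 3. *)
Definition sgn (v : nat) := odd v.
(** The ray met by spiral [i] at step [k]; modulo 3 the term [2 * k] stands for - k, which avoids
    truncated subtraction. *)
Definition ray v i k := (i + (if sgn v then k else 2 * k)) %% 3.
Definition unray v j k := (j + (if sgn v then 2 * k else k)) %% 3.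
(* the strand of vertex [v] whose bottom end is at slot [i], and conversely *)
Definition bot v i := (i + nth 0 [:: 2; 1; 1; 0] v) %% 3.
Definition unbot v i := (i + nth 0 [:: 1; 2; 2; 0] v) %% 3.

(* [(v, i, 0)] is the crossing on the edge [i] of [v], and [(v, i, k)], for   *)
(* [0 < k], the crossing of step [k] of the spiral [i] at the vertex [v].     *)
Definition name := (nat * nat * nat)%type.
Definition kedges : seq (nat * nat) := [:: (0, 0); (0, 1); (0, 2); (1, 0); (1, 2); (2, 0)].
Definition knames : seq name :=
  [seq (vi.1, vi.2, 0) | vi <- kedges] ++
  flatten [seq flatten [seq [seq (v, i, k) | k <- iota 1 (rings v)] | i <- iota 0 3]
          | v <- iota 0 4].
Definition kcr (x : name) : crossing :=
  let: (v, i, k) := x in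
  if k == 0 then edge_crossing ktw v i else vertex_crossing ktw v i k.

Lemma cv_ktw v : v < 4 -> cv (ktw v) = rings v.
Proof. by case: v => [|[|[|[|v]]]] //= _; rewrite /cv /ktw /rings /=; case: ifP; lia. Qed.

Lemma ktw_gt0 v : v < 4 -> (0 < ktw v)%R = sgn v.
Proof. by case: v => [|[|[|[|v]]]] //= _; rewrite /ktw /sgn /=; lia. Qed.

Lemma subm3_ktw v i : v < 4 -> subm3 i (ktw v) = bot v i.
Proof. by case: v => [|[|[|[|v]]]] //= _; rewrite /ktw /subm3 /bot /=; lia. Qed.

Lemma Kn_names : Kn n = [seq kcr x | x <- knames].
Proof.
rewrite /Kn -[fun v => _]/ktw /pretzelK4_pd map_cat; congr cat; rewrite map_flatten.
congr flatten; rewrite -map_comp; apply/eq_in_map => v; rewrite mem_iota => /andP[_ ltv].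
rewrite /= cv_ktw // !cats0 !map_cat -!map_comp.
by congr (_ ++ _ ++ _); apply/eq_in_map => k; rewrite mem_iota /=; case: eqP => //; lia.
Qed.

Definition valid_name (x : name) :=
  let: (v, i, k) := x in
  if k == 0 then (v, i) \in kedges else [&& v < 4, i < 3 & k <= rings v].

Lemma mem_knames x : (x \in knames) = valid_name x.
Proof.
case: x => [[v i] k]; rewrite /knames mem_cat.
apply/orP/idP => [[/mapP[[v' i'] in_e [-> -> ->]] //|]|].
  case/flatten_mapP => v'; rewrite mem_iota => /andP[_ ltv] /flatten_mapP[i'].
  rewrite mem_iota => /andP[_ lti] /mapP[k']; rewrite mem_iota => ltk [-> -> ->].
  by rewrite /valid_name; case: eqP; lia.
rewrite /valid_name; case: eqP => [-> in_e|k0 /and3P[ltv lti ltk]]; [left|right].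
  by apply/mapP; exists (v, i).
apply/flatten_mapP; exists v; first by rewrite mem_iota.
apply/flatten_mapP; exists i; first by rewrite mem_iota.
by apply/mapP; exists k => //; rewrite mem_iota; lia.
Qed.

Lemma size_knames : size knames = 24 + 9 * n.
Proof. by do 4 rewrite /= ?(size_cat, size_map, size_iota); lia. Qed.

Lemma big_knames (R : Type) (idx : R) (op : Monoid.law idx) (f : name -> R) :
  \big[op/idx]_(x <- knames) f x =
  op (\big[op/idx]_(e <- kedges) f (e.1, e.2, 0))
     (\big[op/idx]_(v <- iota 0 4) \big[op/idx]_(i <- iota 0 3)
        \big[op/idx]_(k <- iota 1 (rings v)) f (v, i, k)).
Proof.
rewrite /knames big_cat big_map; congr (op _ _).
rewrite big_flatten big_map; apply: eq_bigr => v _.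
rewrite big_flatten big_map; apply: eq_bigr => i _.
by rewrite big_map.
Qed.

Lemma knames_uniq : uniq knames.
Proof.
have U v i : uniq [seq (v, i, k) | k <- iota 1 (rings v)].
  by rewrite map_inj_uniq ?iota_uniq // => k k' [].
rewrite /knames cat_uniq; apply/and3P; split=> //.
  apply/hasPn => x /flatten_mapP[v _ /flatten_mapP[i _ /mapP[k]]].
  rewrite mem_iota => ltk ->; apply/negP => /mapP[[v' i'] _ [_ _]]; lia.
apply: (uniq_flatten_key (key := fun x => x.1.1)) => // v.
  apply: (uniq_flatten_key (key := fun x => x.1.2)) => // i x /mapP[k _ ->] //.
by move=> x /flatten_mapP[i _ /mapP[k _ ->]].
Qed.

Definition label := (nat * nat * nat)%type.
Definition klab (l : label) := let: (v, i, r) := l in lab ktw v i r.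
Definition valid_label (l : label) :=
  let: (v, i, r) := l in [&& v < 4, i < 3 & r <= 2 * rings v].

(** Segment indices stay below the stride of [lab], so a label is decoded by quotient and
    remainder. *)
Lemma rings_lt_Bnd v : v < 4 -> 2 * rings v < Bnd ktw.
Proof.
move=> ltv; rewrite ltnS leq_mul2l /Bnd.
have -> : [seq cv (ktw w) | w <- iota 0 4] = [seq rings w | w <- iota 0 4].
  by apply/eq_in_map => w; rewrite mem_iota => /andP[_ /cv_ktw].
by case: v ltv => [|[|[|[|v]]]] //= _; lia.
Qed.

Lemma klab_inj : {in valid_label &, injective klab}.
Proof.
move=> [[v i] r] [[v' i'] r'] /and3P[ltv lti ler] /and3P[ltv' lti' ler'].
have rB := leq_ltn_trans ler (rings_lt_Bnd ltv).
have rB' := leq_ltn_trans ler' (rings_lt_Bnd ltv').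
rewrite /klab /lab => eql.
have eqr : r = r'.
  by move/(congr1 (fun m => m %% Bnd ktw)): eql; rewrite !modnMDl !modn_small.
have eqv : 3 * v + i = 3 * v' + i'.
  move/(congr1 (fun m => m %/ Bnd ktw)): eql; rewrite !divnMDl ?(leq_trans _ rB) //.
  by rewrite !divn_small // !addn0.
by rewrite eqr; congr (_, _, _); lia.
Qed.

Definition klbl (e : name * nat) : label :=
  let: ((v, i, k), q) := e in
  let w := nbK4 v i in let i' := slotK4 w v in
  if k == 0 then
    match q with
    | 0 => (v, bot v i, 2 * rings v) | 1 => (w, i', 0)
    | 2 => (w, bot w i', 2 * rings w) | _ => (v, i, 0)
    end
  else
    match q with
    | 0 => (v, i, rings v + k - 1)
    | 1 => (v, ray v i k, rings v - k + ~~ sgn v)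
    | 2 => (v, i, rings v + k)
    | _ => (v, ray v i k, rings v - k + sgn v)
    end.

Definition topend v i : name * nat :=
  let w := nbK4 v i in
  if v < w then ((v, i, 0), 3) else ((w, slotK4 w v, 0), 1).
Definition botend v i : name * nat :=
  let w := nbK4 v i in
  if v < w then ((v, i, 0), 0) else ((w, slotK4 w v, 0), 2).

(* [kF l] (resp. [kG l]) is the slot at the end of [l] nearer to the bottom   *)
(* (resp. top) end of its strand.                                             *)
Definition kF (l : label) : name * nat :=
  let: (v, i, r) := l in
  if r < rings v then ((v, unray v i (rings v - r), rings v - r), if sgn v then 1 else 3)
  else if r < 2 * rings v then ((v, i, (r - rings v).+1), 0)
  else botend v (unbot v i).
Definition kG (l : label) : name * nat :=
  let: (v, i, r) := l in if r is r'.+1 then ethr (kF (v, i, r')) else topend v i.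

Let ends := ends_in knames.

Lemma rings_gt0 v : v < 4 -> 0 < rings v.
Proof. by case: v => [|[|[|[|v]]]]. Qed.

Lemma ray_lt3 v i k : ray v i k < 3. Proof. exact: ltn_mod. Qed.
Lemma unray_lt3 v i k : unray v i k < 3. Proof. exact: ltn_mod. Qed.
Lemma unrayK v i k : i < 3 -> ray v (unray v i k) k = i.
Proof. by rewrite /ray /unray; case: sgn; lia. Qed.
Lemma rayK v i k : i < 3 -> unray v (ray v i k) k = i.
Proof. by rewrite /ray /unray; case: sgn; lia. Qed.

Lemma kF_ray v i k : i < 3 -> 0 < k -> k <= rings v ->
  kF (v, ray v i k, rings v - k) = ((v, i, k), if sgn v then 1 else 3).
Proof. by move=> lti k0 lek; rewrite /kF ifT; [rewrite subKn // rayK | lia]. Qed.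

Lemma kF_spiral v i k : 0 < k -> k <= rings v -> kF (v, i, rings v + k - 1) = ((v, i, k), 0).
Proof.
move=> k0 lek; rewrite /kF ifF ?ifT; try lia.
by congr (_, _, _, _); lia.
Qed.

(** Provides the hypothesis [lblP] of the general theory: edge crossings are enumerated, spiral
    crossings are treated uniformly in [k]. *)
Lemma klblP (e : name * nat) : ends e ->
  [/\ valid_label (klbl e), xlabel (kcr e.1) e.2 = klab (klbl e)
    & e = kF (klbl e) \/ e = kG (klbl e)].
Proof.
case: e => [[[v i] k] q] /andP[/=]; rewrite mem_knames /valid_name.
case: eqP => [-> in_e|/eqP k0 /and3P[ltv lti ltk]] ltq.
  split.
  - by case: q ltq => [|[|[|[|q]]]] // _; edge_cases in_e; rewrite /valid_label /= ?leqnn.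
  - have [ltv ltw] : v < 4 /\ nbK4 v i < 4 by edge_cases in_e.
    rewrite /kcr /= /edge_crossing !subm3_ktw // !cv_ktw //.
    by case: q ltq => [|[|[|[|q]]]].
  case: q ltq => [|[|[|[|q]]]] // _; edge_cases in_e;
    solve [by right | by left | by left; rewrite /= !ifF // /rings /=; lia].
have c0 := rings_gt0 ltv.
have rl := ray_lt3 v i k.
rewrite /klbl /kcr /=.
split.
- case: q ltq => [|[|[|[|q]]]] // _; rewrite /valid_label ltv ?lti ?rl /=;
    case: (sgn v); lia.
- rewrite /vertex_crossing /klab /= cv_ktw // ktw_gt0 // /ray /addm3 /subm3.
  by case: q ltq => [|[|[|[|q]]]] //= _; case: (sgn v) => /=; congr lab; lia.
have k_gt0 : 0 < k by rewrite lt0n.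
have Fr := kF_ray lti k_gt0 ltk; have Fs := @kF_spiral v i k k_gt0 ltk.
case: q ltq => [|[|[|[|q]]]] // _.
- by left; rewrite Fs.
- move: Fr; case: (sgn v) => Fr; rewrite ?addn0 ?addn1; first by left; rewrite Fr.
  by right; rewrite /kG Fr.
- right; have -> : rings v + k = (rings v + k - 1).+1 by lia.
  by rewrite /kG Fs.
move: Fr; case: (sgn v) => Fr; rewrite ?addn0 ?addn1; last by left; rewrite Fr.
by right; rewrite /kG Fr.
Qed.

Definition knext_top v i := (nbK4 v i, slotK4 (nbK4 v i) v).
Definition knext_bot v i :=
  let j := unbot v i in (nbK4 v j, bot (nbK4 v j) (slotK4 (nbK4 v j) v)).

Lemma ends_kF l : valid_label l -> ends (kF l).
Proof.
case: l => [[v i] r] /and3P[ltv lti ler]; rewrite /ends /ends_in mem_knames /kF.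
have c0 := rings_gt0 ltv.
case: ltnP => [ltr|ger]; first by rewrite /= ltv unray_lt3; case: eqP; case: (sgn v); lia.
case: ltnP => [ltr|gtr]; first by rewrite /= ltv lti /=; lia.
by move: ltv lti; case: v {c0 ler ger gtr} => [|[|[|[|v]]]] //;
  case: i => [|[|[|i]]].
Qed.

Lemma ends_kG l : valid_label l -> ends (kG l).
Proof.
case: l => [[v i] [|r]] /and3P[ltv lti ler]; last first.
  by rewrite /kG; apply/ethr_in/ends_kF; rewrite /valid_label ltv lti ltnW.
rewrite /ends /ends_in mem_knames /kG /=.
by move: ltv lti; case: v {ler} => [|[|[|[|v]]]] //; case: i => [|[|[|i]]].
Qed.

Lemma klbl_kF l : valid_label l -> klbl (kF l) = l.
Proof.
case: l => [[v i] r] /and3P[ltv lti ler]; rewrite /kF.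
have c0 := rings_gt0 ltv.
case: ltnP => [ltr|ger].
  rewrite /klbl; case: eqP => [|_]; first lia.
  by rewrite unrayK //; case: (sgn v) => /=; congr (_, _, _); lia.
case: ltnP => [ltr|gtr]; first by rewrite /=; congr (_, _, _); lia.
have -> : r = 2 * rings v by lia.
by move: ltv lti; case: v {c0 ler ger gtr} => [|[|[|[|v]]]] //;
  case: i => [|[|[|i]]].
Qed.

Lemma klbl_ethr_kF v i r : valid_label (v, i, r.+1) ->
  klbl (ethr (kF (v, i, r))) = (v, i, r.+1).
Proof.
move=> /and3P[ltv lti ler]; rewrite /kF.
have c0 := rings_gt0 ltv.
case: ltnP => [ltr|ger].
  rewrite /klbl /ethr /=; case: eqP => [|_]; first lia.
  by rewrite unrayK //; case: (sgn v) => /=; congr (_, _, _); lia.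
by rewrite ler /=; congr (_, _, _); lia.
Qed.

Lemma klbl_kG l : valid_label l -> klbl (kG l) = l.
Proof.
case: l => [[v i] [|r]]; last exact: klbl_ethr_kF.
by case/and3P; case: v => [|[|[|[|v]]]] //; case: i => [|[|[|i]]].
Qed.

Lemma kF_neq_kG l : valid_label l -> kF l != kG l.
Proof.
case: l => [[v i] [|r]] /and3P[ltv lti ler]; have c0 := rings_gt0 ltv.
  by rewrite /kF c0 /kG /topend; case: (v < nbK4 v i); rewrite /= !xpair_eqE; lia.
rewrite /kG /kF /ethr.
case: (ltnP r.+1) => [ltr|ger].
  by rewrite ltnW //= !xpair_eqE; case: (sgn v); lia.
case: (ltnP r.+1) => [ltr2|gtr].
  by rewrite (ltnW ltr2); case: (r < rings v); rewrite /= !xpair_eqE; case: (sgn v); lia.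
rewrite ler /botend; case: (r < rings v); case: (_ < nbK4 _ _);
  rewrite /= !xpair_eqE; case: (sgn v); lia.
Qed.

Lemma ethr_kG0 v i : v < 4 -> i < 3 ->
  ethr (kG (v, i, 0)) = kG (knext_top v i, 0).
Proof. by case: v => [|[|[|[|v]]]] //; case: i => [|[|[|i]]]. Qed.

Lemma ethr_kF_last v i : v < 4 -> i < 3 ->
  ethr (kF (v, i, 2 * rings v)) =
  kF (knext_bot v i, 2 * rings (knext_bot v i).1).
Proof.
have Flast w j : kF (w, j, 2 * rings w) = botend w (unbot w j).
  by rewrite /kF ltnn ltnNge leq_pmull.
rewrite Flast [in RHS](surjective_pairing (knext_bot v i)) Flast.
by case: v => [|[|[|[|v]]]] //; case: i => [|[|[|i]]].
Qed.

End Structure.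
Global Opaque knames.

(** * Traversal and orientation of [Kn] *)

Section Orientation.
Variable n : nat.
Notation c v := (rings n v).
Notation p := [seq kcr n x | x <- knames n].

Lemma x0_in : (0, 0, 0) \in knames n. Proof. by rewrite mem_knames. Qed.

Definition kname (x : name) : 'I_(size p) := named (kcr n) x0_in x.
Definition kslot (e : name * nat) : slot p := nslot (kcr n) x0_in e.

Lemma kends l : valid_label n l ->
  [/\ ends_in (knames n) (kF n l), ends_in (knames n) (kG n l),
      klbl n (kF n l) = l, klbl n (kG n l) = l & kF n l != kG n l].
Proof.
move=> vl; split; rewrite ?klbl_kF ?klbl_kG ?kF_neq_kG //.
  exact: ends_kF.
exact: ends_kG.
Qed.

Lemma nbr_kF l : valid_label n l -> nbr (kslot (kF n l)) = kslot (kG n l).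
Proof. exact: (nbr_F (knames_uniq n) x0_in (@klab_inj n) (@klblP n) kends). Qed.
Lemma nbr_kG l : valid_label n l -> nbr (kslot (kG n l)) = kslot (kF n l).
Proof. exact: (nbr_G (knames_uniq n) x0_in (@klab_inj n) (@klblP n) kends). Qed.
Lemma knbrK : involutive (@nbr p).
Proof. exact: (named_nbrK (knames_uniq n) x0_in (@klab_inj n) (@klblP n) kends). Qed.
Lemma knbr_free (s : slot p) : nbr s != s.
Proof. exact: (named_nbr_free (knames_uniq n) x0_in (@klab_inj n) (@klblP n) kends). Qed.
Lemma kslabel_nbr (s t : slot p) : slabel s = slabel t -> s = t \/ nbr s = t.
Proof. exact: (slabel_nbr (knames_uniq n) x0_in (@klab_inj n) (@klblP n)). Qed.
Lemma kslot_FG (s : slot p) :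
  exists2 l, valid_label n l & s = kslot (kF n l) \/ s = kslot (kG n l).
Proof. exact: (slot_FG (knames_uniq n) x0_in (@klblP n)). Qed.

Lemma thr_kF l : valid_label n l -> thr (kslot (kF n l)) = kslot (ethr (kF n l)).
Proof. by move=> vl; apply: thr_nslot; exact: ends_kF. Qed.
Lemma thr_kG l : valid_label n l -> thr (kslot (kG n l)) = kslot (ethr (kG n l)).
Proof. by move=> vl; apply: thr_nslot; exact: ends_kG. Qed.

Lemma valid_next_top v i r : v < 4 -> i < 3 -> r <= 2 * c (knext_top v i).1 ->
  valid_label n (knext_top v i, r).
Proof. by case: v => [|[|[|[|v]]]] //; case: i => [|[|[|i]]]. Qed.
Lemma valid_next_bot v i r : v < 4 -> i < 3 -> r <= 2 * c (knext_bot v i).1 ->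
  valid_label n (knext_bot v i, r).
Proof. by case: v => [|[|[|[|v]]]] //; case: i => [|[|[|i]]]. Qed.

Lemma step_kF v i r : valid_label n (v, i, r.+1) ->
  step (kslot (kF n (v, i, r))) = kslot (kF n (v, i, r.+1)).
Proof.
move=> /[dup] /and3P[ltv lti ltr] vl.
have vl' : valid_label n (v, i, r) by rewrite /valid_label ltv lti ltnW.
by rewrite /step thr_kF // -[ethr _]/(kG n (v, i, r.+1)) nbr_kG.
Qed.

Lemma step_kG v i r : valid_label n (v, i, r.+1) ->
  step (kslot (kG n (v, i, r.+1))) = kslot (kG n (v, i, r)).
Proof.
move=> /[dup] /and3P[ltv lti ltr] vl.
have vl' : valid_label n (v, i, r) by rewrite /valid_label ltv lti ltnW.
by rewrite /step thr_kG // [kG _ _]/= (ethrK (ends_kF vl')) nbr_kF.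
Qed.

Lemma step_kF_last v i : v < 4 -> i < 3 ->
  step (kslot (kF n (v, i, 2 * c v))) =
  kslot (kG n (knext_bot v i, 2 * c (knext_bot v i).1)).
Proof.
move=> ltv lti; rewrite /step thr_kF ?ethr_kF_last ?nbr_kF ?valid_next_bot //.
by rewrite /valid_label ltv lti /=.
Qed.

Lemma step_kG0 v i : v < 4 -> i < 3 ->
  step (kslot (kG n (v, i, 0))) = kslot (kF n (knext_top v i, 0)).
Proof.
move=> ltv lti; rewrite /step thr_kG ?ethr_kG0 ?nbr_kG ?valid_next_top //.
by rewrite /valid_label ltv lti /=.
Qed.

(* the strands that the knot runs through from top to bottom *)
Definition fwd v i := (v, i) \in [:: (0, 1); (0, 2); (1, 1); (2, 2); (3, 0); (3, 2)].

(** A strand travelled downwards enters crossings at the bottom ends [kF] of its labels, one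
    travelled upwards at the top ends [kG]. *)
Definition kent (e : name * nat) :=
  let l := klbl n e in (e == kF n l) == fwd l.1.1 l.1.2.
Definition kE (s : slot p) := kent (nth (0, 0, 0) (knames n) s.1, val s.2).

Lemma kE_kslot e : ends_in (knames n) e -> kE (kslot e) = kent e.
Proof.
case: e => x q /andP[/= xin ltq]; rewrite /kE /kslot /nslot /= inordK //.
by rewrite val_named // nth_index.
Qed.

Lemma kE_F v i r : valid_label n (v, i, r) -> kE (kslot (kF n (v, i, r))) = fwd v i.
Proof. by move=> vl; have [Fin _ lF _ _] := kends vl; rewrite kE_kslot // /kent lF eqxx. Qed.

Lemma kE_G v i r : valid_label n (v, i, r) -> kE (kslot (kG n (v, i, r))) = ~~ fwd v i.
Proof.
move=> vl; have [_ Gin _ lG neq] := kends vl; rewrite kE_kslot // /kent lG.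
by rewrite [_ == kF _ _]eq_sym (negbTE neq); case: (fwd _ _).
Qed.

Lemma kE_nbr s : kE (nbr s) = ~~ kE s.
Proof.
have [[[v i] r] vl [] ->] := kslot_FG s.
  by rewrite nbr_kF // kE_F // kE_G.
by rewrite nbr_kG // kE_F // kE_G // negbK.
Qed.

Lemma fwd_top v i : v < 4 -> i < 3 ->
  fwd (knext_top v i).1 (knext_top v i).2 = ~~ fwd v i.
Proof. by case: v => [|[|[|[|v]]]] //; case: i => [|[|[|i]]]. Qed.
Lemma fwd_bot v i : v < 4 -> i < 3 ->
  fwd (knext_bot v i).1 (knext_bot v i).2 = ~~ fwd v i.
Proof. by case: v => [|[|[|[|v]]]] //; case: i => [|[|[|i]]]. Qed.

Lemma kE_step s : kE (step s) = kE s.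
Proof.
have [[[v i] r] vl] := kslot_FG s; have /and3P[ltv lti ltr] := vl.
case=> ->.
  have [lt|ge] := ltnP r (2 * c v); first by rewrite step_kF ?kE_F //; apply/and3P.
  have -> : r = 2 * c v by lia.
  have := @valid_next_bot v i _ ltv lti (leqnn _); have := fwd_bot ltv lti.
  rewrite step_kF_last //; case: (knext_bot v i) => v' i' /= fw vl'.
  by rewrite kE_G // kE_F ?fw ?negbK //; apply/and3P.
case: r vl ltr => [|r] vl ltr.
  have := @valid_next_top v i _ ltv lti (leq0n _); have := fwd_top ltv lti.
  rewrite step_kG0 //; case: (knext_top v i) => v' i' fw vl'; rewrite [fwd _ _]/= in fw.
  by rewrite kE_F // kE_G.
by rewrite step_kG // !kE_G //; apply/and3P; split => //; exact: ltnW.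
Qed.

Lemma kE_thr s : kE (thr s) = ~~ kE s.
Proof. by rewrite -[thr s]knbrK kE_nbr -/(step s) kE_step. Qed.

(** This is slot 0 of the first crossing, the slot on which [entering] is based. *)
Definition kstart : slot p := kslot (kF n (0, 2, 2 * c 0)).
Definition kentry v i r := kslot (if fwd v i then kF n (v, i, r) else kG n (v, i, r)).
Definition reached v i := forall r, r <= 2 * c v -> fconnect (@step p) kstart (kentry v i r).

Lemma strand_connect v i r : v < 4 -> i < 3 -> r <= 2 * c v ->
  fconnect (@step p) (kentry v i (if fwd v i then 0 else 2 * c v)) (kentry v i r).
Proof.
rewrite /kentry => ltv lti; case: (fwd v i).
  elim: r => // r IH ltr; apply: connect_trans (IH (ltnW ltr)) _.
  by apply: connect1; rewrite /= step_kF // /valid_label ltv lti.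
move=> ler; rewrite -(subKn ler); set m := 2 * c v - r.
have : m <= 2 * c v by exact: leq_subr.
elim: m => [|m IH] ltm; first by rewrite subn0.
apply: connect_trans (IH (ltnW ltm)) _; apply: connect1 => /=.
have -> : 2 * c v - m = (2 * c v - m.+1).+1 by lia.
rewrite step_kG // /valid_label ltv lti /=; lia.
Qed.

Lemma reached_next v i : v < 4 -> i < 3 ->
  fconnect (@step p) kstart (kentry v i (if fwd v i then 2 * c v else 0)) ->
  let vi := if fwd v i then knext_bot v i else knext_top v i in reached vi.1 vi.2.
Proof.
move=> ltv lti conn vi r ler.
have [ltv' lti'] : vi.1 < 4 /\ vi.2 < 3.
  by rewrite /vi; case: v ltv {conn vi ler} => [|[|[|[|v]]]] //; case: i lti => [|[|[|i]]].
apply: connect_trans (strand_connect ltv' lti' ler).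
apply: connect_trans conn _; apply: connect1 => /=; rewrite /kentry /vi.
case: (boolP (fwd v i)) => fw.
  by rewrite step_kF_last // fwd_bot // fw -surjective_pairing.
by rewrite step_kG0 // fwd_top // fw -surjective_pairing.
Qed.

(** The itinerary of the knot through its twelve strands. It does not involve [n], since [bot]
    depends on the twists modulo 3 only. *)
Lemma reached_all v i : v < 4 -> i < 3 -> reached v i.
Proof.
(* [kstart] lies at the bottom of strand (0, 2), which is travelled downwards, so the walk continues
   on strand (1, 2). *)
have s1 : reached 1 2 by apply: (@reached_next 0 2) => //; exact: connect0.
have nxt w j (ltw : w < 4) (ltj : j < 3) : reached w j ->
    let vi := if fwd w j then knext_bot w j else knext_top w j in reached vi.1 vi.2.
  by move=> rw; apply: reached_next => //; apply: rw; case: ifP.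
have s2 : reached 3 0 := nxt 1 2 isT isT s1.
have s3 : reached 1 0 := nxt 3 0 isT isT s2.
have s4 : reached 2 2 := nxt 1 0 isT isT s3.
have s5 : reached 0 0 := nxt 2 2 isT isT s4.
have s6 : reached 1 1 := nxt 0 0 isT isT s5.
have s7 : reached 2 0 := nxt 1 1 isT isT s6.
have s8 : reached 3 2 := nxt 2 0 isT isT s7.
have s9 : reached 2 1 := nxt 3 2 isT isT s8.
have s10 : reached 0 1 := nxt 2 1 isT isT s9.
have s11 : reached 3 1 := nxt 0 1 isT isT s10.
have s12 : reached 0 2 := nxt 3 1 isT isT s11.
by case: v => [|[|[|[|v]]]] //; case: i => [|[|[|i]]].
Qed.

Lemma kE_connect s : kE s -> fconnect (@step p) kstart s.
Proof.
have [[[v i] r] vl] := kslot_FG s; have /and3P[ltv lti ltr] := vl.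
case=> ->; rewrite ?kE_F ?kE_G // => fw; have := @reached_all v i ltv lti r ltr.
  by rewrite /kentry fw.
by rewrite /kentry (negbTE fw).
Qed.

Lemma is_knot_Kn : is_knot (Kn n).
Proof.
rewrite Kn_names.
apply: (named_is_knot (knames_uniq n) x0_in (@klab_inj n) (@klblP n) kends kE_thr kE_connect).
Qed.

Lemma kentering s : @entering p s = kE s.
Proof.
have p_gt0 : 0 < size p by [].
rewrite /entering (pick_slot p_gt0).
have -> : (Ordinal p_gt0, ord0) = kstart.
  rewrite /kstart /kslot /nslot; congr pair; apply: val_inj => /=; last by rewrite inordK.
  by rewrite val_named // x0_in.
apply: (fconnect_E kE_connect) => [s'|]; first by rewrite kE_step.
by rewrite kE_F.
Qed.

End Orientation.

(** * Crossing signs and the writhe *)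

Section Crossings.
Variable n : nat.
Notation c v := (rings n v).
Notation p := [seq kcr n x | x <- knames n].
Notation kname := (@kname n).
Notation kslot := (@kslot n).
Notation kF := (kF n).
Notation kG := (kG n).

(* At the crossing [x], [under_fwd x] (resp. [over_fwd x]) holds when the     *)
(* under (resp. over) strand enters through slot 0 (resp. 1).                 *)
Definition under_fwd (x : name) :=
  let: (v, i, k) := x in if k == 0 then fwd v (bot v i) else fwd v i.
Definition over_fwd (x : name) :=
  let: (v, i, k) := x in if k == 0 then fwd v i else fwd v (ray v i k) == sgn v.

Lemma kslot_edge v i : (v, i) \in kedges ->
  [/\ kslot ((v, i, 0), 0) = kslot (kF (v, bot v i, 2 * c v)),
      kslot ((v, i, 0), 1) = kslot (kG (knext_top v i, 0)),
      kslot ((v, i, 0), 2) = kslot (kF (knext_bot v (bot v i), 2 * c (knext_bot v (bot v i)).1))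
    & kslot ((v, i, 0), 3) = kslot (kG (v, i, 0))].
Proof.
have Flast w j : kF (w, j, 2 * rings n w) = botend w (unbot w j).
  by rewrite /Submission.kF ltnn ltnNge leq_pmull.
move=> in_e; rewrite [in kF (knext_bot _ _, _)](surjective_pairing (knext_bot _ _)) !Flast.
by edge_cases in_e.
Qed.

Lemma kslot_vertex v i k : 0 < k -> i < 3 -> k <= c v ->
  [/\ kslot ((v, i, k), 0) = kslot (kF (v, i, c v + k - 1)),
      kslot ((v, i, k), 1) = kslot (if sgn v then kF (v, ray v i k, c v - k)
                                    else kG (v, ray v i k, (c v - k).+1)),
      kslot ((v, i, k), 2) = kslot (kG (v, i, c v + k))
    & kslot ((v, i, k), 3) = kslot (if sgn v then kG (v, ray v i k, (c v - k).+1)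
                                    else kF (v, ray v i k, c v - k))].
Proof.
move=> k0 lti lek.
have Fr := kF_ray lti k0 lek; have Fs := @kF_spiral n v i k k0 lek.
have Gs : kG (v, i, c v + k) = ((v, i, k), 2).
  by have -> : c v + k = (c v + k - 1).+1 by [lia]; rewrite /Submission.kG Fs.
have Gr : kG (v, ray v i k, (c v - k).+1) = ((v, i, k), if sgn v then 3 else 1).
  by rewrite /Submission.kG Fr; case: (sgn v).
by rewrite Fr Fs Gs Gr; case: (sgn v).
Qed.

Lemma kentering_under x : valid_name n x -> entering (kslot (x, 0)) = under_fwd x.
Proof.
case: x => [[v i] k]; rewrite kentering /valid_name /under_fwd.
case: eqP => [-> in_e|/eqP k0 /and3P[ltv lti lek]].
  have [-> _ _ _] := kslot_edge in_e.
  by rewrite kE_F //; edge_cases in_e; rewrite /valid_label /= leqnn.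
have k_gt0 : 0 < k by rewrite lt0n.
have [-> _ _ _] := kslot_vertex k_gt0 lti lek.
by rewrite kE_F // /valid_label ltv lti /=; lia.
Qed.

Lemma kentering_over x : valid_name n x -> entering (kslot (x, 1)) = over_fwd x.
Proof.
case: x => [[v i] k]; rewrite kentering /valid_name /over_fwd.
case: eqP => [-> in_e|/eqP k0 /and3P[ltv lti lek]].
  have [_ -> _ _] := kslot_edge in_e.
  have [ltv lti] : v < 4 /\ i < 3 by edge_cases in_e.
  have := fwd_top ltv lti; have := @valid_next_top n v i 0 ltv lti isT.
  case: (knext_top v i) => v' i' vl fw; rewrite kE_G //; rewrite [fwd _ _]/= in fw.
  by rewrite fw negbK.
have k_gt0 : 0 < k by rewrite lt0n.
have [_ -> _ _] := kslot_vertex k_gt0 lti lek.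
have rl := ray_lt3 v i k.
case: (boolP (sgn v)) => sg; rewrite ?kE_F ?kE_G ?(eqbF_neg, eqb_id) //.
  by rewrite /valid_label ltv rl /=; lia.
by rewrite /valid_label ltv rl /=; lia.
Qed.

Lemma in_under_kname x : valid_name n x ->
  in_under (kname x) = if under_fwd x then inord 0 else inord 2.
Proof. by move=> vx; rewrite /in_under kentering_under. Qed.

Lemma in_over_kname x : valid_name n x ->
  in_over (kname x) = if over_fwd x then inord 1 else inord 3.
Proof. by move=> vx; rewrite /in_over kentering_over. Qed.

Lemma positive_kname x : valid_name n x ->
  positive (kname x) = under_fwd x (+) over_fwd x.
Proof.
move=> vx; rewrite /positive in_under_kname // in_over_kname //.
by case: under_fwd; case: over_fwd; rewrite !inordK.
Qed.

Lemma sum_period3 (V : nmodType) (g : nat -> V) m : (forall k, 0 < k -> g (k + 3) = g k) ->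
  (\sum_(k <- iota 1 (3 * m).+1) g k = (g 1 + g 2 + g 3) *+ m + g 1)%R.
Proof.
move=> gp.
have gm j i : 0 < i -> g (j * 3 + i) = g i.
  by move=> i0; elim: j => // j IH; rewrite mulSn -addnA addnC gp // addn_gt0 i0 orbT.
elim: m => [|m IH]; first by rewrite mulr0n big_seq1 add0r.
have -> : (3 * m.+1).+1 = (3 * m).+1 + 3 by lia.
rewrite iotaD big_cat IH /= !big_cons big_nil.
have -> : (1 + (3 * m).+1 = m * 3 + 2)%N by lia.
have -> : ((m * 3 + 2).+1 = m * 3 + 3)%N by lia.
have -> : ((m * 3 + 3).+1 = m.+1 * 3 + 1)%N by lia.
by rewrite !gm // mulrSr addr0 -!addrA; congr +%R; rewrite addrA.
Qed.

(** The signs at vertex 2 have period 3 in the ring index. Three consecutive rings contribute 1 in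
    total, and the crossings left over cancel. *)
Lemma writhe_Kn : writhe p = Posz n.
Proof.
rewrite /writhe (big_named (knames_uniq n) (x0_in n)).
have -> : (\sum_(x <- knames n) (if @positive p (kname x) then 1 else -1) =
   \sum_(x <- knames n) (if under_fwd x (+) over_fwd x then 1 else -1) :> int)%R.
  by rewrite !big_seq; apply: eq_bigr => x; rewrite mem_knames => /positive_kname ->.
rewrite big_knames.
have per i k : 0 < k ->
    under_fwd (2, i, k + 3) (+) over_fwd (2, i, k + 3) =
    under_fwd (2, i, k) (+) over_fwd (2, i, k).
  case: k => // k _; rewrite /under_fwd /over_fwd addSn /=.
  by congr (_ (+) (fwd _ _ == _)); rewrite /ray /=; lia.
pose f x : int := (if under_fwd x (+) over_fwd x then 1 else -1)%R.
pose S v i : int := (\sum_(k <- iota 1 (c v)) f (v, i, k))%R.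
have S2 i : S 2 i = ((f (2, i, 1) + f (2, i, 2) + f (2, i, 3)) *+ n + f (2, i, 1))%R.
  by rewrite /S -[c 2]/((3 * n).+1) (sum_period3 (g := fun k => f (2, i, k))) // => k k0;
    rewrite /f per.
have -> : (\sum_(v <- iota 0 4) \sum_(i <- iota 0 3) \sum_(k <- iota 1 (c v))
    (if under_fwd (v, i, k) (+) over_fwd (v, i, k) then 1 else -1) =
    \sum_(v <- iota 0 4) \sum_(i <- iota 0 3) S v i :> int)%R by [].
rewrite !big_cons !big_nil !S2 /S /= !big_cons !big_nil /f /=; lia.
Qed.

End Crossings.

(** * Arcs and the rows of the Alexander matrix *)

Section Arcs.
Variable n : nat.
Notation c v := (rings n v).
Notation p := [seq kcr n x | x <- knames n].
Notation kname := (@kname n).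
Notation kslot := (@kslot n).
Notation kF := (kF n).
Notation kG := (kG n).
Notation kentry := (@kentry n).

(** Quantifying over all sufficient fuels lets the bound [d] grow by one per step; only at the end
    is it compared with the fuel of [arc_end]. *)
Definition ends_within (d : nat) (s : slot p) (x : 'I_(size p)) :=
  forall fuel, d <= fuel -> arc_end_aux fuel s = x.

Lemma ends_within_under s : under_slot s -> ends_within 1 s s.1.
Proof. by move=> us [|fuel] //= _; rewrite us. Qed.

Lemma ends_within_over d s x : ~~ under_slot s -> ends_within d (step s) x ->
  ends_within d.+1 s x.
Proof. by move=> /negbTE us ds [|fuel] //= ltd; rewrite us ds. Qed.

Lemma under_kslot e : ends_in (knames n) e -> under_slot (kslot e) = ~~ odd e.2.
Proof. by case/andP => _ ltq; rewrite /under_slot /kslot /nslot /= inordK. Qed.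

Lemma kF_top v i r : r < c v -> odd (kF (v, i, r)).2.
Proof. by move=> ltr; rewrite /Submission.kF ltr; case: sgn. Qed.

Lemma kG_top v i r : r <= c v -> odd (kG (v, i, r)).2.
Proof.
case: r => [|r] ltr; first by rewrite /Submission.kG /topend; case: ifP.
by rewrite /Submission.kG /ethr /Submission.kF ltr; case: (sgn v).
Qed.

(* the crossing where the arc containing the label [rings v + k] of the       *)
(* strand [(v, i)] ends                                                       *)
Definition karc v i k : name :=
  if fwd v i then if k < c v then (v, i, k.+1) else (botend v (unbot v i)).1
  else if 0 < k then (v, i, k) else (knext_top v i, 1).

Lemma ends_kF_top v i r : v < 4 -> i < 3 -> r <= c v ->
  ends_within (c v - r).+1 (kslot (kF (v, i, r))) (kname (v, i, 1)).
Proof.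
move=> ltv lti ler.
have [m -> lem] : exists2 m, r = c v - m & m <= c v by exists (c v - r); lia.
rewrite subKn //; have c0 := @rings_gt0 n v ltv.
have vl k : k <= c v -> valid_label n (v, i, c v - k) by rewrite /valid_label ltv lti /=; lia.
elim: m lem => [|m IH] lem.
  have F1 : kF (v, i, c v - 0) = ((v, i, 1), 0) by rewrite -(@kF_spiral n v i 1) // subn0 addnK.
  have -> : kname (v, i, 1) = (kslot (kF (v, i, c v - 0))).1 by rewrite F1.
  by apply: ends_within_under; rewrite under_kslot ?F1 // -F1; apply/ends_kF/vl.
apply: ends_within_over.
  by rewrite under_kslot ?negbK ?kF_top //; [lia | apply/ends_kF/vl].
have e : (c v - m.+1).+1 = c v - m by lia.
by rewrite step_kF e; [apply: IH; exact: ltnW | apply: vl; exact: ltnW].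
Qed.

(** The arc goes up its ray, over the edge crossing and down the ray at the other end of the edge.
    It passes over everything until the first spiral crossing there. *)
Lemma ends_kG_top v i r : v < 4 -> i < 3 -> r <= c v ->
  ends_within (r + (c (knext_top v i).1).+2) (kslot (kG (v, i, r)))
    (kname (knext_top v i, 1)).
Proof.
move=> ltv lti; elim: r => [|r IH] ler.
  apply: ends_within_over.
    by rewrite under_kslot ?negbK ?kG_top //; apply/ends_kG; rewrite /valid_label ltv lti.
  have := @valid_next_top n v i 0 ltv lti isT.
  rewrite step_kG0 //; case: (knext_top v i) => v' i' /and3P[ltv' lti' _].
  by have := @ends_kF_top v' i' 0 ltv' lti' isT; rewrite subn0.
have vl : valid_label n (v, i, r.+1) by rewrite /valid_label ltv lti /=; lia.
apply: ends_within_over; first by rewrite under_kslot ?negbK ?kG_top //; apply/ends_kG.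
by rewrite step_kG //; apply: IH; exact: ltnW.
Qed.

Lemma arc_end_within d s x : d <= 4 * (24 + 9 * n) -> ends_within d s x -> arc_end s = x.
Proof. by move=> led; apply; rewrite size_map size_knames. Qed.

Lemma rings_le v : c v <= 3 * n + 2.
Proof. by case: v => [|[|[|[|v]]]] //=; rewrite /rings /= ?nth_nil; lia. Qed.

Lemma arc_end_top v i r : v < 4 -> i < 3 -> r <= c v ->
  arc_end (kentry v i r) = kname (karc v i 0).
Proof.
move=> ltv lti ler; have lev := rings_le v; rewrite /kentry /karc (rings_gt0 n ltv).
case: (fwd v i).
  by apply: arc_end_within (ends_kF_top ltv lti ler); lia.
apply: arc_end_within (ends_kG_top ltv lti ler).
by have := rings_le (knext_top v i).1; lia.
Qed.

Lemma arc_end_spiral v i k : v < 4 -> i < 3 -> k <= c v ->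
  arc_end (kentry v i (c v + k)) = kname (karc v i k).
Proof.
move=> ltv lti lek; case: (posnP k) => [->|k0]; first by rewrite addn0 arc_end_top.
have vl : valid_label n (v, i, c v + k) by rewrite /valid_label ltv lti /=; lia.
rewrite /kentry /karc k0; case: (fwd v i); last first.
  have [_ _ G2 _] := kslot_vertex k0 lti lek.
  rewrite -G2; apply: (@arc_end_within 1); first by lia.
  by apply: ends_within_under; rewrite under_kslot // /ends_in /= mem_knames /= ;
    case: eqP => [|_]; [lia | rewrite ltv lti lek].
have uF : ~~ odd (kF (v, i, c v + k)).2.
  rewrite /Submission.kF; case: ltnP => [|_]; first lia.
  by case: ltnP => [//|_]; rewrite /botend; case: ifP.
have eF : (if k < c v then (v, i, k.+1) else (botend v (unbot v i)).1)
    = (kF (v, i, c v + k)).1.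
  rewrite /Submission.kF; case: (ltnP (c v + k)) => [|_]; first lia.
  have -> : (c v + k < 2 * c v) = (k < c v) by lia.
  by case: ltnP => _; rewrite ?addKn.
rewrite eF -[kname _]/((kslot (kF (v, i, c v + k))).1).
apply: (@arc_end_within 1); first by lia.
by apply: ends_within_under; rewrite under_kslot //; exact: ends_kF.
Qed.

(* the arcs on the two sides of slots 0, 2 and the over-arc at a crossing *)
Definition arc0 (x : name) : name :=
  let: (v, i, k) := x in if k == 0 then karc v (bot v i) (c v) else karc v i k.-1.
Definition arc2 (x : name) : name :=
  let: (v, i, k) := x in
  if k == 0 then let w := knext_bot v (bot v i) in karc w.1 w.2 (c w.1) else karc v i k.
Definition arcT (x : name) : name :=
  let: (v, i, k) := x in karc v (if k == 0 then i else ray v i k) 0.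

Lemma over_arc_kname x : valid_name n x -> over_arc (kname x) = kname (arcT x).
Proof.
move=> vx; rewrite /over_arc in_over_kname //; case: x vx => [[v i] k] /=.
case: eqP => [-> in_e|/eqP k0 /and3P[ltv lti lek]].
  have [ltv lti] : v < 4 /\ i < 3 by edge_cases in_e.
  have [_ S1 _ S3] := kslot_edge n in_e.
  case: (boolP (fwd v i)) => fw.
    rewrite -[(_, inord 1)]/(kslot ((v, i, 0), 1)) S1.
    have := @arc_end_top (knext_top v i).1 (knext_top v i).2 0.
    rewrite /kentry /karc fwd_top // fw -surjective_pairing /= => -> //.
    - by edge_cases in_e.
    - by edge_cases in_e.
    - by edge_cases in_e.
  rewrite -[(_, inord 3)]/(kslot ((v, i, 0), 3)) S3.
  by rewrite -(@arc_end_top v i 0 ltv lti isT) /kentry (negbTE fw).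
have k_gt0 : 0 < k by rewrite lt0n.
have [_ S1 _ S3] := kslot_vertex k_gt0 lti lek.
have rl := ray_lt3 v i k.
rewrite -(@arc_end_top v (ray v i k) (if fwd v (ray v i k) then c v - k else (c v - k).+1)) //;
  last by case: fwd; lia.
rewrite /kentry; move: S1 S3; case: (fwd v _); case: (sgn v) => S1 S3.
- exact: (congr1 (@arc_end _) S1).
- exact: (congr1 (@arc_end _) S3).
- exact: (congr1 (@arc_end _) S3).
exact: (congr1 (@arc_end _) S1).
Qed.

(** An arc is named after the crossing where it ends, so the incoming under-arc at a crossing is the
    crossing itself. The orientation decides whether that arc is [arc0] or [arc2]. *)
Lemma inc_out_arc x : valid_name n x ->
  (kname x, out_arc (kname x)) =
  if under_fwd x then (kname (arc0 x), kname (arc2 x)) else (kname (arc2 x), kname (arc0 x)).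
Proof.
move=> vx; rewrite /out_arc in_under_kname //; case: x vx => [[v i] k] /=.
case: eqP => [-> in_e|/eqP k0 /and3P[ltv lti lek]].
  have [ltv lti] : v < 4 /\ bot v i < 3 by edge_cases in_e.
  have [ltw lti'] : (knext_bot v (bot v i)).1 < 4 /\ (knext_bot v (bot v i)).2 < 3.
    by edge_cases in_e.
  have bb : knext_bot (knext_bot v (bot v i)).1 (knext_bot v (bot v i)).2 = (v, bot v i).
    by edge_cases in_e.
  have fb := fwd_bot ltv lti.
  have [S0 _ S2 _] := kslot_edge n in_e.
  have spl w j : w < 4 -> j < 3 -> kname (karc w j (c w)) = arc_end (kentry w j (2 * c w)).
    by move=> ltw' ltj'; rewrite mul2n -addnn arc_end_spiral.
  set w := knext_bot v (bot v i) in ltw lti' bb fb S2 *.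
  case fw : (fwd v (bot v i)); rewrite fw in fb.
    have ex : (v, i, 0) = karc v (bot v i) (c v).
      by rewrite /karc fw ltnn; edge_cases in_e.
    have eo : arc_end (step (kslot ((v, i, 0), 0))) = kname (karc w.1 w.2 (c w.1)).
      rewrite S0 (@step_kF_last n _ _ ltv lti) -/w (spl _ _ ltw lti') /kentry fb.
      by rewrite -surjective_pairing.
    exact: (congr2 pair (congr1 kname ex) eo).
  have ex : (v, i, 0) = karc w.1 w.2 (c w.1).
    by rewrite /karc fb ltnn; rewrite /w; edge_cases in_e.
  have eo : arc_end (step (kslot ((v, i, 0), 2))) = kname (karc v (bot v i) (c v)).
    rewrite S2 [in kF (w, _)](surjective_pairing w) (@step_kF_last n _ _ ltw lti') bb.
    by rewrite (spl _ _ ltv lti) /kentry fw.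
  exact: (congr2 pair (congr1 kname ex) eo).
have k_gt0 : 0 < k by rewrite lt0n.
have [S0 _ S2 _] := kslot_vertex k_gt0 lti lek.
have e1 : c v + k - 1 = c v + k.-1 by lia.
have e2 : c v + k = (c v + k.-1).+1 by lia.
have vl : valid_label n (v, i, (c v + k.-1).+1) by rewrite /valid_label ltv lti /=; lia.
have lek' : k.-1 <= c v by lia.
case fw : (fwd v i).
  have ex : (v, i, k) = karc v i k.-1 by rewrite /karc fw ifT; [rewrite prednK | lia].
  have eo : arc_end (step (kslot ((v, i, k), 0))) = kname (karc v i k).
    by rewrite S0 e1 (step_kF vl) -(arc_end_spiral ltv lti lek) /kentry fw -e2.
  exact: (congr2 pair (congr1 kname ex) eo).
have ex : (v, i, k) = karc v i k by rewrite /karc fw k_gt0.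
have eo : arc_end (step (kslot ((v, i, k), 2))) = kname (karc v i k.-1).
  by rewrite S2 e2 (step_kG vl) -(arc_end_spiral ltv lti lek') /kentry fw.
exact: (congr2 pair (congr1 kname ex) eo).
Qed.

Lemma left_right_arc x : valid_name n x ->
  (Defs.left_arc (kname x), Defs.right_arc (kname x)) =
  if over_fwd x then (kname (arc0 x), kname (arc2 x)) else (kname (arc2 x), kname (arc0 x)).
Proof.
move=> vx; rewrite /Defs.left_arc /Defs.right_arc /inc_arc.
have := inc_out_arc vx; rewrite in_over_kname // in_under_kname //.
move: (kname x) (out_arc (kname x)) (kname (arc0 x)) (kname (arc2 x)) => a o a0 a2.
by case: (over_fwd x); case: (under_fwd x); rewrite !inordK //= => -[-> ->].
Qed.

Local Open Scope ring_scope.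

Lemma row_alexander x : valid_name n x ->
  row (kname x) (alexander_matrix p) =
  (1 - 'X) *: delta_mx 0 (kname (arcT x))
  + (if over_fwd x then 'X *: delta_mx 0 (kname (arc2 x)) - delta_mx 0 (kname (arc0 x))
     else 'X *: delta_mx 0 (kname (arc0 x)) - delta_mx 0 (kname (arc2 x))).
Proof.
move=> vx; have := left_right_arc vx; have := over_arc_kname vx.
move: (kname (arcT x)) (kname (arc0 x)) (kname (arc2 x)) => aT a0 a2 oT.
case: (over_fwd x) => -[lx rx].
  apply/rowP => j; rewrite !mxE eqxx oT lx rx !(eq_sym _ j).
  by rewrite !mulr_natr addrA.
apply/rowP => j; rewrite !mxE eqxx oT lx rx !(eq_sym _ j).
by rewrite !mulr_natr addrA.
Qed.

End Arcs.

(** * Alexander polynomial *)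

Local Open Scope ring_scope.

(** * Units, Laurent row spans and principal minors *)

Definition signed_power (P : {poly int}) :=
  exists (b : bool) (k : nat), P = (-1) ^+ b * 'X ^+ k.

Lemma signed_powerM P Q : signed_power P -> signed_power Q -> signed_power (P * Q).
Proof.
move=> [b [k ->]] [b' [k' ->]]; exists (b (+) b'), (k + k')%N.
by rewrite signr_addb exprD; ring.
Qed.

(** While the exponent is positive, evaluation at 0 shows that ['X] divides one of the factors. At
    exponent 0 the factors are units of Z[X], hence 1 or -1. *)
Lemma signed_power_factor P Q : signed_power (P * Q) -> signed_power P.
Proof.
case=> b [k]; elim: k P Q => [|k IH] P Q PQ.
  have uP : P \is a GRing.unit.
    have : P * Q \is a GRing.unit by rewrite PQ expr0 mulr1 unitrX ?unitrN1.
    by rewrite unitrM => /andP[].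
  move: uP; rewrite poly_unitE => /andP[/eqP sP uP0].
  have [c def_P] : exists c, P = c%:P by exists P`_0; apply: size1_polyC; rewrite sP.
  rewrite def_P coefC /= in uP0; exists (c != 1), 0%N.
  rewrite def_P expr0 mulr1; have : (c == 1) || (c == -1) := uP0.
  by case/orP => /eqP ->; rewrite ?polyCN.
have : (P * Q).[0] = 0 by rewrite PQ hornerM hornerXn expr0n mulr0.
have X_neq0 : 'X != 0 :> {poly int} by rewrite polyX_eq0.
move/eqP; rewrite hornerM mulf_eq0 => /orP[] /factor_theorem[R]; rewrite subr0 => defR.
  have [b' [k' defS]] : signed_power R.
    apply: (IH R Q); apply: (mulIf X_neq0).
    by rewrite -[RHS]mulrA -exprSr -PQ defR; ring.
  by exists b', k'.+1; rewrite defR defS exprSr mulrA.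
apply: (IH P R); apply: (mulIf X_neq0).
by rewrite -[RHS]mulrA -exprSr -PQ defR; ring.
Qed.

Section LaurentRowSpan.
Variables (N : nat) (A : 'M[{poly int}]_N).

(* [u] is a combination of the rows of [A] with Laurent polynomial coefficients *)
Definition lspan (u : 'rV[{poly int}]_N) := exists k r, 'X^k *: u = r *m A.

Lemma lspan_row i : lspan (row i A).
Proof. by exists 0%N, (delta_mx 0 i); rewrite scale1r rowE. Qed.

Lemma lspanD u v : lspan u -> lspan v -> lspan (u + v).
Proof.
move=> [k [r ur]] [l [s vs]]; exists (k + l)%N, ('X^l *: r + 'X^k *: s).
by rewrite mulmxDl -!scalemxAl -ur -vs !scalerA -!exprD [(l + k)%N]addnC scalerDr.
Qed.

Lemma lspanZ a u : lspan u -> lspan (a *: u).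
Proof.
move=> [k [r ur]]; exists k, (a *: r).
by rewrite -scalemxAl -ur !scalerA mulrC.
Qed.

Lemma lspanX k u : lspan ('X^k *: u) -> lspan u.
Proof. by move=> [l [r ur]]; exists (l + k)%N, r; rewrite exprD -scalerA. Qed.

Variable w : 'rV[{poly int}]_N.
Hypotheses (wA : w *m A = 0) (w_unit : forall i, signed_power (w 0 i)).
Hypothesis arcs_equal : forall a b, lspan (delta_mx 0 a - delta_mx 0 b).

(* A row [i0] is redundant since [w 0 i0] is invertible, hence the minor has   *)
(* an inverse over the Laurent polynomials.                                    *)
Lemma principal_minor_unit i0 : signed_power (\det (row' i0 (col' i0 A))).
Proof.
have inv_row (a : 'I_N.-1) : exists sr : {poly int} * 'rV[{poly int}]_N,
    [/\ signed_power sr.1, sr.2 0 i0 = 0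
      & sr.1 *: (delta_mx 0 (lift i0 a) - delta_mx 0 i0) = sr.2 *m A].
  have [k [r e]] := arcs_equal (lift i0 a) i0.
  (* Subtracting a multiple of the relation [wA] clears the coefficient of row [i0], at the cost of
     the factor [w 0 i0]. *)
  exists (w 0 i0 * 'X^k, w 0 i0 *: r - r 0 i0 *: w); split=> /=.
  - by apply: signed_powerM (w_unit _) _; exists false, k; rewrite mul1r.
  - by rewrite !mxE mulrC subrr.
  by rewrite mulmxBl -!scalemxAl wA scaler0 subr0 -e scalerA.
have [f fP] := fin_all_exists inv_row.
pose B := \matrix_(a, j) (f a).2 0 (lift i0 j).
(* The determinant of the minor therefore divides a product of signed powers. *)
have BM : B *m row' i0 (col' i0 A) = diag_mx (\row_a (f a).1).
  apply/matrixP => a b; have [_ r0 e] := fP a.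
  have /rowP/(_ (lift i0 b)) := e; rewrite !mxE (bigD1_ord i0) //= r0 mul0r add0r.
  rewrite (inj_eq lift_inj) [lift i0 b == i0]eq_sym (negbTE (neq_lift _ _)) subr0 mulr_natr.
  by rewrite [b == a]eq_sym => ->; apply: eq_bigr => j _; rewrite !mxE.
have := congr1 determinant BM; rewrite det_mulmx det_diag mulrC => dM.
apply: (signed_power_factor (Q := \det B)); rewrite {}dM.
apply: (big_ind signed_power) => [|P Q|a _].
- by exists false, 0%N; rewrite mulr1.
- exact: signed_powerM.
by rewrite mxE; case: (fP a).
Qed.

End LaurentRowSpan.

Ltac vring := apply/rowP => ?; rewrite !mxE; ring.

(** * All arcs agree in the Alexander module *)

Section AlexanderModule.
Variables (n N : nat) (R : comNzRingType) (x : R) (Y : nat -> nat -> nat -> 'rV[R]_N).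
Notation c v := (rings n v).

Definition spiral_row v i k :=
  (1 - x) *: Y v (ray v i k) 0
  + (if fwd v (ray v i k) == sgn v then x *: Y v i k - Y v i k.-1
     else x *: Y v i k.-1 - Y v i k).

Definition edge_row v i :=
  let w := knext_bot v (bot v i) in
  (1 - x) *: Y v i 0
  + (if fwd v i then x *: Y w.1 w.2 (c w.1) - Y v (bot v i) (c v)
     else x *: Y v (bot v i) (c v) - Y w.1 w.2 (c w.1)).

Hypothesis Y_top : forall v i, (v < 4)%N -> (i < 3)%N ->
  Y v i 0 = Y (knext_top v i).1 (knext_top v i).2 0.

Lemma top_arcs : [/\ Y 1 1 0 = Y 0 0 0, Y 2 1 0 = Y 0 1 0, Y 3 1 0 = Y 0 2 0,
  Y 2 2 0 = Y 1 0 0 & Y 3 0 0 = Y 1 2 0] /\ Y 3 2 0 = Y 2 0 0.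
Proof. by do !split; rewrite [LHS]Y_top. Qed.

Lemma ray2_mod i m r : ray 2 i (3 * m + r) = ray 2 i r.
Proof. by rewrite /ray /=; lia. Qed.

Section ArcsEqual.
Variable S : 'rV[R]_N -> Prop.
Hypothesis SD : forall u v, S u -> S v -> S (u + v).
Hypothesis SZ : forall a u, S u -> S (a *: u).
Hypothesis SXn : forall k u, S (x ^+ k *: u) -> S u.
Hypothesis HV : forall v i k, (v < 4)%N -> (i < 3)%N -> (0 < k)%N -> (k <= c v)%N ->
  S (spiral_row v i k).
Hypothesis HE : forall v i, (v, i) \in kedges -> S (edge_row v i).

Lemma SE u v : S u -> u = v -> S v. Proof. by move=> Su <-. Qed.

(* [x] times the fixed point of the affine map that takes [Y 2 i k] to        *)
(* [Y 2 i (k + 3)] for [k] congruent to 1 modulo 3                            *)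
Definition fix_arc i :=
  match i with
  | 0 => x *: (Y 2 1 0 - x *: Y 2 2 0 + x *: Y 2 0 0)
  | 1 => Y 2 1 0 - Y 2 2 0 + x *: Y 2 0 0
  | _ => x *: (Y 2 1 0 - Y 2 2 0 + Y 2 0 0)
  end.

(** Three consecutive crossings multiply the difference to the fixed point by 1/x. This is the m-th
    iterate with denominators cleared. *)
Lemma spiral_closed_form m i : (m <= n)%N -> (i < 3)%N ->
  S ((x * x ^+ m) *: Y 2 i (3 * m).+1
     - (x *: Y 2 i 1 - fix_arc i + x ^+ m *: fix_arc i)).
Proof.
move=> lem lti; elim: m lem => [|m IH] lem.
  (* For m = 0 the vector is zero, and the zero vector is obtained by scaling some relation by 0. *)
  apply: (SE (SZ 0 (HV (v := 0) (i := 0) (k := 1) isT isT isT isT))).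
  by rewrite muln0; vring.
have row r : (0 < r)%N -> (r <= 4)%N -> S (spiral_row 2 i (3 * m + r)).
  by move=> r0 ler; apply: HV => //; rewrite /rings /=; lia.
have := row 2 isT isT; have := row 3 isT isT; have := row 4 isT isT.
rewrite /spiral_row !ray2_mod (_ : (3 * m + 4)%N = (3 * m.+1).+1); last by lia.
rewrite !addnS addn0 !PeanoNat.Nat.pred_succ (_ : (3 * m.+1)%N = (3 * m).+3); last by lia.
move: (IH (ltnW lem)).
case: i lti {row IH} => [|[|[|i]]] // _ h r4 r3 r2; apply: (SXn (k := 1)).
- apply: (SE (SD (SZ x h) (SZ (x * x ^+ m) (SD (SZ x r2) (SD (SZ (x ^+ 2) r3) (SZ (- x ^+ 2) r4))))));
  rewrite /fix_arc /= [x ^+ m.+1]exprS; vring.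
- apply: (SE (SD (SZ x h) (SZ (x * x ^+ m) (SD (SZ (- 1) r2) (SD (SZ 1 r3) (SZ x r4))))));
  rewrite /fix_arc /= [x ^+ m.+1]exprS; vring.
apply: (SE (SD (SZ x h) (SZ (x * x ^+ m) (SD (SZ x r2) (SD (SZ (- x) r3) (SZ x r4))))));
  rewrite /fix_arc /= [x ^+ m.+1]exprS; vring.
Qed.

(** The [g] facts express the last spiral arcs through the six over-arcs. Inserted into the edge
    relations, they yield a square system [E0], [E2], [E3], [E4], [E5] for the five differences to
    [Y 2 0 0]. *)
Lemma top_arcs_equal v i : (v < 4)%N -> (i < 3)%N -> S (Y v i 0 - Y 2 0 0).
Proof.
pose q := x ^+ n.
have D i' (lti : (i' < 3)%N) : S ((x * q) *: Y 2 i' (3 * n).+1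
     - (x *: Y 2 i' 1 - fix_arc i' + q *: fix_arc i')).
  exact: spiral_closed_form.
have [[t11 t21 t31 t22 t30] t32] := top_arcs.
pose tops := (t11, t21, t31, t22, t30, t32).
have r011 : S ((1 - x) *: Y 0 0 0 + (x *: Y 0 1 1 - Y 0 1 0)).
  by have := HV (v := 0) (i := 1) (k := 1) isT isT isT isT; rewrite /spiral_row /= ?tops.
have r012 : S ((1 - x) *: Y 0 2 0 + (x *: Y 0 1 1 - Y 0 1 2)).
  by have := HV (v := 0) (i := 1) (k := 2) isT isT isT isT; rewrite /spiral_row /= ?tops.
have g01 : S (x ^+ 1 *: Y 0 1 2 - ((- (x - x ^+ 2)) *: Y 0 0 0 + (x) *: Y 0 1 0 + (x - x ^+ 2) *: Y 0 2 0)).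
  apply: (SE (SD (SZ (x) r011) (SZ (- (x)) r012))); vring.
have r021 : S ((1 - x) *: Y 0 1 0 + (x *: Y 0 2 0 - Y 0 2 1)).
  by have := HV (v := 0) (i := 2) (k := 1) isT isT isT isT; rewrite /spiral_row /= ?tops.
have r022 : S ((1 - x) *: Y 0 0 0 + (x *: Y 0 2 2 - Y 0 2 1)).
  by have := HV (v := 0) (i := 2) (k := 2) isT isT isT isT; rewrite /spiral_row /= ?tops.
have g02 : S (x ^+ 1 *: Y 0 2 2 - ((- (1 - x)) *: Y 0 0 0 + (1 - x) *: Y 0 1 0 + (x) *: Y 0 2 0)).
  apply: (SE (SD (SZ (- (1)) r021) (SZ (1) r022))); vring.
have r101 : S ((1 - x) *: Y 0 0 0 + (x *: Y 1 0 1 - Y 1 0 0)).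
  by have := HV (v := 1) (i := 0) (k := 1) isT isT isT isT; rewrite /spiral_row /= ?tops.
have g10 : S (x ^+ 1 *: Y 1 0 1 - ((- (1 - x)) *: Y 0 0 0 + (1) *: Y 1 0 0)).
  apply: (SE (SZ (1) r101)); vring.
have r111 : S ((1 - x) *: Y 1 2 0 + (x *: Y 0 0 0 - Y 1 1 1)).
  by have := HV (v := 1) (i := 1) (k := 1) isT isT isT isT; rewrite /spiral_row /= ?tops.
have g11 : S (x ^+ 0 *: Y 1 1 1 - ((x) *: Y 0 0 0 + (1 - x) *: Y 1 2 0)).
  apply: (SE (SZ (- (1)) r111)); vring.
have r121 : S ((1 - x) *: Y 1 0 0 + (x *: Y 1 2 0 - Y 1 2 1)).
  by have := HV (v := 1) (i := 2) (k := 1) isT isT isT isT; rewrite /spiral_row /= ?tops.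
have g12 : S (x ^+ 0 *: Y 1 2 1 - ((1 - x) *: Y 1 0 0 + (x) *: Y 1 2 0)).
  apply: (SE (SZ (- (1)) r121)); vring.
have r301 : S ((1 - x) *: Y 0 2 0 + (x *: Y 1 2 0 - Y 3 0 1)).
  by have := HV (v := 3) (i := 0) (k := 1) isT isT isT isT; rewrite /spiral_row /= ?tops.
have r302 : S ((1 - x) *: Y 2 0 0 + (x *: Y 3 0 2 - Y 3 0 1)).
  by have := HV (v := 3) (i := 0) (k := 2) isT isT isT isT; rewrite /spiral_row /= ?tops.
have g30 : S (x ^+ 1 *: Y 3 0 2 - ((1 - x) *: Y 0 2 0 + (x) *: Y 1 2 0 + (- (1 - x)) *: Y 2 0 0)).
  apply: (SE (SD (SZ (- (1)) r301) (SZ (1) r302))); vring.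
have r311 : S ((1 - x) *: Y 2 0 0 + (x *: Y 3 1 1 - Y 0 2 0)).
  by have := HV (v := 3) (i := 1) (k := 1) isT isT isT isT; rewrite /spiral_row /= ?tops.
have r312 : S ((1 - x) *: Y 1 2 0 + (x *: Y 3 1 2 - Y 3 1 1)).
  by have := HV (v := 3) (i := 1) (k := 2) isT isT isT isT; rewrite /spiral_row /= ?tops.
have g31 : S (x ^+ 2 *: Y 3 1 2 - ((1) *: Y 0 2 0 + (- (x - x ^+ 2)) *: Y 1 2 0 + (- (1 - x)) *: Y 2 0 0)).
  apply: (SE (SD (SZ (1) r311) (SZ (x) r312))); vring.
have r321 : S ((1 - x) *: Y 1 2 0 + (x *: Y 3 2 1 - Y 2 0 0)).
  by have := HV (v := 3) (i := 2) (k := 1) isT isT isT isT; rewrite /spiral_row /= ?tops.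
have r322 : S ((1 - x) *: Y 0 2 0 + (x *: Y 3 2 1 - Y 3 2 2)).
  by have := HV (v := 3) (i := 2) (k := 2) isT isT isT isT; rewrite /spiral_row /= ?tops.
have g32 : S (x ^+ 1 *: Y 3 2 2 - ((x - x ^+ 2) *: Y 0 2 0 + (- (x - x ^+ 2)) *: Y 1 2 0 + (x) *: Y 2 0 0)).
  apply: (SE (SD (SZ (x) r321) (SZ (- (x)) r322))); vring.
have r201 : S ((1 - x) *: Y 1 0 0 + (x *: Y 2 0 0 - Y 2 0 1)).
  by have := HV (v := 2) (i := 0) (k := 1) isT isT isT isT; rewrite /spiral_row /= ?tops.
have g20 : S ((x * q) *: Y 2 0 (3 * n).+1 - ((- (x - x * q)) *: Y 0 1 0 + (x - x ^+ 2 * q) *: Y 1 0 0 + (x ^+ 2 * q) *: Y 2 0 0)).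
  apply: (SE (SD (SZ (1) (D 0 isT)) (SZ (- x) r201))); rewrite /fix_arc /= ?tops; vring.
have r211 : S ((1 - x) *: Y 2 0 0 + (x *: Y 2 1 1 - Y 0 1 0)).
  by have := HV (v := 2) (i := 1) (k := 1) isT isT isT isT; rewrite /spiral_row /= ?tops.
have g21 : S ((x * q) *: Y 2 1 (3 * n).+1 - ((q) *: Y 0 1 0 + (1 - q) *: Y 1 0 0 + (- (1 - x * q)) *: Y 2 0 0)).
  apply: (SE (SD (SZ (1) (D 1 isT)) (SZ (1) r211))); rewrite /fix_arc /= ?tops; vring.
have e0 : S ((1 - x) *: Y 0 0 0 + (x *: Y 0 2 2 - Y 1 2 1)).
  by have := HE (v := 0) (i := 0) isT; rewrite /edge_row /= ?tops.
have E0 : S ((x ^+ 2 * q - x ^+ 3 * q) *: Y 0 1 0 + (x ^+ 3 * q) *: Y 0 2 0 + (- (x ^+ 2 * q - x ^+ 3 * q)) *: Y 1 0 0 + (- (x ^+ 3 * q)) *: Y 1 2 0).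
  apply: (SE (SD (SZ (x ^+ 2 * q) e0) (SD (SZ (- (x ^+ 2 * q)) g02) (SZ (x ^+ 2 * q) g12)))); vring.
have e2 : S ((1 - x) *: Y 0 2 0 + (x *: Y 3 1 2 - Y 0 1 2)).
  by have := HE (v := 0) (i := 2) isT; rewrite /edge_row /= ?tops.
have E2 : S ((x ^+ 2 * q - x ^+ 3 * q) *: Y 0 0 0 + (- (x ^+ 2 * q)) *: Y 0 1 0 + (x * q) *: Y 0 2 0 + (- (x ^+ 2 * q - x ^+ 3 * q)) *: Y 1 2 0 + (- (x * q - x ^+ 2 * q)) *: Y 2 0 0).
  apply: (SE (SD (SZ (x ^+ 2 * q) e2) (SD (SZ (- (x * q)) g31) (SZ (x * q) g01)))); vring.
have e3 : S ((1 - x) *: Y 1 0 0 + (x *: Y 1 1 1 - Y 2 0 (3 * n).+1)).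
  by have := HE (v := 1) (i := 0) isT; rewrite /edge_row /= ?tops.
have E3 : S ((x ^+ 4 * q) *: Y 0 0 0 + (x ^+ 2 - x ^+ 2 * q) *: Y 0 1 0 + (- (x ^+ 2 - x ^+ 2 * q)) *: Y 1 0 0 + (x ^+ 3 * q - x ^+ 4 * q) *: Y 1 2 0 + (- (x ^+ 3 * q)) *: Y 2 0 0).
  apply: (SE (SD (SZ (x ^+ 2 * q) e3) (SD (SZ (- (x ^+ 3 * q)) g11) (SZ (x) g20)))); vring.
have e4 : S ((1 - x) *: Y 1 2 0 + (x *: Y 1 0 1 - Y 3 0 2)).
  by have := HE (v := 1) (i := 2) isT; rewrite /edge_row /= ?tops.
have E4 : S ((- (x ^+ 2 * q - x ^+ 3 * q)) *: Y 0 0 0 + (- (x * q - x ^+ 2 * q)) *: Y 0 2 0 + (x ^+ 2 * q) *: Y 1 0 0 + (- (x ^+ 3 * q)) *: Y 1 2 0 + (x * q - x ^+ 2 * q) *: Y 2 0 0).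
  apply: (SE (SD (SZ (x ^+ 2 * q) e4) (SD (SZ (- (x ^+ 2 * q)) g10) (SZ (x * q) g30)))); vring.
have e5 : S ((1 - x) *: Y 2 0 0 + (x *: Y 2 1 (3 * n).+1 - Y 3 2 2)).
  by have := HE (v := 2) (i := 0) isT; rewrite /edge_row /= ?tops.
have E5 : S ((x ^+ 2 * q) *: Y 0 1 0 + (- (x ^+ 2 * q - x ^+ 3 * q)) *: Y 0 2 0 + (x ^+ 2 - x ^+ 2 * q) *: Y 1 0 0 + (x ^+ 2 * q - x ^+ 3 * q) *: Y 1 2 0 + (- (x ^+ 2)) *: Y 2 0 0).
  apply: (SE (SD (SZ (x ^+ 2 * q) e5) (SD (SZ (- (x ^+ 2)) g21) (SZ (x * q) g32)))); vring.
(* Here and below the multipliers form one row of the inverse of that system, with the denominator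
   x^(5 + 2n) cleared. *)
have t0 : S (Y 0 0 0 - Y 2 0 0).
  apply: (SXn (k := 5 + 2 * n)); apply: (SE (SD (SZ (- (1 - q - x + x ^+ 2 + x ^+ 2 * q - x ^+ 3 * q - x ^+ 3 * q ^+ 2 + x ^+ 4 * q ^+ 2)) E0) (SD (SZ (x - x ^+ 2 - 2%:R * x ^+ 2 * q - x ^+ 2 * q ^+ 2 + x ^+ 3 + 2%:R * x ^+ 3 * q + 2%:R * x ^+ 3 * q ^+ 2 - x ^+ 4 * q - 2%:R * x ^+ 4 * q ^+ 2 + x ^+ 5 * q ^+ 2) E2) (SD (SZ (q - x * q + x ^+ 2 * q) E3) (SD (SZ (x - x ^+ 2 - x ^+ 2 * q - x ^+ 2 * q ^+ 2 + x ^+ 3 + x ^+ 3 * q + 2%:R * x ^+ 3 * q ^+ 2 - x ^+ 4 * q - 2%:R * x ^+ 4 * q ^+ 2 + x ^+ 5 * q ^+ 2) E4) (SZ (- (x ^+ 2 * q ^+ 2 - x ^+ 3 * q ^+ 2)) E5)))))).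
  rewrite exprD [(2 * n)%N]mulnC exprM -/q; vring.
have t1 : S (Y 0 1 0 - Y 2 0 0).
  apply: (SXn (k := 5 + 2 * n)); apply: (SE (SD (SZ (x ^+ 3 * q - x ^+ 4 * q ^+ 2) E0) (SD (SZ (x ^+ 3 * q ^+ 2 - x ^+ 4 * q - x ^+ 4 * q ^+ 2 + x ^+ 5 * q ^+ 2) E2) (SD (SZ (x ^+ 3 * q ^+ 2 - x ^+ 4 * q - x ^+ 4 * q ^+ 2 + x ^+ 5 * q ^+ 2) E4) (SZ (x ^+ 3 * q ^+ 2) E5))))).
  rewrite exprD [(2 * n)%N]mulnC exprM -/q; vring.
have t2 : S (Y 0 2 0 - Y 2 0 0).
  apply: (SXn (k := 5 + 2 * n)); apply: (SE (SD (SZ (x - x * q - x ^+ 2 + 2%:R * x ^+ 3 * q - x ^+ 4 * q ^+ 2) E0) (SD (SZ (- (x ^+ 2 - x ^+ 3 - 2%:R * x ^+ 3 * q - x ^+ 3 * q ^+ 2 + 2%:R * x ^+ 4 * q + x ^+ 4 * q ^+ 2 - x ^+ 5 * q ^+ 2)) E2) (SD (SZ (- (x * q - x ^+ 2 * q)) E3) (SD (SZ (- (x ^+ 2 - x ^+ 3 - x ^+ 3 * q - x ^+ 3 * q ^+ 2 + 2%:R * x ^+ 4 * q + x ^+ 4 * q ^+ 2 - x ^+ 5 * q ^+ 2)) E4) (SZ (x ^+ 3 * q ^+ 2) E5)))))).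
  rewrite exprD [(2 * n)%N]mulnC exprM -/q; vring.
have t3 : S (Y 1 0 0 - Y 2 0 0).
  apply: (SXn (k := 5 + 2 * n)); apply: (SE (SD (SZ (- (x ^+ 4 * q ^+ 2)) E0) (SD (SZ (x ^+ 3 * q ^+ 2 - x ^+ 4 * q ^+ 2 + x ^+ 5 * q ^+ 2) E2) (SD (SZ (x ^+ 3 * q ^+ 2 - x ^+ 4 * q ^+ 2 + x ^+ 5 * q ^+ 2) E4) (SZ (x ^+ 3 * q ^+ 2) E5))))).
  rewrite exprD [(2 * n)%N]mulnC exprM -/q; vring.
have t4 : S (Y 1 2 0 - Y 2 0 0).
  apply: (SXn (k := 5 + 2 * n)); apply: (SE (SD (SZ (x - x * q - x ^+ 2 + x ^+ 3 * q - x ^+ 4 * q ^+ 2) E0) (SD (SZ (- (x ^+ 2 - x ^+ 3 - x ^+ 3 * q - x ^+ 3 * q ^+ 2 + x ^+ 4 * q + x ^+ 4 * q ^+ 2 - x ^+ 5 * q ^+ 2)) E2) (SD (SZ (- (x * q - x ^+ 2 * q)) E3) (SD (SZ (- (x ^+ 2 - x ^+ 3 - x ^+ 3 * q ^+ 2 + x ^+ 4 * q + x ^+ 4 * q ^+ 2 - x ^+ 5 * q ^+ 2)) E4) (SZ (x ^+ 3 * q ^+ 2) E5)))))).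
  rewrite exprD [(2 * n)%N]mulnC exprM -/q; vring.
have t5 : S (Y 2 0 0 - Y 2 0 0) by apply: (SE (SZ 0 t0)); vring.
by case: v => [|[|[|[|v]]]] //; case: i => [|[|[|i]]] // _ _; rewrite ?tops.
Qed.

(** In each spiral relation the coefficients add up to 0 and the new arc has coefficient x or -1, so
    equality propagates along the spiral. *)
Lemma arcs_equal v i k : (v < 4)%N -> (i < 3)%N -> (k <= c v)%N -> S (Y v i k - Y 2 0 0).
Proof.
move=> ltv lti; elim: k => [|k IH] lek; first exact: top_arcs_equal.
have h0 := IH (ltnW lek); have ht := top_arcs_equal ltv (ray_lt3 v i k.+1).
have := HV ltv lti (ltn0Sn k) lek; rewrite /spiral_row /=; case: ifP => _ hr.
  by apply: (SXn (k := 1)); apply: (SE (SD hr (SD h0 (SZ (- (1 - x)) ht)))); vring.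
by apply: (SE (SD (SZ (- 1) hr) (SD (SZ x h0) (SZ (1 - x) ht)))); vring.
Qed.

End ArcsEqual.
End AlexanderModule.

(* The sign and exponent of the coefficient of each Wirtinger relation in the *)
(* planarity relation, read off an Alexander numbering of the regions.        *)
Definition weight_table : seq (seq (seq (bool * nat))) :=
  [:: [:: [:: (false, 0); (true, 1); (true, 0)]; [:: (false, 0); (true, 1); (false, 1)];
          [:: (true, 1); (false, 0); (true, 0)]];
      [:: [:: (false, 0); (false, 1)]; [:: (false, 0); (false, 1)];
          [:: (true, 1); (true, 0)]];
      [:: [:: (true, 1); (true, 0); (false, 0); (false, 1)];
          [:: (false, 0); (false, 1); (true, 1); (false, 1)];
          [:: (false, 0); (true, 0); (true, 1); (false, 1)]];
      [:: [:: (false, 0); (false, 0); (true, 0)]; [:: (false, 0); (false, 0); (false, 1)];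
          [:: (false, 0); (true, 1); (false, 1)]]]%N.

Definition weight_entry v i k : bool * nat :=
  nth (false, 0%N) (nth [::] (nth [::] weight_table v) i) k.

(** In the twist region the exponent grows by one every three rings outwards. All other exponents
    are shifted by [n], the shift reached at its rim, so that none is negative. *)
Definition weight_data n (x : name) : bool * nat :=
  let: (v, i, k) := x in
  if (v == 2) && (0 < k)%N then
    let e := weight_entry 2 i (k.-1 %% 3).+1 in (e.1, (e.2 + k.-1 %/ 3)%N)
  else let e := weight_entry v i k in (e.1, (e.2 + n)%N).

(** * The dependency between the Wirtinger relations *)

Section PlanarRelation.
Variables (n N : nat) (R : comNzRingType) (x : R) (Y : nat -> nat -> nat -> 'rV[R]_N).
Hypothesis Y_top : forall v i, (v < 4)%N -> (i < 3)%N ->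
  Y v i 0 = Y (knext_top v i).1 (knext_top v i).2 0.

Definition weight (z : name) : R :=
  (-1) ^+ (weight_data n z).1 * x ^+ (weight_data n z).2.

Lemma weight_spiral i m r : (r < 3)%N ->
  weight (2, i, (3 * m + r).+1) =
  (-1) ^+ (weight_entry 2 i r.+1).1 * (x ^+ (weight_entry 2 i r.+1).2 * x ^+ m).
Proof.
move=> ltr; rewrite /weight /weight_data /=.
rewrite (_ : (3 * m + r) %% 3 = r)%N; last by lia.
by rewrite (_ : (3 * m + r) %/ 3 = m)%N ?exprD //; lia.
Qed.

(* Around each ring of a vertex the relations add up to the difference of two *)
(* boundary terms, so they telescope.                                         *)
Lemma ring_telescope m :
  \sum_(k <- iota 1 (3 * m)) \sum_(i <- iota 0 3)
     weight (2, i, k) *: spiral_row x Y 2 i k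
  = x ^+ m *: (x *: Y 2 0 (3 * m) + x *: Y 2 1 (3 * m) - Y 2 2 (3 * m)
               - x *: Y 2 0 0 - x *: Y 2 1 0 + Y 2 2 0).
Proof.
elim: m => [|m IH]; first by rewrite muln0 big_nil; vring.
have -> : (3 * m.+1 = 3 * m + 3)%N by lia.
rewrite iotaD big_cat IH /= add1n !big_cons !big_nil.
have w r i : (r < 3)%N -> weight (2, i, (3 * m + r).+1) =
  (-1) ^+ (weight_entry 2 i r.+1).1 * (x ^+ (weight_entry 2 i r.+1).2 * x ^+ m).
  exact: weight_spiral.
have w0 i := w 0%N i isT; have w1 i := w 1%N i isT; have w2 i := w 2%N i isT.
rewrite !addnS !addn0 in w0 w1 w2 *; rewrite !w0 !w1 !w2.
have r0 i : ray 2 i (3 * m).+1 = ray 2 i 1 by rewrite -(ray2_mod i m 1) addn1.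
have r1 i : ray 2 i (3 * m).+2 = ray 2 i 2 by rewrite -(ray2_mod i m 2) addn2.
have r2 i : ray 2 i (3 * m).+3 = ray 2 i 3 by rewrite -(ray2_mod i m 3) addn3.
rewrite /spiral_row !r0 !r1 !r2 /weight_entry /= [x ^+ m.+1]exprS; vring.
Qed.

(** Once vertex 2 is telescoped to boundary terms, this is a finite identity between arcs with
    coefficients in x and x^n. *)
Lemma planar_relation :
  \sum_(e <- kedges) weight (e.1, e.2, 0%N) *: edge_row n x Y e.1 e.2
  + \sum_(v <- iota 0 4) \sum_(i <- iota 0 3) \sum_(k <- iota 1 (rings n v))
      weight (v, i, k) *: spiral_row x Y v i k = 0.
Proof.
have [[t11 t21 t31 t22 t30] t32] := top_arcs Y_top.
pose V v := \sum_(i <- iota 0 3) \sum_(k <- iota 1 (rings n v))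
      weight (v, i, k) *: spiral_row x Y v i k.
have V2 : V 2%N = x ^+ n *: (Y 2 0 (3 * n).+1 + x ^+ 2 *: Y 2 1 (3 * n).+1
    - x *: Y 2 2 (3 * n).+1 - x ^+ 2 *: Y 2 0 0 - Y 2 1 0 + x *: Y 2 2 0).
  have iota2 : iota 1 (rings n 2) = iota 1 (3 * n) ++ [:: (3 * n).+1].
    by have -> : rings n 2 = (3 * n + 1)%N by [rewrite addn1]; rewrite iotaD add1n.
  rewrite /V exchange_big iota2 big_cat /=.
  rewrite ring_telescope !big_cons !big_nil.
  have w i := @weight_spiral i n 0%N isT; rewrite addn0 in w; rewrite !w.
  have r0 i : ray 2 i (3 * n).+1 = ray 2 i 1 by rewrite -(ray2_mod i n 1) addn1.
  by rewrite /spiral_row !r0 /weight_entry /=; vring.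
rewrite -[\sum_(v <- iota 0 4) _]/(\sum_(v <- iota 0 4) V v).
have -> : \sum_(v <- iota 0 4) V v = V 0%N + V 1%N + V 2%N + V 3%N.
  by rewrite !big_cons big_nil addr0 !addrA.
rewrite V2 /V /kedges /= !big_cons !big_nil /=.
rewrite /weight /weight_data /weight_entry /edge_row /spiral_row /=.
rewrite ?t11 ?t21 ?t31 ?t22 ?t30 ?t32 !add0n !add1n [x ^+ n.+1]exprS; vring.
Qed.

End PlanarRelation.

(** * Triviality of the Alexander polynomial *)

Section AlexanderTrivial.
Variable n : nat.
Notation c v := (rings n v).
Notation p := [seq kcr n x | x <- knames n].
Notation kname := (@kname n).

Definition arc_vector v i k : 'rV[{poly int}]_(size p) := delta_mx 0 (kname (karc n v i k)).

Lemma arc_vector_top v i : (v < 4)%N -> (i < 3)%N ->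
  arc_vector v i 0 = arc_vector (knext_top v i).1 (knext_top v i).2 0.
Proof.
move=> ltv lti; rewrite /arc_vector; congr (delta_mx 0 (kname _)).
by case: v ltv => [|[|[|[|v]]]] //; case: i lti => [|[|[|i]]].
Qed.

Lemma row_spiral v i k : (v < 4)%N -> (i < 3)%N -> (0 < k)%N -> (k <= c v)%N ->
  row (kname (v, i, k)) (alexander_matrix p) = spiral_row 'X arc_vector v i k.
Proof.
move=> ltv lti k0 lek; rewrite row_alexander; last first.
  by rewrite /valid_name (negbTE (lt0n_neq0 k0)) ltv lti lek.
by rewrite /arcT /arc0 /arc2 /over_fwd (negbTE (lt0n_neq0 k0)).
Qed.

Lemma row_edge v i : (v, i) \in kedges ->
  row (kname (v, i, 0%N)) (alexander_matrix p) = edge_row n 'X arc_vector v i.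
Proof. by move=> in_e; rewrite row_alexander. Qed.

(** The arc ends at the crossing of the same name, where [inc_out_arc] recognises it as [arc0] or
    [arc2]. *)
Lemma arc_vector_surj (a : 'I_(size p)) :
  exists v i k, [/\ (v < 4)%N, (i < 3)%N, (k <= c v)%N & delta_mx 0 a = arc_vector v i k].
Proof.
have [x xin ->] := named_surj (knames_uniq n) (x0_in n) a.
rewrite -/(kname x); rewrite mem_knames in xin.
have arcs : [\/ kname x = kname (arc0 n x) | kname x = kname (arc2 n x)].
  by case: (under_fwd x) (inc_out_arc xin) => -[]; [left|right].
have [A0 A2] : (exists v i k, [/\ (v < 4)%N, (i < 3)%N, (k <= c v)%N & arc0 n x = karc n v i k])
    /\ (exists v i k, [/\ (v < 4)%N, (i < 3)%N, (k <= c v)%N & arc2 n x = karc n v i k]).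
  move: xin {arcs}; case: x => [[v i] k]; rewrite /valid_name /arc0 /arc2.
  case: eqP => [_ in_e|_ /and3P[ltv lti lek]].
    have [ltv _] : (v < 4)%N /\ (i < 3)%N by edge_cases in_e.
    pose w := knext_bot v (bot v i).
    have [ltw ltw2] : (w.1 < 4)%N /\ (w.2 < 3)%N by rewrite /w; edge_cases in_e.
    split; [exists v, (bot v i), (c v) | exists w.1, w.2, (c w.1)]; split=> //.
    by rewrite ltn_mod.
  by split; [exists v, i, k.-1 | exists v, i, k]; split=> //; lia.
case: arcs => ->; [case: A0 | case: A2] => v [i [k [ltv lti lek ->]]];
  by exists v, i, k.
Qed.

Lemma alexander_trivial_Kn : alexander_trivial (Kn n).
Proof.
rewrite Kn_names => i0.
pose w : 'rV[{poly int}]_(size p) := \row_c0 weight n 'X (nth (0, 0, 0)%N (knames n) c0).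
apply: (principal_minor_unit (w := w)) => [|i|a b].
- rewrite mulmx_sum_row (big_named (knames_uniq n) (x0_in n)).
  have wx y : y \in knames n -> w 0 (kname y) = weight n 'X y.
    by move=> yin; rewrite mxE val_named // nth_index.
  rewrite big_seq (eq_bigr (fun y => weight n 'X y *: row (kname y) (alexander_matrix p)))
    => [|y /wx <- //].
  rewrite -big_seq big_knames -[RHS](planar_relation n 'X arc_vector_top).
  congr (_ + _).
    rewrite !big_seq; apply: eq_bigr => -[v i] /= in_e; congr (_ *: _).
    exact: row_edge.
  rewrite !big_seq; apply: eq_bigr => v; rewrite mem_iota => /andP[_ ltv].
  rewrite !big_seq; apply: eq_bigr => i; rewrite mem_iota => /andP[_ lti].
  rewrite !big_seq; apply: eq_bigr => k; rewrite mem_iota => /andP[k0 ltk]; congr (_ *: _).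
  by rewrite row_spiral.
- by rewrite mxE; exists (weight_data n (nth (0, 0, 0)%N (knames n) i)).1,
    (weight_data n (nth (0, 0, 0)%N (knames n) i)).2.
have eq_arc d : lspan (alexander_matrix p) (delta_mx 0 d - arc_vector 2 0 0).
  have [v [i [k [ltv lti lek ->]]]] := arc_vector_surj d.
  apply: (arcs_equal (n := n) arc_vector_top (@lspanD _ (alexander_matrix p)) (@lspanZ _ _) (@lspanX _ _)) => // [v' i' k' ltv' lti' k0 lek'|v' i' in_e].
    by rewrite -row_spiral //; exact: lspan_row.
  by rewrite -row_edge //; exact: lspan_row.
have -> : delta_mx 0 a - delta_mx 0 b = (delta_mx 0 a - arc_vector 2 0 0)
    + (-1) *: (delta_mx 0 b - arc_vector 2 0 0) :> 'rV[{poly int}]_(size p).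
  by rewrite scaleN1r opprB addrA subrK.
by apply: lspanD; [|apply: lspanZ]; exact: eq_arc.
Qed.

End AlexanderTrivial.

(** * Jones polynomial *)

Section ColourSums.
Variables (F : comNzRingType) (C : finType).

Definition upd (h : nat -> C) (l : nat) (a : C) : nat -> C :=
  fun m => if m == l then a else h m.

Fixpoint csum (ls : seq nat) (G : (nat -> C) -> F) (h : nat -> C) : F :=
  if ls is l :: ls' then \sum_(a : C) csum ls' G (upd h l a) else G h.

Lemma eq_csum ls G1 G2 h : (forall h, G1 h = G2 h) -> csum ls G1 h = csum ls G2 h.
Proof. by move=> eqG; elim: ls h => //= l ls IH h; apply: eq_bigr => a _. Qed.

Lemma csum_cat ls1 ls2 G h : csum (ls1 ++ ls2) G h = csum ls1 (csum ls2 G) h.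
Proof. by elim: ls1 h => //= l ls IH h; apply: eq_bigr => a _. Qed.

Definition indep (ls : seq nat) (P : (nat -> C) -> F) :=
  forall h l a, l \in ls -> P (upd h l a) = P h.

Lemma csum_factor ls P G h : indep ls P ->
  csum ls (fun h => P h * G h) h = P h * csum ls G h.
Proof.
elim: ls h => //= l ls IH h iP; rewrite big_distrr; apply: eq_bigr => a _ /=.
rewrite IH ?iP ?mem_head // => h' l' a' l'in; apply: iP.
by rewrite in_cons l'in orbT.
Qed.

Lemma csumD ls G1 G2 h :
  csum ls (fun h => G1 h + G2 h) h = csum ls G1 h + csum ls G2 h.
Proof. by elim: ls h => //= l ls IH h; rewrite -big_split; apply: eq_bigr => a _ /=. Qed.

Lemma csum_rename (r : nat -> nat) (supp ls : seq nat) G h :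
  (forall h1 h2, {in supp, h1 =1 h2} -> G h1 = G h2) ->
  {in supp &, injective r} -> {subset ls <= supp} ->
  csum [seq r l | l <- ls] (fun h => G (h \o r)) h = csum ls G (h \o r).
Proof.
move=> extG injr; elim: ls h => //= l ls IH h sub.
have lin : l \in supp by apply: sub; rewrite mem_head.
have sub' : {subset ls <= supp} by move=> m min; apply: sub; rewrite in_cons min orbT.
apply: eq_bigr => a _; rewrite IH //.
have ext2 g1 g2 : {in supp, g1 =1 g2} -> csum ls G g1 = csum ls G g2.
  elim: (ls) g1 g2 => [|m ms IHm] g1 g2 eqg /=; first exact: extG.
  apply: eq_bigr => b _; apply: IHm => z zin; rewrite /upd; case: eqP => // _.
  exact: eqg.
apply: ext2 => m min; rewrite /upd /=.
by have -> : (r m == r l) = (m == l) by apply/eqP/eqP => [/injr->|->].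
Qed.

End ColourSums.

Section LinkColourings.
Variables (F : comNzRingType) (C : finType) (p : PD) (key : slot p -> nat).
Hypothesis key_nbr : forall s t : slot p, key s = key t -> s = t \/ nbr s = t.
Hypothesis nbr_key : forall s : slot p, key (nbr s) = key s.

(** An invariant colouring of the slots is a colouring of the edges, which [key] numbers. The
    induction keeps the colours outside [ls] equal to [h]. *)
Lemma sum_nbr_invariant (ls : seq nat) (Phi : {ffun slot p -> C} -> F) h :
  uniq ls -> (forall s, key s \in ls) -> (forall l, l \in ls -> exists s, key s = l) ->
  \sum_(f | nbr_invariant f) Phi f = csum ls (fun h => Phi [ffun s => h (key s)]) h.
Proof.
move=> uls key_ls ls_key.
pose good (ls : seq nat) (h : nat -> C) (f : {ffun slot p -> C}) := nbr_invariant f &&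
  [forall s, (key s \in ls) || (f s == h (key s))].
suff csumE : forall h, csum ls (fun h => Phi [ffun s => h (key s)]) h =
    \sum_(f | good ls h f) Phi f.
  rewrite csumE; apply: eq_bigl => f; rewrite /good; case: nbr_invariant => //=.
  by symmetry; apply/forallP => s; rewrite key_ls.
elim: ls uls ls_key {key_ls} => [|l ls IH] /= uls ls_key {}h.
  rewrite (big_pred1 [ffun s => h (key s)]) // => f; apply/andP/eqP => [[_ /forallP fh]|->].
    by apply/ffunP => s; rewrite ffunE; apply/eqP; exact: fh.
  split; first by apply/forallP => s; rewrite !ffunE nbr_key.
  by apply/forallP => s; rewrite ffunE eqxx.
case/andP: uls => l_ls uls.
have [sl key_sl] := ls_key l (mem_head _ _).
have inv_key (f : {ffun slot p -> C}) s t : nbr_invariant f -> key s = key t -> f s = f t.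
  move=> /forallP fi /key_nbr[-> //|<-]; exact/esym/eqP/fi.
rewrite [RHS](partition_big (fun f : {ffun slot p -> C} => f sl) xpredT) //=.
apply: eq_bigr => a _; rewrite IH //; last first.
  by move=> m min; apply: ls_key; rewrite in_cons min orbT.
apply: eq_bigl => f; rewrite /good -andbA; case: (boolP (nbr_invariant f)) => //= fi.
apply/forallP/andP => [fh|[/forallP fh /eqP fsl] s].
  have fsl : f sl = a.
    by have := fh sl; rewrite key_sl (negbTE l_ls) /= /upd eqxx => /eqP.
  split; last exact/eqP.
  apply/forallP => s; rewrite in_cons; have := fh s; rewrite /upd.
  by case: (key s =P l) => //= _ ->.
have := fh s; rewrite in_cons /upd; case: (key s =P l) => //= keys _.
by apply/orP; right; rewrite -fsl (inv_key f s sl fi (etrans keys (esym key_sl))).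
Qed.

End LinkColourings.

(* Pairs [(a, b)] standing for [a + b u] with [u ^ 2 = - 3 u - 1]. *)
Definition zu := (Z * Z)%type.
Definition zu_add (x y : zu) : zu := (Z.add x.1 y.1, Z.add x.2 y.2).
Definition zu_mul (x y : zu) : zu :=
  let t := Z.mul x.2 y.2 in
  (Z.sub (Z.mul x.1 y.1) t,
   Z.sub (Z.add (Z.mul x.1 y.2) (Z.mul x.2 y.1)) (Z.mul (Zpos 3) t)).
Definition zu_one : zu := (Zpos 1, Z0).
Definition zu_u : zu := (Z0, Zpos 1).
Definition zu_three : zu := (Zpos 3, Z0).
Definition zu_exp (x : zu) (k : nat) : zu := iter k (zu_mul x) zu_one.

(* A term [(a, ds)] stands for [a] times the product of the Kronecker deltas  *)
(* of the pairs of labels in [ds].                                            *)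
Definition dterm := (zu * seq (nat * nat))%type.
Definition dsum := seq dterm.

Definition dsum_mul (s t : dsum) : dsum :=
  [seq (zu_mul x.1 y.1, x.2 ++ y.2) | x <- s, y <- t].

Fixpoint pull (l : nat) (ds : seq (nat * nat)) : option (nat * seq (nat * nat)) :=
  if ds is d :: ds' then
    if d.1 == l then Some (d.2, ds')
    else if d.2 == l then Some (d.1, ds')
    else omap (fun r => (r.1, d :: r.2)) (pull l ds')
  else None.

Definition rename1 (l o m : nat) := if m == l then o else m.

(** Summing out [l]: a delta containing [l] substitutes its other label, and without such a delta
    the three colours give a factor 3. Trivial deltas go first, so that [l] is never replaced by
    itself. *)
Definition dterm_elim (l : nat) (t : dterm) : dterm :=
  let ds := [seq d <- t.2 | d.1 != d.2] in
  if pull l ds is Some (o, ds') then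
    (t.1, [seq (rename1 l o d.1, rename1 l o d.2) | d <- ds'])
  else (zu_mul zu_three t.1, ds).

Definition dpair (d : nat * nat) := if (d.1 <= d.2)%N then d else (d.2, d.1).
Definition dpair_le (d e : nat * nat) := (d.1 < e.1)%N || (d.1 == e.1) && (d.2 <= e.2)%N.
Definition dterm_norm (t : dterm) : dterm := (t.1, sort dpair_le (map dpair t.2)).

Fixpoint dsum_insert (t : dterm) (s : dsum) : dsum :=
  if s is t' :: s' then
    if t'.2 == t.2 then (zu_add t.1 t'.1, t.2) :: s' else t' :: dsum_insert t s'
  else [:: t].
Definition dsum_norm (s : dsum) : dsum := foldr (fun t => dsum_insert (dterm_norm t)) [::] s.

Definition dsum_elim (l : nat) (s : dsum) : dsum := dsum_norm [seq dterm_elim l t | t <- s].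

(** The crossing weight with A^-1 taken out, which leaves coefficients in Z[u]. *)
Definition dcrossing (x : crossing) : dsum :=
  let: (a, b, c, d) := x in
  [:: (zu_u, [:: (a, b); (c, d)]); (zu_one, [:: (b, c); (d, a)])].

(** * Soundness of the symbolic evaluation *)

Section Evaluation.
Variables (F : comNzRingType) (C : finType) (u : F).
Hypotheses (u_eq : u ^+ 2 = - (3%:R * u) - 1) (card_C : #|C| = 3%N).

Definition zu_val (x : zu) : F := (int_of_Z x.1)%:~R + (int_of_Z x.2)%:~R * u.

Let iz (a : Z) : F := (int_of_Z a)%:~R.

Lemma izD a b : iz (Z.add a b) = iz a + iz b.
Proof. by rewrite /iz -rmorphD -(rmorphD int_of_Z). Qed.
Lemma izB a b : iz (Z.sub a b) = iz a - iz b.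
Proof. by rewrite /iz -rmorphB -(rmorphB int_of_Z). Qed.
Lemma izM a b : iz (Z.mul a b) = iz a * iz b.
Proof. by rewrite /iz -rmorphM -(rmorphM int_of_Z). Qed.

Lemma zu_valD x y : zu_val (zu_add x y) = zu_val x + zu_val y.
Proof. by rewrite /zu_val /zu_add /= -![(int_of_Z _)%:~R]/(iz _) !izD; ring. Qed.

Lemma zu_valM x y : zu_val (zu_mul x y) = zu_val x * zu_val y.
Proof.
case: x y => [a b] [c d]; rewrite /zu_val /zu_mul; cbn [fst snd].
rewrite -![(int_of_Z _)%:~R]/(iz _) !(izB, izD, izM) (_ : iz (Zpos 3) = 3%:R) //.
move: (iz a) (iz b) (iz c) (iz d) => a' b' c' d'.
have -> : (a' + b' * u) * (c' + d' * u) = a' * c' + (a' * d' + b' * c') * u + b' * d' * u ^+ 2.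
  by ring.
by rewrite u_eq; ring.
Qed.

Lemma zu_val1 : zu_val zu_one = 1. Proof. by rewrite /zu_val /= mul0r addr0. Qed.
Lemma zu_valu : zu_val zu_u = u. Proof. by rewrite /zu_val /= mul1r add0r. Qed.
Lemma zu_val3 : zu_val zu_three = 3%:R. Proof. by rewrite /zu_val /= mul0r addr0. Qed.
Lemma zu_valX x k : zu_val (zu_exp x k) = zu_val x ^+ k.
Proof. by elim: k => [|k IH]; rewrite ?zu_val1 //= zu_valM IH exprS. Qed.

Definition deltas (ds : seq (nat * nat)) (h : nat -> C) : F :=
  \prod_(d <- ds) (h d.1 == h d.2)%:R.
Definition dterm_val (t : dterm) h : F := zu_val t.1 * deltas t.2 h.
Definition dsum_val (s : dsum) h : F := \sum_(t <- s) dterm_val t h.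

Lemma dsum_val_mul s t h : dsum_val (dsum_mul s t) h = dsum_val s h * dsum_val t h.
Proof.
rewrite /dsum_val /dsum_mul big_allpairs_dep big_distrl /=; apply: eq_bigr => x _.
rewrite big_distrr; apply: eq_bigr => y _ /=.
by rewrite /dterm_val /deltas /= zu_valM big_cat /=; ring.
Qed.

Lemma pullP l ds h : if pull l ds is Some (o, ds')
  then deltas ds h = (h o == h l)%:R * deltas ds' h
       /\ (forall d, d \in ds' -> d \in ds) /\ ((o, l) \in ds \/ (l, o) \in ds)
  else forall d, d \in ds -> (d.1 != l) && (d.2 != l).
Proof.
elim: ds => //= d ds; case: eqP => [<- _|/eqP n1].
  rewrite /deltas big_cons eq_sym; split=> //; split.
    by move=> e ein; rewrite in_cons ein orbT.
  by right; rewrite -surjective_pairing mem_head.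
case: eqP => [<- _|/eqP n2].
  rewrite /deltas big_cons; split=> //; split.
    by move=> e ein; rewrite in_cons ein orbT.
  by left; rewrite -surjective_pairing mem_head.
case: (pull l ds) => [[o ds']|] /=.
  case=> + [sub mem]; rewrite /deltas !big_cons => ->; rewrite mulrCA; split=> //; split.
    by move=> e; rewrite !in_cons => /orP[->//|/sub->]; rewrite orbT.
  by case: mem => mem; [left|right]; rewrite in_cons mem orbT.
by move=> nin e; rewrite in_cons => /orP[/eqP ->|/nin //]; rewrite n1 n2.
Qed.

Lemma deltas_filter ds h : deltas [seq d <- ds | d.1 != d.2] h = deltas ds h.
Proof.
rewrite /deltas big_filter big_mkcond; apply: eq_bigr => d _.
by case: eqP => //= ->; rewrite eqxx.
Qed.

Lemma deltas_upd_notin l a ds h : (forall d, d \in ds -> (d.1 != l) && (d.2 != l)) ->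
  deltas ds (upd h l a) = deltas ds h.
Proof.
move=> nin; rewrite /deltas !big_seq; apply: eq_bigr => d /nin /andP[/negbTE n1 /negbTE n2].
by rewrite /upd n1 n2.
Qed.

Lemma deltas_rename l o ds h :
  deltas [seq (rename1 l o d.1, rename1 l o d.2) | d <- ds] h = deltas ds (upd h l (h o)).
Proof.
rewrite /deltas big_map; apply: eq_bigr => d _; rewrite /upd /rename1 /=.
by case: (d.1 == l); case: (d.2 == l).
Qed.

Lemma dterm_val_elim l t h : csum [:: l] (dterm_val t) h = dterm_val (dterm_elim l t) h.
Proof.
case: t => z ds; rewrite /dterm_elim /=.
set fs := [seq d <- ds | d.1 != d.2].
have eqfs a : dterm_val (z, ds) (upd h l a) = zu_val z * deltas fs (upd h l a).
  by rewrite /dterm_val /= deltas_filter.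
under eq_bigr do rewrite eqfs.
case E: (pull l fs) => [[o ds']|]; last first.
  have nin : forall d, d \in fs -> (d.1 != l) && (d.2 != l) by have := pullP l fs h; rewrite E.
  under eq_bigr do rewrite deltas_upd_notin //.
  by rewrite sumr_const card_C /dterm_val /= zu_valM zu_val3 -mulr_natl; ring.
have nlo : l != o.
  have := pullP l fs h; rewrite E => -[_ [_ mem]].
  by case: mem; rewrite mem_filter => /andP[/= + _] //; rewrite eq_sym.
rewrite (bigD1 (h o)) //= big1 ?addr0 => [|a neq].
  have := pullP l fs (upd h l (h o)); rewrite E => -[-> _].
  rewrite /dterm_val /= deltas_rename /upd eqxx [o == l]eq_sym (negbTE nlo) eqxx mul1r //.
have := pullP l fs (upd h l a); rewrite E => -[-> _].
by rewrite /upd eqxx [o == l]eq_sym (negbTE nlo) eq_sym (negbTE neq) mul0r mulr0.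
Qed.

Lemma dterm_val_norm t h : dterm_val (dterm_norm t) h = dterm_val t h.
Proof.
rewrite /dterm_val /dterm_norm /deltas /= (perm_big (map dpair t.2)) ?perm_sort //=.
rewrite big_map; congr (_ * _); apply: eq_bigr => d _; rewrite /dpair.
by case: ifP => //= _; rewrite eq_sym.
Qed.

Lemma dsum_val_insert t s h : dsum_val (dsum_insert t s) h = dterm_val t h + dsum_val s h.
Proof.
elim: s => [|t' s IH] /=; rewrite /dsum_val ?big_seq1 ?big_nil ?addr0 //.
case: eqP => [eqt|_]; rewrite !big_cons.
  by rewrite addrA; congr (_ + _); rewrite /dterm_val /= zu_valD eqt mulrDl.
by rewrite -/(dsum_val _ h) IH -/(dsum_val s h) addrCA.
Qed.

Lemma dsum_val_norm s h : dsum_val (dsum_norm s) h = dsum_val s h.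
Proof.
elim: s => //= t s IH; rewrite dsum_val_insert dterm_val_norm IH.
by rewrite /dsum_val big_cons.
Qed.

Lemma csum_dsum_elim l s h : csum [:: l] (dsum_val s) h = dsum_val (dsum_elim l s) h.
Proof.
rewrite /dsum_elim dsum_val_norm /dsum_val big_map /= exchange_big /=.
by apply: eq_bigr => t _; rewrite -dterm_val_elim.
Qed.

Definition crossing_val (x : crossing) (h : nat -> C) : F :=
  let: (a, b, c, d) := x in
  u *+ ((h a == h b) && (h c == h d)) + 1 *+ ((h b == h c) && (h d == h a)).

Lemma dsum_val_crossing x h : dsum_val (dcrossing x) h = crossing_val x h.
Proof.
case: x => [[[a b] c] d]; rewrite /dsum_val /dcrossing !big_cons big_nil addr0.
rewrite /dterm_val /deltas /= !big_cons !big_nil zu_valu zu_val1 !mulr1.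
by rewrite -!natrM !mulnb !mulr_natr.
Qed.

(* [inl x] multiplies by the crossing [x], [inr l] sums over the colours of [l]. *)
Definition instr := (crossing + nat)%type.

Definition run (is_ : seq instr) (s : dsum) : dsum :=
  foldl (fun s i => match i with
    | inl x => dsum_norm (dsum_mul (dcrossing x) s) | inr l => dsum_elim l s end) s is_.

Definition crossings_of (is_ : seq instr) := pmap (fun i => if i is inl x then Some x else None) is_.
Definition labels_of (is_ : seq instr) := pmap (fun i => if i is inr l then Some l else None) is_.

Definition avoids (l : nat) (x : crossing) :=
  let: (a, b, c, d) := x in [&& a != l, b != l, c != l & d != l].

Fixpoint well_ordered (is_ : seq instr) : bool :=
  match is_ with
  | [::] => true
  | inl _ :: is' => well_ordered is'
  | inr l :: is' => all (avoids l) (crossings_of is') && well_ordered is'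
  end.

Lemma crossing_val_avoids l x h a : avoids l x -> crossing_val x (upd h l a) = crossing_val x h.
Proof.
case: x => [[[x0 x1] x2] x3] /and4P[/negbTE n0 /negbTE n1 /negbTE n2 /negbTE n3].
by rewrite /crossing_val /upd n0 n1 n2 n3.
Qed.

(** A label may be summed out before later crossings are multiplied in because these avoid it. The
    label eliminated last is the outermost sum, whence [rev]. *)
Lemma run_correct is_ s h : well_ordered is_ ->
  dsum_val (run is_ s) h = csum (rev (labels_of is_))
    (fun h => (\prod_(x <- crossings_of is_) crossing_val x h) * dsum_val s h) h.
Proof.
elim: is_ s h => [|[x|l] is_ IH] s h /=; first by rewrite big_nil mul1r.
  move=> wo; rewrite IH //; apply: eq_csum => h'.
  rewrite big_cons dsum_val_norm dsum_val_mul dsum_val_crossing; ring.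
case/andP => av wo; rewrite IH // rev_cons -cats1 csum_cat; apply: eq_csum => h'.
rewrite -csum_dsum_elim; symmetry.
apply: (csum_factor (P := fun h => \prod_(x <- crossings_of is_) crossing_val x h)).
move=> h'' l' a; rewrite inE => /eqP ->.
rewrite !big_seq; apply: eq_bigr => x xin; apply: crossing_val_avoids.
by move/allP: av; apply.
Qed.

Definition zu_neg (x : zu) : zu := zu_mul (Zneg 1, Z0) x.
Definition zu_is0 (x : zu) := Z.eqb x.1 Z0 && Z.eqb x.2 Z0.
Definition dsum_eqb (s t : dsum) :=
  all (fun x => zu_is0 x.1) (dsum_norm (s ++ [seq (zu_neg x.1, x.2) | x <- t])).

Lemma zu_valN x : zu_val (zu_neg x) = - zu_val x.
Proof. by rewrite zu_valM {1}/zu_val /= mul0r addr0 mulN1r. Qed.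

Lemma zu_val_is0 x : zu_is0 x -> zu_val x = 0.
Proof. by case: x => a b /andP[/= /Z.eqb_eq -> /Z.eqb_eq ->]; rewrite /zu_val /= mul0r addr0. Qed.

Lemma dsum_eqbP s t h : dsum_eqb s t -> dsum_val s h = dsum_val t h.
Proof.
move=> st; apply/eqP; rewrite -subr_eq0; apply/eqP.
have <- : dsum_val (s ++ [seq (zu_neg x.1, x.2) | x <- t]) h = dsum_val s h - dsum_val t h.
  rewrite /dsum_val big_cat big_map -sumrN; congr (_ + _); apply: eq_bigr => x _.
  by rewrite /dterm_val zu_valN mulNr.
rewrite -dsum_val_norm /dsum_val big_seq big1 // => x xin.
by rewrite /dterm_val zu_val_is0 ?mul0r //; move/allP: st; apply.
Qed.

Definition closed_below m (is_ : seq instr) (s : dsum) :=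
  all (fun x : crossing => let: (a, b, c, d) := x in [&& a < m, b < m, c < m & d < m])%N
    (crossings_of is_)
  && all (fun t : dterm => all (fun d => (d.1 < m) && (d.2 < m))%N t.2) s
  && all (fun l => l < m)%N (labels_of is_).

Lemma run_renamed m (r : nat -> nat) is_ s h :
  well_ordered is_ -> closed_below m is_ s -> {in iota 0 m &, injective r} ->
  csum [seq r l | l <- rev (labels_of is_)]
    (fun h => (\prod_(x <- crossings_of is_) crossing_val x (h \o r)) * dsum_val s (h \o r)) h
  = dsum_val (run is_ s) (h \o r).
Proof.
move=> wo /andP[/andP[cx cs] cl] injr; rewrite run_correct //.
apply: (csum_rename (supp := iota 0 m)
  (G := fun h => (\prod_(x <- crossings_of is_) crossing_val x h) * dsum_val s h)) => //.
  move=> h1 h2 eqh; have {}eqh k : (k < m)%N -> h1 k = h2 k.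
    by move=> ltk; apply: eqh; rewrite mem_iota.
  congr (_ * _).
    rewrite !big_seq; apply: eq_bigr => -[[[a b] c] d] xin.
    by move/allP/(_ _ xin)/and4P: cx => [la lb lc ld]; rewrite /crossing_val !eqh.
  rewrite /dsum_val !big_seq; apply: eq_bigr => t tin; congr (_ * _).
  rewrite /deltas !big_seq; apply: eq_bigr => d din.
  by move/allP/(_ _ tin)/allP/(_ _ din)/andP: cs => [l1 l2]; rewrite !eqh.
by move=> l; rewrite mem_rev mem_iota => /(allP cl).
Qed.

End Evaluation.

(* The tensors of the noncrossing matchings of the three rays (labels 0-2)    *)
(* and the three spirals (labels 3-5) on the boundary of ring [k], shifted by *)
(* [o]; [refl3] is the sum of the three matchings with a diameter.            *)
Definition rot3 (o k : nat) : dsum :=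
  [:: (zu_one, [seq (o + 3 + i, o + ray 2 i k)%N | i <- iota 0 3])].
Definition refl3 (o : nat) : dsum :=
  [seq (zu_one, [seq (o + 3 + i, o + (r + 2 * i) %% 3)%N | i <- iota 0 3]) | r <- iota 0 3].

Definition tensor (F : comNzRingType) (C : finType) (u : F) (o k : nat) (a b d : F)
    (h : nat -> C) : F :=
  a * dsum_val u (rot3 o k) h + b * dsum_val u (rot3 o k.+1) h + d * dsum_val u (refl3 o) h.

(** Labels 0-2 and 3-5 are the outer rays and spirals, 6-8 and 9-11 the inner ones, which are summed
    out. *)
Definition ring_program (k : nat) : seq instr :=
  [seq inl (9 + i, 6 + ray 2 i k, 3 + i, ray 2 i k)%N | i <- iota 0 3]
  ++ [seq inr l | l <- [:: 11; 10; 9; 8; 7; 6]%N].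
(** At the centre a ray and its spiral share an edge, so 6-8 serve for both. *)
Definition core_program : seq instr :=
  [seq inl (6 + i, 6 + ray 2 i 1, 3 + i, ray 2 i 1)%N | i <- iota 0 3]
  ++ [seq inr l | l <- [:: 8; 7; 6]%N].

Definition dsum_scale (z : zu) (s : dsum) : dsum := [seq (zu_mul z t.1, t.2) | t <- s].
Definition zu3 := (zu * zu * zu)%type.
Definition dtensor (k : nat) (c : zu3) : dsum :=
  dsum_scale c.1.1 (rot3 0 k) ++ dsum_scale c.1.2 (rot3 0 k.+1) ++ dsum_scale c.2 (refl3 0).

Definition zn (a b : Z) : zu := (a, b).
(** [ring_col0], [ring_col1] and [ring_col2] are the columns of the transfer matrix of one ring. *)
Definition ring_col0 : zu3 := (zn (Zpos 6) (Zpos 15), zu_one, zu_u).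
Definition ring_col1 : zu3 := (zn (Zpos 55) (Zpos 144), zn Z0 Z0, zn Z0 Z0).
Definition ring_col2 : zu3 := (zn (Zpos 54) (Zpos 141), zn Z0 Z0, zn (Zpos 1) (Zpos 3)).

Definition ring_matrix (c : zu3) : zu3 :=
  (zu_add (zu_add (zu_mul c.1.1 ring_col0.1.1) (zu_mul c.1.2 ring_col1.1.1)) (zu_mul c.2 ring_col2.1.1),
   zu_add (zu_add (zu_mul c.1.1 ring_col0.1.2) (zu_mul c.1.2 ring_col1.1.2)) (zu_mul c.2 ring_col2.1.2),
   zu_add (zu_add (zu_mul c.1.1 ring_col0.2) (zu_mul c.1.2 ring_col1.2)) (zu_mul c.2 ring_col2.2)).

Lemma ring_program_check k : (k < 3)%N ->
  [/\ dsum_eqb (run (ring_program k.+1) (rot3 6 k)) (dtensor k.+1 ring_col0),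
      dsum_eqb (run (ring_program k.+1) (rot3 6 k.+1)) (dtensor k.+1 ring_col1)
    & dsum_eqb (run (ring_program k.+1) (refl3 6)) (dtensor k.+1 ring_col2)].
Proof. by case: k => [|[|[|k]]] // _; split; vm_compute. Qed.

Lemma core_program_check : dsum_eqb (run core_program [:: (zu_one, [::])]) (dtensor 1 ring_col0).
Proof. by vm_compute. Qed.

(** The crossings outside the twist region of vertex 2, whose boundary has the labels 30-35. Labels
    are summed out as soon as their last crossing is in, which keeps the sums small. *)
Definition outer_program : seq instr :=
 [:: inl (4, 31, 35, 5); inr 31; inr 35; inl (22, 32, 33, 15); inr 32; inr 33;
  inl (34, 55, 59, 30); inr 34; inr 30; inl (3, 6, 4, 5); inr 4; inr 5; inl (2, 12, 3, 11);
  inr 3; inl (12, 7, 13, 6); inr 12; inr 6; inl (7, 2, 8, 1); inr 7; inr 2;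
  inl (8, 11, 9, 10); inr 8; inr 11; inl (9, 50, 54, 10); inr 9; inr 10; inl (13, 1, 14, 0);
  inr 13; inr 1; inl (14, 20, 27, 0); inr 14; inr 0; inl (26, 15, 27, 16); inr 15; inr 27;
  inl (16, 20, 17, 21); inr 16; inr 20; inl (21, 25, 22, 26); inr 21; inr 22; inr 26;
  inl (17, 45, 49, 25); inr 17; inr 25; inl (48, 55, 49, 56); inr 55; inr 49;
  inl (53, 45, 54, 46); inr 45; inr 54; inl (52, 56, 53, 57); inr 56; inr 53;
  inl (47, 51, 48, 52); inr 48; inr 52; inl (57, 46, 58, 47); inr 57; inr 46; inr 47;
  inl (58, 50, 59, 51); inr 58; inr 50; inr 59; inr 51]%N.


Lemma ray2_modl i k : ray 2 i (k %% 3) = ray 2 i k.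
Proof. by rewrite /ray /=; lia. Qed.
Lemma ray2_modSl i k : ray 2 i (k %% 3).+1 = ray 2 i k.+1.
Proof. by rewrite /ray /=; lia. Qed.

Lemma rot3_mod o k : rot3 o (k %% 3) = rot3 o k.
Proof. by rewrite /rot3 /= !ray2_modl. Qed.
Lemma rot3_modS o k : rot3 o (k %% 3).+1 = rot3 o k.+1.
Proof. by rewrite /rot3 /= !ray2_modSl. Qed.
Lemma rot3_modSS o k : rot3 o (k %% 3).+2 = rot3 o k.+2.
Proof.
by rewrite -(rot3_modS _ (k %% 3).+1) -(rot3_modS _ k.+1); congr (rot3 o _.+1); lia.
Qed.
Lemma ring_program_mod k : ring_program (k %% 3).+1 = ring_program k.+1.
Proof. by rewrite /ring_program /= !ray2_modSl. Qed.

(** * One ring as a linear map on tensors *)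

Section Tensors.
Variables (F : comNzRingType) (C : finType) (u : F).
Hypotheses (u_eq : u ^+ 2 = - (3%:R * u) - 1) (card_C : #|C| = 3%N).
Implicit Types h : nat -> C.

Lemma csumZ ls a (G : (nat -> C) -> F) h : csum ls (fun h => a * G h) h = a * csum ls G h.
Proof. exact: (csum_factor (P := fun=> a)). Qed.

Lemma dsum_val_scale z s h : dsum_val u (dsum_scale z s) h = zu_val u z * dsum_val u s h.
Proof.
rewrite /dsum_val big_map big_distrr; apply: eq_bigr => t _.
by rewrite /dterm_val /= zu_valM // mulrA.
Qed.

Definition tensor3 o k (c : zu3) h :=
  tensor u o k (zu_val u c.1.1) (zu_val u c.1.2) (zu_val u c.2) h.

Lemma dsum_val_dtensor k c h : dsum_val u (dtensor k c) h = tensor3 0 k c h.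
Proof.
have cat s t : dsum_val u (s ++ t) h = dsum_val u s h + dsum_val u t h.
  exact: big_cat.
by rewrite /dtensor /tensor3 /tensor !cat !dsum_val_scale addrA.
Qed.

(** By linearity and the period 3 of [ray], the finitely many cases of [ring_program_check] cover
    every ring. *)
Lemma csum_ring (r : nat -> nat) k (c : zu3) h : {in iota 0 12 &, injective r} ->
  csum [seq r l | l <- iota 6 6]
    (fun h => (\prod_(x <- crossings_of (ring_program k.+1)) crossing_val u x (h \o r))
              * tensor3 6 k c (h \o r)) h
  = tensor3 0 k.+1 (ring_matrix c) (h \o r).
Proof.
move=> injr; rewrite -ring_program_mod.
have lt3 : (k %% 3 < 3)%N by rewrite ltn_mod.
have [h0 h1 h2] := ring_program_check lt3.
have E s : closed_below 12 (ring_program (k %% 3).+1) s ->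
  csum [seq r l | l <- iota 6 6]
    (fun h => (\prod_(x <- crossings_of (ring_program (k %% 3).+1)) crossing_val u x (h \o r))
              * dsum_val u s (h \o r)) h
  = dsum_val u (run (ring_program (k %% 3).+1) s) (h \o r).
  by move=> cl; rewrite -(run_renamed u_eq card_C _ _ cl).
transitivity (csum [seq r l | l <- iota 6 6] (fun h =>
    (zu_val u c.1.1 * ((\prod_(x <- crossings_of (ring_program (k %% 3).+1)) crossing_val u x (h \o r))
              * dsum_val u (rot3 6 (k %% 3)) (h \o r))
    + zu_val u c.1.2 * ((\prod_(x <- crossings_of (ring_program (k %% 3).+1)) crossing_val u x (h \o r))
              * dsum_val u (rot3 6 (k %% 3).+1) (h \o r)))
    + zu_val u c.2 * ((\prod_(x <- crossings_of (ring_program (k %% 3).+1)) crossing_val u x (h \o r))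
              * dsum_val u (refl3 6) (h \o r))) h).
  by apply: eq_csum => h'; rewrite rot3_mod rot3_modS /tensor3 /tensor; ring.
rewrite !csumD !csumZ !E; try by case: (k %% 3)%N lt3 => [|[|[|m]]].
rewrite (dsum_eqbP u_eq _ h0) (dsum_eqbP u_eq _ h1) (dsum_eqbP u_eq _ h2).
rewrite !dsum_val_dtensor // /tensor3 /tensor rot3_modS rot3_modSS.
rewrite /ring_matrix; cbn [fst snd]; rewrite !(zu_valD, zu_valM) //; ring.
Qed.

Lemma csum_core (r : nat -> nat) h : {in iota 0 9 &, injective r} ->
  csum [seq r l | l <- iota 6 3]
    (fun h => \prod_(x <- crossings_of core_program) crossing_val u x (h \o r)) h
  = tensor3 0 1 ring_col0 (h \o r).
Proof.
move=> injr; rewrite -dsum_val_dtensor // -(dsum_eqbP u_eq _ core_program_check).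
rewrite -(run_renamed u_eq card_C (m := 9)) //; apply: eq_csum => h'.
by rewrite /dsum_val big_seq1 /dterm_val /deltas big_nil zu_val1 !mulr1.
Qed.

End Tensors.

(** * Contraction of the twist region *)

Section TwistRegion.
Variable n : nat.
Notation c := (3 * n).+1.

(* A numbering of the labels that does not depend on [n] outside the interior *)
(* of the twist region of the vertex 2.                                       *)
Definition kap (l : label) : nat :=
  let: (v, i, r) := l in
  if v == 2 then if r == 0 then 30 + i else if r == 2 * c then 33 + i else 60 + 3 * r + i
  else 15 * v + 5 * i + r.

Definition kx (x : name) : crossing :=
  (kap (klbl n (x, 0)), kap (klbl n (x, 1)), kap (klbl n (x, 2)), kap (klbl n (x, 3)))%N.

Arguments kap : simpl never.
Arguments kx : simpl never.

Lemma kap_inner i r : (0 < r)%N -> (r < 2 * c)%N -> kap (2, i, r)%N = (60 + 3 * r + i)%N.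
Proof. by move=> r0 ltr; rewrite /kap eqxx !ifF //; lia. Qed.

Lemma kap_last i : kap (2, i, 2 * rings n 2)%N = (33 + i)%N.
Proof. by rewrite /kap eqxx eqxx. Qed.

Lemma kap_inj : {in valid_label n &, injective kap}.
Proof.
have dec v i r : valid_label n (v, i, r) ->
  [\/ [/\ v != 2, (r < 5)%N & kap (v, i, r) = (15 * v + 5 * i + r)%N],
      v = 2 /\ r = 0%N /\ kap (v, i, r) = (30 + i)%N,
      v = 2 /\ r = (2 * c)%N /\ kap (v, i, r) = (33 + i)%N
    | [/\ v = 2, (0 < r)%N, (r < 2 * c)%N & kap (v, i, r) = (60 + 3 * r + i)%N] ]%N.
  case/and3P => ltv lti; rewrite /kap; case: (v =P 2%N) => [-> ler|v2 ler].
    case: (r =P 0%N) => [->|r0]; first by constructor 2.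
    case: (r =P (2 * c)%N) => [->|rc]; first by constructor 3.
    by constructor 4; split=> //; move: ler; rewrite /rings /=; lia.
  constructor 1; split; [exact/eqP | | by []].
  by case: v ltv v2 ler => [|[|[|[|v]]]] //=; rewrite /rings /=; lia.
move=> [[v i] r] [[v' i'] r'] vl vl'.
have /and3P[ltv lti _] := vl; have /and3P[ltv' lti' _] := vl'.
case: (dec _ _ _ vl) => [[v2 lr ->]|[v2 [lr ->]]|[v2 [lr ->]]|[v2 r0 lr ->]];
case: (dec _ _ _ vl') => [[v2' lr' ->]|[v2' [lr' ->]]|[v2' [lr' ->]]|[v2' r0' lr' ->]] e;
by (congr (_, _, _); lia) || (exfalso; lia).
Qed.

Definition radius k q := nth 0%N [:: c - k.+1; c + k.+1; c - k; c + k]%N q.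
(** Places the labels of [ring_program] around ring [k.+1]: [m %% 3] is the strand, and [m %/ 3]
    selects outer ray, outer spiral, inner ray or inner spiral. *)
Definition r12 k m := kap (2, m %% 3, radius k (m %/ 3))%N.
Definition rho k m := kap (2, m %% 3, if (m < 3)%N then c - k else c + k)%N.

Lemma r12_outer k m : (m < 6)%N -> r12 k m = rho k.+1 m.
Proof. by case: m => [|[|[|[|[|[|m]]]]]]. Qed.
Lemma r12_inner k m : (m < 6)%N -> r12 k (6 + m) = rho k m.
Proof. by case: m => [|[|[|[|[|[|m]]]]]]. Qed.

Lemma r12_label k m : (k < c)%N -> (m < 12)%N -> valid_label n (2, m %% 3, radius k (m %/ 3))%N.
Proof.
move=> ltk ltm; rewrite /valid_label ltn_mod /= /rings /=.
by do 12 (case: m ltm => [|m] ltm; first by rewrite /radius /=; lia).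
Qed.

Lemma r12_inj k : (0 < k)%N -> (k < c)%N -> {in iota 0 12 &, injective (r12 k)}.
Proof.
move=> k0 ltk m m'; rewrite !mem_iota => /andP[_ ltm] /andP[_ ltm'].
move/(kap_inj (r12_label ltk ltm) (r12_label ltk ltm')) => -[em er].
have radP q : (q < 4)%N -> radius k q = (if q < 2 then if q == 0 then c - k.+1 else c + k.+1
   else if q == 2 then c - k else c + k)%N by case: q => [|[|[|[|q]]]].
by move: er; rewrite !radP; [|lia|lia]; do !case: ifP; lia.
Qed.

(** At the innermost ring the inner rays and spirals coincide, so nine labels remain distinct. *)
Lemma r12_inj0 : {in iota 0 9 &, injective (r12 0)}.
Proof.
move=> m m'; rewrite !mem_iota => /andP[_ ltm] /andP[_ ltm'].
have l12 j : (j < 0 + 9)%N -> (j < 12)%N by lia.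
move/(kap_inj (r12_label (k := 0) isT (l12 _ ltm)) (r12_label (k := 0) isT (l12 _ ltm'))) => -[em er].
have radP q : (q < 3)%N -> radius 0 q = (if q == 0 then c - 1 else if q == 1 then c + 1 else c)%N.
  by case: q => [|[|[|q]]] // _; rewrite /radius /= ?subn0.
by move: er; rewrite !radP; [|lia|lia]; do !case: ifP; lia.
Qed.

Definition level k : seq nat := [seq r12 k l | l <- iota 6 (if k == 0 then 3 else 6)%N].
Fixpoint inner k : seq nat := if k is k'.+1 then level k' ++ inner k' else [::].

Lemma level0E : level 0 = [:: 60 + 3 * c; 60 + 3 * c + 1; 60 + 3 * c + 2]%N.
Proof.
rewrite /level /= /r12 /= /radius /= subn0 !kap_inner; try lia.
by rewrite addn0.
Qed.

Lemma levelE k : (0 < k)%N -> (k < c)%N ->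
  level k = [:: 60 + 3 * (c - k); 60 + 3 * (c - k) + 1; 60 + 3 * (c - k) + 2;
                60 + 3 * (c + k); 60 + 3 * (c + k) + 1; 60 + 3 * (c + k) + 2]%N.
Proof.
move=> k0 ltk; rewrite /level; case: eqP => [|_]; first lia.
rewrite /= /r12 /= /radius /= !kap_inner; try lia.
by rewrite !addn0.
Qed.

Lemma mem_inner k l : (k <= c)%N ->
  (l \in inner k) = (0 < k)%N && (60 + 3 * (c - k).+1 <= l < 60 + 3 * (c + k))%N.
Proof.
elim: k => // k IH ltk; rewrite /= mem_cat IH; last exact: ltnW.
case: (posnP k) => [->|k0]; first by rewrite level0E !inE /=; lia.
by rewrite levelE // !inE /=; lia.
Qed.

Lemma inner_uniq k : (k <= c)%N -> uniq (inner k).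
Proof.
elim: k => // k IH ltk; rewrite /= cat_uniq IH ?andbT; last exact: ltnW.
apply/andP; split.
  case: (posnP k) => [->|k0]; first by rewrite level0E /= !inE; lia.
  by rewrite levelE // /= !inE; lia.
apply/hasPn => l; rewrite mem_inner ?(ltnW ltk) // => /andP[k0 lk].
by rewrite levelE // !inE; lia.
Qed.

Lemma kx_ring i k : (k < c)%N -> (i < 3)%N ->
  kx (2, i, k.+1)%N = (r12 k (9 + i), r12 k (6 + ray 2 i k.+1), r12 k (3 + i),
                       r12 k (ray 2 i k.+1))%N.
Proof.
move=> ltk lti; have lr := ray_lt3 2 i k.+1.
have [e1 f1] : ((9 + i) %% 3 = i)%N /\ ((9 + i) %/ 3 = 3)%N by lia.
have [e2 f2] : ((3 + i) %% 3 = i)%N /\ ((3 + i) %/ 3 = 1)%N by lia.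
have [e3 f3] : ((6 + ray 2 i k.+1) %% 3 = ray 2 i k.+1)%N /\ ((6 + ray 2 i k.+1) %/ 3 = 2)%N by lia.
have [e4 f4] : (ray 2 i k.+1 %% 3 = ray 2 i k.+1)%N /\ (ray 2 i k.+1 %/ 3 = 0)%N by lia.
rewrite /r12 e1 f1 e2 f2 e3 f3 e4 f4 /kx /klbl /= /rings /= /radius /=.
by congr (kap (_, _, _), kap (_, _, _), kap (_, _, _), kap (_, _, _)); lia.
Qed.

Variables (F : comNzRingType) (C : finType) (u : F).
Hypotheses (u_eq : u ^+ 2 = - (3%:R * u) - 1) (card_C : #|C| = 3%N).
Implicit Types h : nat -> C.

Definition ring_val k h := \prod_(i <- iota 0 3) crossing_val u (kx (2, i, k)%N) h.

Lemma ring_val_program k h : (k < c)%N ->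
  ring_val k.+1 h = \prod_(x <- crossings_of (ring_program k.+1)) crossing_val u x (h \o r12 k).
Proof.
by move=> ltk; rewrite /ring_val [iota 0 3]/= !big_cons !big_nil !kx_ring.
Qed.

Lemma ring_val_core h :
  ring_val 1 h = \prod_(x <- crossings_of core_program) crossing_val u x (h \o r12 0).
Proof.
rewrite /ring_val [iota 0 3]/= !big_cons !big_nil !kx_ring //.
have e i : (i < 3)%N -> r12 0 (9 + i) = r12 0 (6 + i).
  by move=> lti; rewrite !r12_inner /rho //; case: i lti => [|[|[|i]]] //= _; rewrite ?subn0 ?addn0.
by rewrite !e.
Qed.

Lemma ring_val_indep k : (k < c)%N -> indep (inner k) (ring_val k.+1).
Proof.
move=> ltk h l a; rewrite mem_inner; last exact: ltnW.
move=> /andP[k0 lk]; rewrite /ring_val !big_seq; apply: eq_bigr => i.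
rewrite mem_iota => /andP[_ lti]; apply: crossing_val_avoids; rewrite kx_ring //.
have av m : (m < 12)%N -> r12 k m != l.
  move=> ltm; rewrite /r12; have : (m %/ 3 < 4)%N by lia.
  have := ltn_pmod m (isT : (0 < 3)%N); move: (m %% 3)%N (m %/ 3)%N => i' q lti' ltq; rewrite /kap eqxx.
  by case: q ltq => [|[|[|[|q]]]] // _; rewrite /radius /=;
    (do ?case: ifP => _; lia).
by have lr := ray_lt3 2 i k.+1; rewrite /avoids !av //; lia.
Qed.

Lemma dsum_val_shift (s : dsum) o h (r1 r2 : nat -> nat) : (forall m, (m < 6)%N -> r1 (o + m)%N = r2 m) ->
  all (fun t : dterm => all (fun d => (d.1 < 6) && (d.2 < 6))%N t.2) s ->
  dsum_val u [seq (t.1, [seq (o + d.1, o + d.2)%N | d <- t.2]) | t <- s] (h \o r1)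
  = dsum_val u s (h \o r2) :> F.
Proof.
move=> er /allP cs; rewrite /dsum_val big_map !big_seq; apply: eq_bigr => t tin.
congr (_ * _); rewrite /deltas big_map !big_seq; apply: eq_bigr => d din /=.
by have /allP/(_ _ din)/andP[l1 l2] := cs _ tin; rewrite !er.
Qed.

Lemma tensor3_inner k z h : tensor3 u 6 k z (h \o r12 k) = tensor3 u 0 k z (h \o rho k).
Proof.
have er m : (m < 6)%N -> r12 k (6 + m)%N = rho k m by exact: r12_inner.
have lr i j : (ray 2 i j < 6)%N by apply: leq_trans (ray_lt3 2 i j) _.
rewrite /tensor3 /tensor; congr (_ * _ + _ * _ + _ * _).
- rewrite -(@dsum_val_shift (rot3 0 k) 6 h (r12 k) (rho k)) //.
  by rewrite /rot3 /= !lr.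
- rewrite -(@dsum_val_shift (rot3 0 k.+1) 6 h (r12 k) (rho k)) //.
  by rewrite /rot3 /= !lr.
by rewrite -(@dsum_val_shift (refl3 0) 6 h (r12 k) (rho k)).
Qed.

Lemma tensor3_outer k z h : tensor3 u 0 k.+1 z (h \o r12 k) = tensor3 u 0 k.+1 z (h \o rho k.+1).
Proof.
have er m : (m < 6)%N -> r12 k (0 + m)%N = rho k.+1 m by exact: r12_outer.
have lr i j : (ray 2 i j < 6)%N by apply: leq_trans (ray_lt3 2 i j) _.
rewrite /tensor3 /tensor; congr (_ * _ + _ * _ + _ * _).
- rewrite -(@dsum_val_shift (rot3 0 k.+1) 0 h (r12 k) (rho k.+1)) //.
  by rewrite /rot3 /= !lr.
- rewrite -(@dsum_val_shift (rot3 0 k.+2) 0 h (r12 k) (rho k.+1)) //.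
  by rewrite /rot3 /= !lr.
by rewrite -(@dsum_val_shift (refl3 0) 0 h (r12 k) (rho k.+1)).
Qed.

Definition twist_coef k : zu3 := iter k.-1 ring_matrix ring_col0.

(** Contraction from the centre outwards, each ring applying [ring_matrix] once more. The arbitrary
    factor [P] carries the next ring and the rest of the diagram through the induction. *)
Lemma csum_twist k (P : (nat -> C) -> F) h : (0 < k)%N -> (k <= c)%N -> indep (inner k) P ->
  csum (inner k) (fun h => P h * \prod_(j <- iota 1 k) ring_val j h) h
  = P h * tensor3 u 0 k (twist_coef k) (h \o rho k).
Proof.
case: k => // k _; elim: k P h => [|k IH] P h ltk iP.
  rewrite csum_factor // /inner cats0 -tensor3_outer -(csum_core u_eq card_C) ?r12_inj0 //.
    by congr (_ * _); apply: eq_csum => h'; rewrite big_seq1 ring_val_core.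
  exact: r12_inj0.
rewrite -[inner k.+2]/(level k.+1 ++ inner k.+1) csum_cat.
have iP1 : indep (inner k.+1) P.
  by move=> h' l a lin; apply: iP; rewrite -[inner k.+2]/(level k.+1 ++ inner k.+1) mem_cat lin orbT.
have iP2 : indep (level k.+1) P.
  by move=> h' l a lin; apply: iP; rewrite -[inner k.+2]/(level k.+1 ++ inner k.+1) mem_cat lin.
transitivity (csum (level k.+1) (fun h => P h *
    (ring_val k.+2 h * tensor3 u 0 k.+1 (twist_coef k.+1) (h \o rho k.+1))) h).
  apply: eq_csum => h'.
  rewrite mulrA -(IH (fun h => P h * ring_val k.+2 h)) ?(ltnW ltk) //.
    apply: eq_csum => h''.
    have -> : iota 1 k.+2 = iota 1 k.+1 ++ [:: k.+2].
      by rewrite -(addn1 k.+1) iotaD; congr (_ ++ _); rewrite /= addnC.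
    rewrite big_cat big_seq1.
    by rewrite -[in RHS]mulrA [in RHS](mulrC (ring_val _ _)).
  by move=> h'' l a lin; rewrite iP1 // ring_val_indep.
rewrite csum_factor //; congr (_ * _).
rewrite -tensor3_outer -(csum_ring u_eq card_C) //; last exact: r12_inj.
by apply: eq_csum => h'; rewrite tensor3_inner ring_val_program.
Qed.

End TwistRegion.

(* the values of [outer_program] on the three tensors *)
Definition outer0 : zu := zn (Zpos 308637) (Zpos 808344).
Definition outer1 : zu := zn (Zpos 2230413) (Zpos 5839344).
Definition outer2 : zu := zn (Zneg 3051963) (Zneg 7989792).
Definition outer_labels : seq nat := rev (labels_of outer_program).

(** * The colour sum of the whole diagram *)

Section ColourPartition.
Variable n : nat.
Notation c := (3 * n).+1.
Notation kap := (kap n).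
Notation kx := (kx n).
Notation p := [seq kcr n x | x <- knames n].
Notation kslot := (@kslot n).

Definition all_labels := outer_labels ++ inner n c.

Lemma all_labels_uniq : uniq all_labels.
Proof.
rewrite cat_uniq inner_uniq // andbT; apply/andP; split; first by vm_compute.
apply/hasPn => l; rewrite mem_inner // => /andP[_ /andP[lel _]].
have : all (fun l => l < 60)%N outer_labels by vm_compute.
by move/allP => lt60; apply/negP => /lt60; lia.
Qed.

Lemma kap_in_labels l : valid_label n l -> kap l \in all_labels.
Proof.
case: l => [[v i] r] /and3P[ltv lti ler]; rewrite mem_cat.
case: (v =P 2%N) => [ev|v2]; last first.
  have lr : (r <= 2 * nth 0 [:: 2; 1; 0; 2] v)%N.
    by case: v ltv v2 ler => [|[|[|[|v]]]].
  rewrite /Submission.kap (negbTE (introN eqP v2)).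
  have : all (fun v => all (fun i => all (fun r => (15 * v + 5 * i + r)%N \in outer_labels)
    (iota 0 (2 * nth 0 [:: 2; 1; 0; 2] v).+1)) (iota 0 3)) [:: 0; 1; 3]%N by vm_compute.
  move/allP/(_ v) => /(_ _)/allP/(_ i) => /(_ _ _)/allP/(_ r) => -> //.
  - by case: v ltv v2 {ler lr} => [|[|[|[|v]]]].
  - by rewrite mem_iota.
  by rewrite mem_iota.
rewrite {v}ev in ltv ler *; rewrite /Submission.kap eqxx.
have : all (fun i => ((30 + i)%N \in outer_labels) && ((33 + i)%N \in outer_labels)) (iota 0 3).
  by vm_compute.
move/allP/(_ i); rewrite mem_iota => /(_ lti)/andP[i1 i2].
case: eqP => [_|r0]; first by rewrite i1.
case: eqP => [_|rc]; first by rewrite i2.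
have -> : (60 + 3 * r + i)%N \in inner n c; last exact: orbT.
by rewrite mem_inner //; move: ler; rewrite /rings /=; lia.
Qed.

Lemma labels_kap l : l \in all_labels -> exists2 z, valid_label n z & kap z = l.
Proof.
rewrite mem_cat => /orP[lin|].
  have : all (fun l => (30 <= l < 36)%N || [&& l %/ 15 != 2, l %/ 15 < 4
    & l %% 5 <= 2 * nth 0 [:: 2; 1; 0; 2] (l %/ 15)]%N) outer_labels by vm_compute.
  move/allP/(_ l lin) => /orP[/andP[l1 l2]|/and3P[v2 lv lr]].
    case: (ltnP l 33) => l3.
      exists (2, l - 30, 0)%N; first by rewrite /valid_label /=; lia.
      by rewrite /Submission.kap !eqxx; lia.
    exists (2, l - 33, 2 * rings n 2)%N; last by rewrite kap_last; lia.
    by rewrite /valid_label leqnn /=; lia.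
  exists (l %/ 15, (l %% 15) %/ 5, l %% 5)%N; last by rewrite /Submission.kap (negbTE v2); lia.
  rewrite /valid_label lv /=; apply/andP; split; first lia.
  by case: (l %/ 15)%N lv v2 lr => [|[|[|[|v]]]].
rewrite mem_inner // => /andP[_ /andP[l1 l2]].
exists (2, (l - 60) %% 3, (l - 60) %/ 3)%N; last by rewrite kap_inner; lia.
by rewrite /valid_label /= /rings /=; lia.
Qed.

Definition slot_key (s : slot p) : nat :=
  kap (klbl n (nth (0, 0, 0)%N (knames n) s.1, val s.2)).

Lemma slot_key_kslot e : ends_in (knames n) e -> slot_key (kslot e) = kap (klbl n e).
Proof.
case: e => x q /andP[/= xin ltq]; rewrite /slot_key /kslot /nslot /= inordK //.
by rewrite val_named // nth_index.
Qed.

Lemma slot_key_nbr (s t : slot p) : slot_key s = slot_key t -> s = t \/ nbr s = t.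
Proof.
have [e ein ->] := nslot_surj (knames_uniq n) (x0_in n) s.
have [f fin ->] := nslot_surj (knames_uniq n) (x0_in n) t.
rewrite -/(kslot e) -/(kslot f) !slot_key_kslot // => ekap; apply: kslabel_nbr.
have [ve xe _] := klblP ein; have [vf xf _] := klblP fin.
rewrite /Submission.kslot !slabel_nslot // xe xf.
by rewrite (kap_inj ve vf ekap).
Qed.

Lemma nbr_slot_key (s : slot p) : slot_key (nbr s) = slot_key s.
Proof.
have [l vl FG] := kslot_FG s; have [Fin Gin lF lG _] := kends vl.
by case: FG => ->; rewrite ?nbr_kF ?nbr_kG // !slot_key_kslot // lF lG.
Qed.

Variables (F : comNzRingType) (C : finType) (u : F).
Hypotheses (u_eq : u ^+ 2 = - (3%:R * u) - 1) (card_C : #|C| = 3%N).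
Implicit Types h : nat -> C.

Lemma outer_crossings h :
  \prod_(x <- knames n) crossing_val u (kx x) h =
  (\prod_(x <- crossings_of outer_program) crossing_val u x h)
  * \prod_(j <- iota 1 c) ring_val n u j h.
Proof.
(* For a variable [n] the test for the last label in [kap] does not compute, so the three edge
   crossings involving it are first rewritten to numerals. *)
have kl i : Submission.kap n (2, i, 2 * rings n 2)%N = (33 + i)%N by exact: kap_last.
have E0 : kx (0, 1, 0)%N = (4, 31, 35, 5)%N.
  by rewrite /Submission.kx -[X in (_, _, X, _)]/(Submission.kap n (2, 2, 2 * rings n 2)%N) kl.
have E1 : kx (1, 0, 0)%N = (22, 32, 33, 15)%N.
  by rewrite /Submission.kx -[X in (_, _, X, _)]/(Submission.kap n (2, 0, 2 * rings n 2)%N) kl.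
have E2 : kx (2, 0, 0)%N = (34, 55, 59, 30)%N.
  by rewrite /Submission.kx -[X in (X, _, _, _)]/(Submission.kap n (2, 1, 2 * rings n 2)%N) kl.
pose V v := \prod_(i <- iota 0 3) \prod_(k <- iota 1 (rings n v)) crossing_val u (kx (v, i, k)) h.
have V2 : V 2%N = \prod_(j <- iota 1 c) ring_val n u j h by rewrite /V exchange_big.
transitivity ((\prod_(e <- kedges) crossing_val u (kx (e.1, e.2, 0%N)) h) * \prod_(v <- iota 0 4) V v).
  exact: big_knames.
have -> : \prod_(v <- iota 0 4) V v = V 0%N * V 1%N * V 2%N * V 3%N.
  by rewrite !big_cons big_nil mulr1 !mulrA.
rewrite V2; set W := \prod_(j <- iota 1 c) _.
pose el := [seq kx (e.1, e.2, 0%N) | e <- kedges].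
pose vl v := [seq kx (v, ik.1, ik.2) | ik <- [seq (i, k) | i <- iota 0 3, k <- iota 1 (rings n v)]].
have Vl v : V v = \prod_(x <- vl v) crossing_val u x h.
  by rewrite /V /vl big_map big_allpairs_dep.
have -> : \prod_(e <- kedges) crossing_val u (kx (e.1, e.2, 0%N)) h
    = \prod_(x <- el) crossing_val u x h by rewrite /el big_map.
rewrite !Vl; transitivity ((\prod_(x <- el) crossing_val u x h * (\prod_(x <- vl 0%N) crossing_val u x h
   * (\prod_(x <- vl 1%N) crossing_val u x h * \prod_(x <- vl 3%N) crossing_val u x h))) * W).
  by ring.
congr (_ * _).
rewrite -!big_cat; apply: perm_big.
have -> : el = [:: kx (0, 0, 0); (4, 31, 35, 5); kx (0, 2, 0); (22, 32, 33, 15); kx (1, 2, 0);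
                 (34, 55, 59, 30)]%N by rewrite /el /= E0 E1 E2.
by vm_compute.
Qed.

Lemma outer_indep : indep (inner n c)
  (fun h => \prod_(x <- crossings_of outer_program) crossing_val u x h).
Proof.
move=> h l a; rewrite mem_inner // => /andP[_ /andP[lel _]].
rewrite !big_seq; apply: eq_bigr => x xin; apply: crossing_val_avoids.
have : all (fun x : crossing => let: (x0, x1, x2, x3) := x in
    [&& x0 < 60, x1 < 60, x2 < 60 & x3 < 60])%N (crossings_of outer_program) by vm_compute.
move/allP/(_ x xin); case: x {xin} => [[[x0 x1] x2] x3] /and4P[l0 l1 l2 l3].
by apply/and4P; split; lia.
Qed.

Definition dot3 (z : zu3) : F :=
  zu_val u z.1.1 * zu_val u outer0 + zu_val u z.1.2 * zu_val u outer1
  + zu_val u z.2 * zu_val u outer2.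

Lemma csum_outer z h :
  csum outer_labels (fun h => (\prod_(x <- crossings_of outer_program) crossing_val u x h)
    * tensor3 u 30 1 z h) h = dot3 z.
Proof.
have wo : well_ordered outer_program by vm_compute.
have E s v : run outer_program s = [:: (v, [::])] ->
  csum outer_labels (fun h => (\prod_(x <- crossings_of outer_program) crossing_val u x h)
    * dsum_val u s h) h = zu_val u v.
  move=> rs; rewrite -(run_correct u_eq card_C) // rs /dsum_val big_seq1.
  by rewrite /dterm_val /deltas big_nil mulr1.
pose P h := \prod_(x <- crossings_of outer_program) crossing_val u x h.
transitivity (csum outer_labels (fun h =>
    (zu_val u z.1.1 * (P h * dsum_val u (rot3 30 1) h)
     + zu_val u z.1.2 * (P h * dsum_val u (rot3 30 2) h))
     + zu_val u z.2 * (P h * dsum_val u (refl3 30) h)) h).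
  by apply: eq_csum => h'; rewrite /tensor3 /tensor /P; ring.
rewrite !csumD !csumZ /P (E _ outer0); last by vm_compute.
rewrite (E _ outer1); last by vm_compute.
by rewrite (E _ outer2); last by vm_compute.
Qed.

(** Since [c] is 1 modulo 3, the basis tensors at the rim are those after one ring. *)
Lemma tensor3_boundary z h : tensor3 u 0 c z (h \o rho n c) = tensor3 u 30 1 z h.
Proof.
have er m : (m < 6)%N -> (30 + m)%N = rho n c m.
  have k0 i : kap (2, i, c - c)%N = (30 + i)%N by rewrite subnn.
  have k1 i : kap (2, i, c + c)%N = (33 + i)%N by rewrite addnn -mul2n -[c]/(rings n 2) kap_last.
  case: m => [|[|[|[|[|[|m]]]]]] // _.
  - exact: (esym (k0 0%N)).
  - exact: (esym (k0 1%N)).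
  - exact: (esym (k0 2%N)).
  - exact: (esym (k1 0%N)).
  - exact: (esym (k1 1%N)).
  exact: (esym (k1 2%N)).
have lr i j : (ray 2 i j < 6)%N by apply: leq_trans (ray_lt3 2 i j) _.
have m1 : rot3 30 1 = rot3 30 c by rewrite -(rot3_mod 30 c); congr rot3; lia.
have m2 : rot3 30 2 = rot3 30 c.+1 by rewrite -(rot3_modS 30 c); congr rot3; lia.
rewrite /tensor3 /tensor m1 m2; congr (_ * _ + _ * _ + _ * _).
- rewrite -(@dsum_val_shift _ _ u (rot3 0 c) 30 h id (rho n c)) //.
  by rewrite /rot3 /= !lr.
- rewrite -(@dsum_val_shift _ _ u (rot3 0 c.+1) 30 h id (rho n c)) //.
  by rewrite /rot3 /= !lr.
by rewrite -(@dsum_val_shift _ _ u (refl3 0) 30 h id (rho n c)).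
Qed.

Lemma csum_all h :
  csum all_labels (fun h => \prod_(x <- knames n) crossing_val u (kx x) h) h
  = dot3 (twist_coef c).
Proof.
rewrite csum_cat -(csum_outer _ h); apply: eq_csum => h'.
rewrite -tensor3_boundary -(csum_twist u_eq card_C
  (P := fun h => \prod_(x <- crossings_of outer_program) crossing_val u x h)) //;
  last exact: outer_indep.
by apply: eq_csum => h''; rewrite outer_crossings.
Qed.

End ColourPartition.

(** * A recurrence in [n] *)

Section JonesRecurrence.
Variables (F : comNzRingType) (u : F).
Hypothesis u_eq : u ^+ 2 = - (3%:R * u) - 1.

Definition scale3 (a : zu) (z : zu3) : zu3 := (zu_mul a z.1.1, zu_mul a z.1.2, zu_mul a z.2).

Definition add3 (x y : zu3) : zu3 :=
  (zu_add x.1.1 y.1.1, zu_add x.1.2 y.1.2, zu_add x.2 y.2).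
(** Adding u^6 times the first vector kills its component of eigenvalue - u^6 under three rings and
    leaves an eigenvector for - u^12. *)
Definition eigen3 : zu3 :=
  add3 (twist_coef 4) (scale3 (zu_exp zu_u 6) (twist_coef 1)).

Lemma eigen3P : iter 3 ring_matrix eigen3 = scale3 (zu_neg (zu_exp zu_u 12)) eigen3.
Proof. by vm_compute. Qed.

Definition val3 (z : zu3) : F * F * F := (zu_val u z.1.1, zu_val u z.1.2, zu_val u z.2).
Definition ring_map (x : F * F * F) : F * F * F :=
  let k z := zu_val u z in
  (x.1.1 * k ring_col0.1.1 + x.1.2 * k ring_col1.1.1 + x.2 * k ring_col2.1.1,
   x.1.1 * k ring_col0.1.2 + x.1.2 * k ring_col1.1.2 + x.2 * k ring_col2.1.2,
   x.1.1 * k ring_col0.2 + x.1.2 * k ring_col1.2 + x.2 * k ring_col2.2).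
Definition comb3 (a : F) (x : F * F * F) (b : F) (y : F * F * F) : F * F * F :=
  (a * x.1.1 + b * y.1.1, a * x.1.2 + b * y.1.2, a * x.2 + b * y.2).

Lemma val3_ring z : val3 (ring_matrix z) = ring_map (val3 z).
Proof.
by rewrite /val3 /ring_matrix /ring_map; cbn [fst snd]; rewrite !(zu_valD, zu_valM).
Qed.

Lemma val3_iter k z : val3 (iter k ring_matrix z) = iter k ring_map (val3 z).
Proof. by elim: k => //= k IH; rewrite val3_ring IH. Qed.

Lemma ring_map_comb a x b y : ring_map (comb3 a x b y) = comb3 a (ring_map x) b (ring_map y).
Proof. by rewrite /ring_map /comb3 /=; congr (_, _, _); ring. Qed.

Lemma iter_ring_map_comb k a x b y :
  iter k ring_map (comb3 a x b y) = comb3 a (iter k ring_map x) b (iter k ring_map y).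
Proof. by elim: k => //= k ->; rewrite ring_map_comb. Qed.

Lemma val3_scale a z : val3 (scale3 a z) = comb3 (zu_val u a) (val3 z) 0 (val3 z).
Proof. by rewrite /val3 /scale3 /comb3; cbn [fst snd]; rewrite !zu_valM // !mul0r !addr0. Qed.

Lemma val3_add x y : val3 (add3 x y) = comb3 1 (val3 x) 1 (val3 y).
Proof. by rewrite /val3 /add3 /comb3; cbn [fst snd]; rewrite !zu_valD !mul1r. Qed.

Lemma comb3_comb3 a x b c d y : comb3 a x b (comb3 c y d y) = comb3 a x (b * (c + d)) y.
Proof. by rewrite /comb3 /=; congr (_, _, _); ring. Qed.

Lemma comb3_eigen a b x : comb3 a (comb3 b x 0 x) 0 (comb3 b x 0 x) = comb3 (b * a) x 0 x.
Proof. by rewrite /comb3 /=; congr (_, _, _); ring. Qed.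

Lemma comb3_1 x : comb3 1 x 0 x = x.
Proof. by case: x => [[a b] d]; rewrite /comb3 /= !mul1r !mul0r !addr0. Qed.

Lemma val3_twist_next m :
  val3 (twist_coef (3 * m.+1).+1) = iter 3 ring_map (val3 (twist_coef (3 * m).+1)).
Proof. by rewrite -val3_iter -iterD; congr val3; rewrite /twist_coef mulnS. Qed.

Lemma twist_coef_rec n :
  comb3 1 (val3 (twist_coef (3 * n.+1).+1)) (u ^+ 6) (val3 (twist_coef (3 * n).+1))
  = comb3 ((- u ^+ 12) ^+ n) (val3 eigen3) 0 (val3 eigen3).
Proof.
have e : val3 eigen3 = comb3 1 (val3 (twist_coef 4)) (u ^+ 6) (val3 (twist_coef 1)).
  rewrite /eigen3; move: (twist_coef 4) (twist_coef 1) => x1 x0.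
  by rewrite val3_add val3_scale comb3_comb3 addr0 mul1r zu_valX // zu_valu.
move: eigen3 eigen3P e => E EP e; elim: n => [|n IH].
  by rewrite expr0 comb3_1; exact: esym e.
rewrite val3_twist_next [X in comb3 _ _ _ X]val3_twist_next -iter_ring_map_comb IH.
rewrite iter_ring_map_comb -val3_iter EP val3_scale comb3_eigen.
by rewrite zu_valN // zu_valX // zu_valu [_ ^+ n.+1]exprS.
Qed.

Definition dotF (f x : F * F * F) : F := x.1.1 * f.1.1 + x.1.2 * f.1.2 + x.2 * f.2.

Lemma dotF_comb f a x b y : dotF f (comb3 a x b y) = a * dotF f x + b * dotF f y.
Proof. by rewrite /dotF /comb3 /=; ring. Qed.

Lemma dot3_rec n :
  dot3 u (twist_coef (3 * n.+1).+1) + u ^+ 6 * dot3 u (twist_coef (3 * n).+1)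
  = (- u ^+ 12) ^+ n * dot3 u eigen3.
Proof.
have := congr1 (dotF (zu_val u outer0, zu_val u outer1, zu_val u outer2)) (twist_coef_rec n).
by rewrite !dotF_comb mul1r mul0r addr0.
Qed.

End JonesRecurrence.

(** * Values of the Jones polynomials and their separation *)

Section JonesValue.
Variables (n : nat) (F : fieldType) (A : F).
Hypotheses (A_neq0 : A != 0) (A_eq : A ^+ 4 + 3%:R * A ^+ 2 + 1 = 0).
Notation u := (A ^+ 2).
Notation p := [seq kcr n x | x <- knames n].
Notation kslot := (@kslot n).

Lemma u_relation : u ^+ 2 = - (3%:R * u) - 1.
Proof. by apply/eqP; rewrite -subr_eq0 -[X in _ == X]A_eq; apply/eqP; ring. Qed.

Lemma loop_relation : #|'I_3|%:R = - A ^+ 2 - A ^- 2.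
Proof.
rewrite card_ord; apply: (mulIf (expf_neq0 2 A_neq0)).
rewrite mulrBl mulVf ?expf_neq0 //; apply/eqP; rewrite -subr_eq0 -[X in _ == X]A_eq.
by apply/eqP; ring.
Qed.

Lemma colour_weightE (x0 x1 x2 x3 : 'I_3) :
  colour_weight A x0 x1 x2 x3 =
  A^-1 * (u *+ ((x0 == x1) && (x2 == x3)) + 1 *+ ((x1 == x2) && (x3 == x0))).
Proof. by rewrite /colour_weight mulrDr !mulrnAr mulr1 expr2 mulKf. Qed.

(** Each of the 24 + 9n crossings contributes A^-1 and the writhe contributes (- A^3)^(-n); together
    they make (-1)^n u^(-12 - 6n). The 3 is the value of the circle that the bracket omits. *)
Lemma jones_value : exists2 J : F, laurent_eval A (jones (Kn n)) J &
  3%:R * J * u ^+ 12 = (-1) ^+ n * u ^- (6 * n) * dot3 u (twist_coef (3 * n).+1).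
Proof.
rewrite Kn_names.
have p_gt0 : (0 < size p)%N by rewrite size_map size_knames.
have [K evK] := laurent_eval_bracket (@knbrK n) (@knbr_free n) A_neq0 loop_relation p_gt0.
rewrite card_ord => sumK.
exists ((- A ^+ 3) ^ (- n%:Z) * K).
  rewrite /jones writhe_Kn; apply: laurent_evalM evK; apply: laurent_eval_exprz.
    by apply/laurent_evalN/laurent_evalX/laurent_eval_var.
  by rewrite !invrN -!exprVn; apply/laurent_evalN/laurent_evalX/laurent_eval_varV.
have {}sumK : 3%:R * K = A ^- (24 + 9 * n) * dot3 u (twist_coef (3 * n).+1).
  rewrite sumK (sum_nbr_invariant (@slot_key_nbr n) (@nbr_slot_key n) _ (fun=> ord0)
    (all_labels_uniq n)); last first.
  - move=> l /labels_kap[z vz <-]; have [Fin _ lF _ _] := kends vz.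
    by exists (kslot (kF n z)); rewrite slot_key_kslot // lF.
  - move=> s; have [e ein ->] := nslot_surj (knames_uniq n) (x0_in n) s.
    rewrite -/(kslot e) slot_key_kslot //; apply: kap_in_labels.
    by have [] := klblP ein.
  rewrite -(csum_all n u_relation (card_ord 3) (fun=> ord0)) -csumZ; apply: eq_csum => h.
  rewrite (big_named (knames_uniq n) (x0_in n)).
  have -> : A ^- (24 + 9 * n) = \prod_(x <- knames n) A^-1.
    by rewrite big_const_seq count_predT size_knames -exprVn -Monoid.iteropE.
  rewrite -big_split /= !big_seq; apply: eq_bigr => x xin.
  have key q : (q < 4)%N -> slot_key (named (kcr n) (x0_in n) x, inord q) = kap n (klbl n (x, q)).
    by move=> ltq; rewrite -(slot_key_kslot (e := (x, q))) // /ends_in xin.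
  by rewrite colour_weightE !ffunE !key.
have -> : 3%:R * ((- A ^+ 3) ^ (- n%:Z) * K) * u ^+ 12
    = (- A ^+ 3) ^ (- n%:Z) * u ^+ 12 * (3%:R * K) by ring.
rewrite sumK; move: (dot3 _ _) => D.
rewrite -exprnN (exprNn (A ^+ 3) n) -!exprM.
have A0 k : A ^+ k != 0 by exact: expf_neq0.
have -> : A ^+ (24 + 9 * n) = A ^+ (2 * 12) * A ^+ (9 * n) by rewrite -exprD.
have -> : A ^+ (2 * (6 * n)) = A ^+ (3 * n) * A ^+ (9 * n) by rewrite -exprD; congr (_ ^+ _); lia.
move: (A0 (2 * 12)%N) (A0 (3 * n)%N) (A0 (9 * n)%N).
move: (A ^+ (2 * 12)) (A ^+ (3 * n)) (A ^+ (9 * n)) => a b d a0 b0 d0.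
have s1 : (-1) ^+ n * (-1) ^+ n = 1 :> F by rewrite -exprD addnn -mul2n exprM sqrrN !expr1n.
move: ((-1) ^+ n) s1 => s s1.
have s0 : s != 0 by apply: contra_eq_neq s1 => ->; rewrite mul0r eq_sym oner_neq0.
have sV : s^-1 = s by apply: (mulfI s0); rewrite mulfV // s1.
by rewrite -[in RHS]sV; field; rewrite a0 b0 d0 s0.
Qed.

End JonesValue.

(** If |u| = 1, then 3 = |u^2 + 1| <= 2. *)
Lemma norm_u_neq1 (u : algC) : u ^+ 2 + 3%:R * u + 1 = 0 -> `|u| != 1.
Proof.
move=> uE; apply/eqP => u1.
have : 3%:R * u = - (u ^+ 2 + 1) by apply/eqP; rewrite -subr_eq0 -[X in _ == X]uE; apply/eqP; ring.
move/(congr1 Num.norm); rewrite normrM normrN u1 mulr1 normr_nat => e3.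
have := ler_normD (u ^+ 2) 1; rewrite -e3 normrX u1 normr1 expr1n.
by rewrite -[1 + 1]/(2%:R) ler_nat.
Qed.

Lemma dot3_eigen_neq0 (u : algC) : u ^+ 2 + 3%:R * u + 1 = 0 -> dot3 u eigen3 != 0.
Proof.
move=> uE.
have u_eq : u ^+ 2 = - (3%:R * u) - 1.
  by apply/eqP; rewrite -subr_eq0 -[X in _ == X]uE; apply/eqP; ring.
pose g := zu_add (zu_add (zu_mul eigen3.1.1 outer0) (zu_mul eigen3.1.2 outer1))
                 (zu_mul eigen3.2 outer2).
have H (a b d x y w : zu) : zu_val u (zu_add (zu_add (zu_mul a x) (zu_mul b y)) (zu_mul d w))
    = zu_val u a * zu_val u x + zu_val u b * zu_val u y + zu_val u d * zu_val u w.
  by rewrite !zu_valD !(zu_valM u_eq).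
have -> : dot3 u eigen3 = zu_val u g by exact: (esym (H _ _ _ _ _ _)).
(* The conjugate of [g], the other root being - 3 - u; their product is an integer, which is
   computed to be nonzero. *)
pose g' : zu := (Z.sub g.1 (Z.mul (Zpos 3) g.2), Z.opp g.2).
suff : zu_val u (zu_mul g g') != 0 by rewrite zu_valM // mulf_eq0 negb_or => /andP[].
have -> : zu_mul g g' = (Z.sub (Z.mul g.1 g'.1) (Z.mul g.2 g'.2), Z0) by vm_compute.
rewrite /zu_val; cbn [fst snd]; rewrite mul0r addr0 intr_eq0.
by apply/eqP => /(congr1 Z_of_int); rewrite int_of_ZK; vm_compute.
Qed.

(** The increments of the normalised values [V] form a geometric progression of ratio u^6, so equal
    values force u^(6n) = u^(6m). *)
Lemma jones_injective n m : jones (Kn n) = jones (Kn m) -> n = m.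
Proof.
move=> eqJ.
pose s := sqrtC 5%:R : algC; have s2 : s ^+ 2 = 5%:R by rewrite sqrtCK.
(* A root of u^2 + 3u + 1, so that - A^2 - A^-2 = 3. *)
pose u : algC := (s - 3%:R) / 2%:R.
have uE : u ^+ 2 + 3%:R * u + 1 = 0.
  have -> : u ^+ 2 + 3%:R * u + 1 = (s ^+ 2 - 5%:R) / 4%:R by rewrite /u; field.
  by rewrite s2 subrr mul0r.
pose A := sqrtC u; have A2 : A ^+ 2 = u by rewrite sqrtCK.
have u0 : u != 0.
  by apply: contra_eq_neq uE => ->; rewrite expr0n mulr0 !add0r oner_neq0.
have A0 : A != 0 by apply: contraNneq u0 => A0; rewrite -A2 A0 expr0n.
have A4 : A ^+ 4 + 3%:R * A ^+ 2 + 1 = 0 by rewrite -[4%N]/(2 * 2)%N exprM A2.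
have u_eq := u_relation A4; rewrite A2 in u_eq.
pose V k := (-1) ^+ k * u ^- (6 * k) * dot3 u (twist_coef (3 * k).+1).
have VJ k : exists2 J, laurent_eval A (jones (Kn k)) J & 3%:R * J * u ^+ 12 = V k.
  by have := jones_value k A0 A4; rewrite A2.
have [J1 ev1 V1] := VJ n; have [J2 ev2 V2] := VJ m.
rewrite eqJ in ev1; have eJ := laurent_eval_inj A0 ev1 ev2.
have {V1 V2 eJ} eqV : V n = V m by rewrite -V1 -V2 eJ.
pose g := dot3 u eigen3.
have Vrec k : V k.+1 - V k = - (u ^- 6 * (u ^+ 6) ^+ k * g).
  have rec := dot3_rec u_eq k; rewrite -/g in rec.
  have -> : V k.+1 - V k = - ((-1) ^+ k * u ^- (6 * k.+1)) *
     (dot3 u (twist_coef (3 * k.+1).+1) + u ^+ 6 * dot3 u (twist_coef (3 * k).+1)).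
    rewrite /V exprS (mulnS 6 k) exprD.
    move: (dot3 u _) (dot3 u _) => D1 D2.
    have : u ^+ 6 != 0 by rewrite expf_neq0.
    have : u ^+ (6 * k) != 0 by rewrite expf_neq0.
    move: (u ^+ 6) (u ^+ (6 * k)) ((-1) ^+ k) => a b e b0 a0.
    by field; rewrite a0 b0.
  have u12 : (- u ^+ 12) ^+ k = (-1) ^+ k * (u ^+ (6 * k) * u ^+ (6 * k)).
    by rewrite (exprNn (u ^+ 12)) -exprM -exprD; congr (_ * u ^+ _); lia.
  have s1 : (-1) ^+ k * (-1) ^+ k = 1 :> algC by rewrite -exprD addnn -mul2n exprM sqrrN !expr1n.
  rewrite rec u12 (mulnS 6 k) exprD -exprM.
  have : u ^+ 6 != 0 by rewrite expf_neq0.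
  have : u ^+ (6 * k) != 0 by rewrite expf_neq0.
  move: (u ^+ 6) (u ^+ (6 * k)) ((-1) ^+ k) s1 => a b s' s1 b0 a0.
  transitivity (- ((s' * s') * a^-1 * b * g)); last by rewrite s1 mul1r.
  by field; rewrite a0 b0.
have Vclosed k : (u ^+ 6 - 1) * (V k - V 0%N) = - (u ^- 6 * g) * ((u ^+ 6) ^+ k - 1).
  elim: k => [|k IH]; first by rewrite subrr expr0 subrr !mulr0.
  have -> : V k.+1 - V 0%N = (V k.+1 - V k) + (V k - V 0%N) by ring.
  by rewrite mulrDr IH Vrec [(u ^+ 6) ^+ k.+1]exprS; ring.
have g0 : g != 0 by exact: dot3_eigen_neq0.
have pow_eq : (u ^+ 6) ^+ n = (u ^+ 6) ^+ m.
  have c0 : - (u ^- 6 * g) != 0 by rewrite oppr_eq0 mulf_neq0 ?invr_eq0 ?expf_neq0.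
  have := Vclosed n; rewrite eqV Vclosed => /(mulfI c0)/addIr eqp.
  exact: esym eqp.
have /(congr1 Num.norm) := pow_eq; rewrite !normrX => e.
have u6 : `|u| ^+ 6 != 1.
  by rewrite pexpr_eq1 // ?normr_ge0 // (norm_u_neq1 uE).
by apply: (ieexprIn _ u6) e; rewrite exprn_gt0 // normr_gt0.
Qed.

Theorem theorem1p1 :
  (forall n : nat, is_knot (Kn n) /\ alexander_trivial (Kn n)) /\
  (forall n m : nat, n <> m -> jones (Kn n) <> jones (Kn m)).
Proof.
split=> [n|n m neq]; first by split; [exact: is_knot_Kn | exact: alexander_trivial_Kn].
by move/jones_injective.
Qed.
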